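(* Let $a\in\mathcal{S}'(\mathbb{R}^{2n})$ and let $\operatorname{Op}_{\mathrm{BJ}}(a)$ be the Born--Jordan operator with symbol $a$. Then $$\widehat{S}\,\operatorname{Op}_{\mathrm{BJ}}(a)\,\widehat{S}^{-1}=\operatorname{Op}_{\mathrm{BJ}}(a\circ s^{-1})$$ for every $\widehat{S}$ in the subgroup of the metaplectic group $\operatorname{Mp}(2n,\mathbb{R})$ generated by the operators $\widehat{J}$ and $\widehat{M}_{L,m}$ ($L\in GL(n,\mathbb{R})$, $m$ an admissible integer for $L$), where $s=\pi^{\operatorname{Mp}}(\widehat{S})\in\operatorname{Sp}(2n,\mathbb{R})$.
   Context: Fix $\hbar>0$. Write $z=(x,p)\in\mathbb{R}^n\times\mathbb{R}^n=\mathbb{R}^{2n}$, $px=p\cdot x$, $\sigma(z,z')=p\cdot x'-p'\cdot x$, and $J=\begin{pmatrix}0&I\\-I&0\end{pmatrix}$. $\operatorname{Sp}(2n,\mathbb{R})$ is the group of linear automorphisms $s$ of $\mathbb{R}^{2n}$ with $s^TJs=J$. Symplectic Fourier transform: $a_\sigma(z)=\mathcal{F}_\sigma a(z)=(2\pi\hbar)^{-n}\int_{\mathbb{R}^{2n}}e^{-\frac{i}{\hbar}\sigma(z,z')}a(z')\,dz'$, extended to $\mathcal{S}'(\mathbb{R}^{2n})$ as usual. Heisenberg operators: $\widehat{T}(z_0)\psi(x)=e^{\frac{i}{\hbar}(p_0\cdot x-\frac12 p_0\cdot x_0)}\psi(x-x_0)$ for $z_0=(x_0,p_0)$. Let $\Theta(z)=\dfrac{\sin(px/2\hbar)}{px/2\hbar}$,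 with value $1$ where $px=0$. The Born--Jordan operator with symbol $a\in\mathcal{S}'(\mathbb{R}^{2n})$ is the continuous operator $\mathcal{S}(\mathbb{R}^n)\to\mathcal{S}'(\mathbb{R}^n)$ $$\operatorname{Op}_{\mathrm{BJ}}(a)\psi=(2\pi\hbar)^{-n}\int_{\mathbb{R}^{2n}}a_\sigma(z)\Theta(z)\widehat{T}(z)\psi\,dz,$$ the integral being understood in the weak (distributional) sense. The metaplectic group $\operatorname{Mp}(2n,\mathbb{R})$ is a group of unitary operators on $L^2(\mathbb{R}^n)$ (restricting to automorphisms of $\mathcal{S}(\mathbb{R}^n)$ and extending to automorphisms of $\mathcal{S}'(\mathbb{R}^n)$), which is a double cover of $\operatorname{Sp}(2n,\mathbb{R})$ with covering homomorphism $\pi^{\operatorname{Mp}}$. The elements in question are $\widehat{J}=e^{-in\pi/4}\mathcal{F}$, where $\mathcal{F}\psi(p)=(2\pi\hbar)^{-n/2}\int_{\mathbb{R}^n} e^{-\frac{i}{\hbar}p\cdot x}\psi(x)\,dx$, and $\widehat{M}_{L,m}\psi(x)=i^m\sqrt{|\det L|}\,\psi(Lx)$, where $L\in GL(n,\mathbb{R})$ and the integer $m$ corresponds to a choice of argument of $\det L$ ($m\pi\equiv\arg\det L \bmod 2\pi$). Their projections are $\pi^{\operatorname{Mp}}(\widehat{J})=J$ and $\pi^{\operatorname{Mp}}(\widehat{M}_{L,m})=\begin{pmatrix}L^{-1}&0\\0&L^T\end{pmatrix}$. *)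

(* Defs.v *)
From HB Require Import structures.
From mathcomp Require Import all_boot all_order all_algebra.
From mathcomp Require Import all_classical all_reals all_analysis.
From mathcomp Require Import complex.

Set Implicit Arguments.
Unset Strict Implicit.
Unset Printing Implicit Defensive.
Import Order.TTheory GRing.Theory Num.Theory.
Import numFieldNormedType.Exports.

Local Open Scope classical_set_scope.
Local Open Scope ring_scope.
Local Open Scope complex_scope.

Section lebesgue_step.
Context (R : realType) (n : nat).
Local Notation mR := (measurableTypeR R).
Variable mu : {sigma_finite_measure set (n.-tuple mR) -> \bar R}.

Definition tcons (u : mR * n.-tuple mR) : n.+1.-tuple mR :=
  [tuple of u.1 :: u.2].

Lemma measurable_tcons : measurable_fun [set: mR * n.-tuple mR] tcons.
Proof. by apply: measurable_cons. Qed.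

Definition lebesgue_step : set (n.+1.-tuple mR) -> \bar R :=
  pushforward (@lebesgue_measure R \x mu)%E tcons.

Let step_m : {measure set (n.+1.-tuple mR) -> \bar R} :=
  measure_function_pushforward__canonical__measure_function_Measure
  ((@lebesgue_measure R \x mu)%E) measurable_tcons.

Let step0 : lebesgue_step set0 = 0%E.
Proof. exact: (measure0 step_m). Qed.
Let step_ge0 A : (0 <= lebesgue_step A)%E.
Proof. exact: (measure_ge0 step_m). Qed.
Let step_sigma : semi_sigma_additive lebesgue_step.
Proof. exact: (@measure_semi_sigma_additive _ _ _ step_m). Qed.

HB.instance Definition _ := isMeasure.Build _ _ _ lebesgue_step
  step0 step_ge0 step_sigma.

Let step_sigma_finite : sigma_finite setT lebesgue_step.
Proof.
have /sigma_finiteP[F [TF ndF Foo]] := sigma_finiteT (@lebesgue_measure R).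
have /sigma_finiteP[G [TG ndG Goo]] := sigma_finiteT mu.
pose unc (t : n.+1.-tuple mR) : (mR * n.-tuple mR)%type :=
  (thead t, [tuple of behead t]).
have munc : measurable_fun setT unc.
  apply/measurable_fun_pair; first exact: measurable_tnth.
  exact: measurable_behead.
have tconsK : cancel tcons unc.
  by move=> [x t]; rewrite /unc theadE; congr pair; exact: val_inj.
exists (fun k => unc @^-1` (F k `*` G k)).
  apply/seteqP; split => // t _.
  have [i _ Fi] : (\bigcup_k F k) (unc t).1 by rewrite -TF.
  have [j _ Gj] : (\bigcup_k G k) (unc t).2 by rewrite -TG.
  exists (maxn i j) => //; split.
    by move: Fi; exact/subsetPset/ndF/leq_maxl.
  by move: Gj; exact/subsetPset/ndG/leq_maxr.
move=> k; have [mF Fk] := Foo k; have [mG Gk] := Goo k; split.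
  by rewrite -[X in measurable X]setTI; apply: munc => //; exact: measurableX.
rewrite /lebesgue_step /pushforward (_ : _ @^-1` _ = F k `*` G k); last first.
  by apply/funext => u; rewrite /preimage /mkset tconsK.
by rewrite product_measure1E// lte_mul_pinfty// ge0_fin_numE.
Qed.

HB.instance Definition _ := Measure_isSigmaFinite.Build _ _ _ lebesgue_step
  step_sigma_finite.

End lebesgue_step.

(* Lebesgue measure on R^n, as the n-fold product of the Lebesgue measure on R;
   the library has Borel sets on n-tuples but not on column vectors. *)
Fixpoint lebesgue_tuple (R : realType) (n : nat) :
    {sigma_finite_measure set (n.-tuple (measurableTypeR R)) -> \bar R} :=
  match n with
  | 0 => \d_ ([tuple] : 0.-tuple (measurableTypeR R))
  | m.+1 => lebesgue_step (lebesgue_tuple R m)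
  end.

Section born_jordan.
Context (R : realType) (hbar : R).

Definition cfun (m : nat) := 'cV[R]_m -> R[i].

Definition re_fun m (f : cfun m) (x : 'cV[R]_m) : R := complex.Re (f x).
Definition im_fun m (f : cfun m) (x : 'cV[R]_m) : R := complex.Im (f x).

Definition integral_cV m (f : 'cV[R]_m -> R) : R :=
  \int[lebesgue_tuple R m]_t f (\col_i tnth t i).

Definition cintegral m (f : cfun m) : R[i] :=
  integral_cV (re_fun f) +i* integral_cV (im_fun f).

Definition cis (t : R) : R[i] := cos t +i* sin t.

Definition dot m (x y : 'cV[R]_m) : R := \sum_i x i 0 * y i 0.

Fixpoint partial m (l : seq 'I_m) (f : 'cV[R]_m -> R) : 'cV[R]_m -> R :=
  if l is i :: l' then fun x => 'D_(delta_mx i 0) (partial l' f) x else f.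

Definition smooth m (f : 'cV[R]_m -> R) :=
  forall (l : seq 'I_m) x, differentiable (partial l f) x.

Definition cpartial m (l : seq 'I_m) (f : cfun m) : cfun m :=
  fun x => partial l (re_fun f) x +i* partial l (im_fun f) x.

Definition schwartz m (f : cfun m) :=
  [/\ smooth (re_fun f), smooth (im_fun f) &
    forall (N : nat) (l : seq 'I_m), exists C : R, forall x,
      (1 + `|x|) ^+ N * Normc.normc (cpartial l f x) <= C].

Definition seminorm m (N : nat) (f : cfun m) : R :=
  sup [set r | exists l : seq 'I_m, exists x : 'cV[R]_m, (size l <= N)%N /\
    r = (1 + `|x|) ^+ N * Normc.normc (cpartial l f x)].

(* A functional is defined on all functions, but only its values on Schwartz
   functions are constrained or compared: two functionals are the same
   distribution iff they are related by [dist_eq]. *)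
Definition functional (m : nat) := cfun m -> R[i].

Definition tempered m (u : functional m) :=
  (forall (c : R[i]) f g, schwartz f -> schwartz g ->
     u (fun x => c * f x + g x) = c * u f + u g) /\
  (exists C : R, exists N : nat, forall f, schwartz f ->
     Normc.normc (u f) <= C * seminorm N f).

Definition dist_eq m (u v : functional m) := forall f, schwartz f -> u f = v f.

(* The pairing of distributions with test functions is bilinear; for a function
   u and invertible A,
   <u o A, f> = \int u(A z) f(z) dz = |det A|^-1 <u, f o A^-1>. *)
Definition dist_comp m (u : functional m) (A : 'M[R]_m) : functional m :=
  fun f => (`|\det A|^-1)%:C * u (fun z => f (invmx A *m z)).

(* Points of phase space are z = col_mx x p, so x = usubmx z, p = dsubmx z. *)
Section phase_space.
Variable n : nat.

Definition symp_form (z z' : 'cV[R]_(n + n)) : R :=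
  dot (dsubmx z) (usubmx z') - dot (dsubmx z') (usubmx z).

Definition symp_fourier (f : cfun (n + n)) : cfun (n + n) := fun z =>
  ((2 * pi * hbar) ^- n)%:C *
  cintegral (fun z' => cis (- (symp_form z z' / hbar)) * f z').

(* As symp_form is antisymmetric, Fubini gives
   \int (F a)(z) f(z) dz = \int a(z') (F f)(- z') dz' for functions a. *)
Definition dsymp_fourier (a : functional (n + n)) : functional (n + n) :=
  fun f => a (fun z => symp_fourier f (- z)).

Definition heisenberg (z : 'cV[R]_(n + n)) (psi : cfun n) : cfun n := fun x =>
  cis ((dot (dsubmx z) x - dot (dsubmx z) (usubmx z) / 2) / hbar) *
  psi (x - usubmx z).

Definition Theta (z : 'cV[R]_(n + n)) : R :=
  let t := dot (dsubmx z) (usubmx z) / (2 * hbar) in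
  if t == 0 then 1 else sin t / t.

Definition OpBJ (a : functional (n + n)) (psi : cfun n) : functional n :=
  fun phi => ((2 * pi * hbar) ^- n)%:C *
    dsymp_fourier a (fun z =>
      (Theta z)%:C * cintegral (fun x => heisenberg z psi x * phi x)).

(* Metaplectic operators are represented by their action on Schwartz functions,
   which determines the unitary operator on L^2; values elsewhere are junk. *)
Definition operator := cfun n -> cfun n.

(* The inverse of S as a bijection of the Schwartz space onto itself. *)
Definition op_inv (S : operator) : operator := fun psi =>
  xget (fun=> 0) [set chi | schwartz chi /\ S chi = psi].

(* Extension of a unitary operator to distributions: for functions u, with
   (f, g) = \int f (conj g), one has
   \int (S u) phi = (S u, conj phi) = (u, S^-1 (conj phi))
                  = \int u (conj (S^-1 (conj phi))). *)
Definition op_ext (S : operator) (u : functional n) : functional n :=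
  fun phi => u (fun x => (op_inv S (fun y => (phi y)^*) x)^*).

Definition fourier (psi : cfun n) : cfun n := fun p =>
  ((Num.sqrt (2 * pi * hbar)) ^- n)%:C *
  cintegral (fun x => cis (- (dot p x / hbar)) * psi x).

Definition Jhat : operator := fun psi p =>
  cis (- (n%:R * pi / 4)) * fourier psi p.

(* m pi = arg (det L) modulo 2 pi *)
Definition admissible (L : 'M[R]_n) (m : int) :=
  L \in unitmx /\ (-1) ^ m = Num.sg (\det L).

Definition Mhat (L : 'M[R]_n) (m : int) : operator := fun psi x =>
  ((0 : R) +i* 1) ^ m * (Num.sqrt `|\det L|)%:C * psi (L *m x).

Definition Vhat (P : 'M[R]_n) : operator := fun psi x =>
  cis (dot (P *m x) x / (2 * hbar)) * psi x.

Definition Jmx : 'M[R]_(n + n) := block_mx 0 1%:M (- 1%:M) 0.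

(* Mp(2n,R) is the group generated by the operators Jhat, Mhat L m and Vhat P
   with P symmetric. [Mp_proj S s] is the graph of the covering homomorphism:
   S is in Mp(2n,R) and s in Sp(2n,R) is its projection. *)
Inductive Mp_proj : operator -> 'M[R]_(n + n) -> Prop :=
| Mp_proj_J : Mp_proj Jhat Jmx
| Mp_proj_M L m : admissible L m ->
    Mp_proj (Mhat L m) (block_mx (invmx L) 0 0 L^T)
| Mp_proj_V P : P^T = P -> Mp_proj (Vhat P) (block_mx 1%:M 0 P 1%:M)
| Mp_proj_comp S S' s s' : Mp_proj S s -> Mp_proj S' s' ->
    Mp_proj (S \o S') (s *m s')
| Mp_proj_inv S s : Mp_proj S s -> Mp_proj (op_inv S) (invmx s)
| Mp_proj_eq S S' s : (forall psi, schwartz psi -> S psi = S' psi) ->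
    Mp_proj S s -> Mp_proj S' s.

(* The subgroup of Mp(2n,R) generated by Jhat and the Mhat L m. *)
Inductive JM_group : operator -> Prop :=
| JM_J : JM_group Jhat
| JM_M L m : admissible L m -> JM_group (Mhat L m)
| JM_comp S S' : JM_group S -> JM_group S' -> JM_group (S \o S')
| JM_inv S : JM_group S -> JM_group (op_inv S)
| JM_eq S S' : (forall psi, schwartz psi -> S psi = S' psi) ->
    JM_group S -> JM_group S'.

Lemma JM_group_Mp S : JM_group S -> exists s, Mp_proj S s.
Proof.
elim=> [|L m Lm|S1 S2 _ [s1 h1] _ [s2 h2]|S1 _ [s h]|S1 S2 e _ [s h]].
- by exists Jmx; exact: Mp_proj_J.
- by eexists; exact: Mp_proj_M Lm.
- by eexists; exact: Mp_proj_comp h1 h2.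
- by eexists; exact: Mp_proj_inv h.
- by exists s; exact: Mp_proj_eq e h.
Qed.

Lemma Mp_proj_symplectic S s : Mp_proj S s -> s^T *m Jmx *m s = Jmx.
Proof.
elim=> {S s} [|L m [Lu _]|P PT|S S' s s' _ h _ h'|S s _ h|S S' s _ _ //].
- rewrite /Jmx tr_block_mx !mulmx_block !linearN /= !trmx0 !trmx1.
  by rewrite !(mulmx0, mul0mx, mulmx1, mul1mx, mulNmx, mulmxN, addr0, add0r,
    opprK, oppr0).
- rewrite /Jmx tr_block_mx !mulmx_block /= !trmx0 trmxK.
  rewrite !(mulmx0, mul0mx, mulmx1, mul1mx, mulNmx, mulmxN, addr0, add0r).
  by rewrite -trmx_mul mulmxV// trmx1.
- rewrite /Jmx tr_block_mx !mulmx_block /= !trmx0 !trmx1 PT.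
  rewrite !(mulmx0, mul0mx, mulmx1, mul1mx, mulNmx, mulmxN, addr0, add0r, oppr0).
  by rewrite addNr.
- by rewrite trmx_mul !mulmxA -(mulmxA s'^T) -(mulmxA s'^T) h h'.
- have su : s \in unitmx.
    have JJ : Jmx *m Jmx = - 1%:M :> 'M[R]_(n + n).
      rewrite /Jmx mulmx_block.
      rewrite !(mulmx0, mul0mx, mulmx1, mul1mx, mulNmx, mulmxN, addr0, add0r).
      by rewrite scalar_mx_block opp_block_mx !oppr0.
    have : - (Jmx *m s^T *m Jmx) *m s = 1%:M.
      by rewrite mulNmx -!mulmxA (mulmxA s^T) h JJ opprK.
    by move=> /mulmx1_unit[].
  by rewrite -{1}h trmx_inv !mulmxA mulVmx ?unitmx_tr// mul1mx mulmxK.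
Qed.

End phase_space.
End born_jordan.

(* Main.v *)
(* A metaplectic operator S over s satisfies S T(z) = T(s z) S, so conjugating the
   superposition of the T(z) with weight a_sigma Theta by S amounts to the change
   of variables z -> s z, which has determinant +-1 and commutes with the symplectic
   Fourier transform.  What remains is Theta o s = Theta: Theta is an even function
   of p.x, which J changes into - p.x and the dilations leave invariant.  This is
   known for the matrix read off a word in J and the dilations, and s is that
   matrix, because T(w) psi = T(w') psi with psi <> 0 forces w = w': |psi| would be
   periodic if the positions differed, and conjugating by J exchanges positions
   and momenta.

   The distribution a is thus evaluated at two equal test functions; the change of
   variables behind this equality is needed for functions that are not known to be
   measurable.

   Unitarity and bijectivity of J on Schwartz functions come from Fourier inversion,
   obtained by inserting exp(- eps (|p_1| + ... + |p_n|)), whose Fourier transform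
   is a product of Poisson kernels, and letting eps tend to 0. *)

Require Import Defs.
From HB Require Import structures.
From mathcomp Require Import all_boot all_order all_algebra.
From mathcomp Require Import all_classical all_reals all_analysis.
From mathcomp Require Import measurable_realfun complex.
From mathcomp Require Import ring lra.

Set Implicit Arguments.
Unset Strict Implicit.
Unset Printing Implicit Defensive.
Import Order.TTheory GRing.Theory Num.Theory.
Import numFieldNormedType.Exports.

Local Open Scope classical_set_scope.
Local Open Scope ring_scope.

(** * Change of variables *)

(** Along the generation of [Mp_proj] two invariants are carried: bijectivity on Schwartz functions,
    which gives meaning to the choice in [op_inv], and isometry, which lets [S] cross the pairing in
    [op_ext]. For [Jhat] both rest on the inversion formula.

    An exponential regulariser is used because the integrals it leads to have elementary
    antiderivatives. The Poisson kernel that results is, up to scaling, the function [dec], which is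
    also the common majorant for Fubini and dominated convergence.

    Lebesgue measure on columns is an iterated product. Invertible matrices are therefore split by
    block elimination into factors that move only the head coordinate or only the tail, and Tonelli
    treats each factor fibre by fibre.

    The matrix [s] of the theorem and the matrix s0 read off the word are compared through T(s z)
    psi = T(s0 z) psi. This says nothing for psi = 0, a case in which both sides vanish. *)

Section transfer.
Context d1 d2 (X : measurableType d1) (Y : measurableType d2) (R : realType).
Variables (mu : {measure set X -> \bar R}) (nu : {measure set Y -> \bar R}).
Local Open Scope ereal_scope.
Import HBNNSimple.

Definition transfers (phi : X -> Y) (c : R) :=
  measurable_fun [set: X] phi /\
  forall g : Y -> \bar R, measurable_fun [set: Y] g -> (forall y, 0 <= g y) ->
    \int[mu]_x g (phi x) = c%:E * \int[nu]_y g y.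

(** What the integral of a nonnegative function unfolds to, whether or not the function is
    measurable. *)
Let nnint d (T : measurableType d) (m : set T -> \bar R) f :=
  ereal_sup [set sintegral m h |
    h in [set h : {nnsfun T >-> R} | forall x, (h x)%:E <= f x]].

(** A simple function [h] below [f] yields the simple function [h \o phi] below [f \o phi], with
    integral multiplied by [c]. Only one inequality results, as a simple function below [f \o phi]
    need not factor through [phi]. *)
Lemma transfers_nn phi (c : R) (f : Y -> \bar R) : (0 < c)%R ->
  transfers phi c ->
  c%:E * nnint nu f <= nnint mu (f \o phi).
Proof.
move=> c0 [mphi phiP].
rewrite -lee_pdivlMl//; apply: ge_ereal_sup => _ [h hf <-].
rewrite lee_pdivlMl//.
have fin : finite_set (range (h \o phi)).
  by apply: sub_finite_set (fimfunP h) => _ [x _ <-]; exists (phi x).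
have mh : measurable_fun [set: X] (h \o phi) by exact: measurableT_comp.
have h0 x : (0 <= (h \o phi) x)%R by exact: fun_ge0.
pose hphi : {nnsfun X >-> R} := HB.pack (h \o phi)
  (isMeasurableFun.Build _ _ _ _ _ mh)
  (FiniteImage.Build _ _ _ fin) (isNonNegFun.Build _ _ _ h0).
apply: ereal_sup_ubound; exists hphi; first by move=> x; exact: hf.
rewrite -2!integralT_nnsfun.
apply: (phiP (EFin \o h)) => /=; first exact/measurable_EFinP.
by move=> y; rewrite lee_fin; exact: fun_ge0.
Qed.

End transfer.

Section transfer_bijective.
Context d1 d2 (X : measurableType d1) (Y : measurableType d2) (R : realType).
Variables (mu : {measure set X -> \bar R}) (nu : {measure set Y -> \bar R}).
Variables (phi : X -> Y) (psi : Y -> X) (c : R).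
Hypotheses (psiK : cancel psi phi) (c0 : 0 < c).
Hypotheses (phiP : transfers mu nu phi c) (psiP : transfers nu mu psi c^-1).
Local Open Scope ereal_scope.

(* [f] is arbitrary: the simple functions below [f] and those below [f \o phi]
   are transported into each other by [psi] and [phi]. *)
Let ge0_integral_bijective (f : Y -> \bar R) : (forall y, 0 <= f y) ->
  \int[mu]_x f (phi x) = c%:E * \int[nu]_y f y.
Proof.
move=> f0; rewrite !ge0_integralTE//.
apply/eqP; rewrite eq_le; apply/andP; split; last exact: transfers_nn.
have ci0 : (0 < c^-1)%R by rewrite invr_gt0.
rewrite -lee_pdivrMl//; apply: le_trans (transfers_nn _ ci0 psiP) _.
by rewrite (_ : _ \o psi = f)//; apply/funext => y /=; rewrite psiK.
Qed.

Lemma integral_bijective (f : Y -> \bar R) :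
  \int[mu]_x f (phi x) = c%:E * \int[nu]_y f y.
Proof.
rewrite integralE [in RHS]integralE.
have -> : (fun x => f (phi x))^\+ = (fun x => f^\+ (phi x)).
  by apply/funext => x; rewrite !funeposE.
have -> : (fun x => f (phi x))^\- = (fun x => f^\- (phi x)).
  by apply/funext => x; rewrite !funenegE.
rewrite !ge0_integral_bijective//.
have := @integral_ge0 _ _ _ nu setT _ (fun x _ => funepos_ge0 f x).
have := @integral_ge0 _ _ _ nu setT _ (fun x _ => funeneg_ge0 f x).
(* Distributivity over an extended difference is checked case by case, so that +oo - +oo, possible
   for a non-integrable [f], is covered too. *)
move: (integral _ _ _) (integral _ _ _) => [b| |] [a| |] //;
  rewrite ?leeNy_eq// => _ _.
- by rewrite -[LHS]/((c * b - c * a)%:E) -mulrBr EFinM.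
- by rewrite gt0_muley//= gt0_muleNy.
- by rewrite gt0_muley//= gt0_muley.
- by rewrite gt0_muley//= gt0_muleNy.
Qed.

End transfer_bijective.

(** * Integrals over columns, one coordinate at a time *)

Section columns.
Context (R : realType).
Local Notation mR := (measurableTypeR R).
Local Open Scope ereal_scope.

Definition colt n (t : n.-tuple mR) : 'cV[R]_n := (\col_i tnth t i)%R.
Definition tcol n (x : 'cV[R]_n) : n.-tuple mR := [tuple x i ord0 | i < n].

Lemma coltK n : cancel (@colt n) (@tcol n).
Proof. by move=> t; apply: eq_from_tnth => i; rewrite tnth_mktuple mxE. Qed.

Lemma tcolK n : cancel (@tcol n) (@colt n).
Proof. by move=> x; apply/colP => i; rewrite mxE tnth_mktuple. Qed.

(** [col_mx] builds a column of size [1 + n], convertible with [n.+1] but not syntactically equal to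
    it; hence the explicit sizes in later uses of block lemmas. *)
Definition ccons n (x : R) (y : 'cV[R]_n) : 'cV[R]_n.+1 :=
  col_mx (x%:M : 'cV[R]_1) y.

Lemma colt_tcons n (x : R) (t : n.-tuple mR) :
  colt (tcons (x, t)) = ccons x (colt t).
Proof.
apply/colP => i; rewrite mxE /ccons; case: (unliftP ord0 i) => [j|] ->.
  rewrite tnthS (_ : lift ord0 j = rshift 1 j :> 'I_(1 + n)); last exact: val_inj.
  by rewrite (@col_mxEd _ 1) mxE.
rewrite tnth0 [in RHS](_ : ord0 = lshift n ord0 :> 'I_(1 + n)); last exact: val_inj.
by rewrite (@col_mxEu _ 1) mxE.
Qed.

Lemma cconsE n (z : 'cV[R]_n.+1) :
  z = ccons (z ord0 ord0) (dsubmx (z : 'cV[R]_(1 + n))).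
Proof.
rewrite /ccons -[LHS](@vsubmxK _ 1 n); congr (@col_mx _ 1 n 1 _ _).
by apply/colP => i; rewrite ord1 !mxE; congr (z _ _); apply/val_inj.
Qed.

Definition eint n (g : 'cV[R]_n -> \bar R) :=
  \int[lebesgue_tuple R n]_t g (colt t).

Definition meas_cV n (g : 'cV[R]_n -> \bar R) :=
  measurable_fun [set: n.-tuple mR] (g \o @colt n).

(** Measurability is tested coordinatewise after pulling back to tuples, because the Borel sets live
    on tuples and not on columns. *)
Definition meas_map n m (phi : 'cV[R]_n -> 'cV[R]_m) :=
  forall i, measurable_fun [set: n.-tuple mR] (fun t => phi (colt t) i ord0 : mR).

Lemma meas_mapP n m (phi : 'cV[R]_n -> 'cV[R]_m) : meas_map phi ->
  measurable_fun [set: n.-tuple mR] (fun t => tcol (phi (colt t))).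
Proof.
move=> mphi; apply/measurable_fun_tnthP => i.
apply: eq_measurable_fun (mphi i) => t _ /=.
by rewrite tnth_mktuple.
Qed.

Lemma meas_cV_comp n m (phi : 'cV[R]_n -> 'cV[R]_m) g :
  meas_map phi -> meas_cV g -> meas_cV (g \o phi).
Proof.
move=> /meas_mapP mphi mg.
rewrite /meas_cV (_ : _ \o _ = (g \o @colt m) \o (fun t => tcol (phi (colt t)))).
  exact: measurableT_comp.
by apply/funext => t /=; rewrite tcolK.
Qed.

Lemma meas_cV_ccons n (g : 'cV[R]_n.+1 -> \bar R) : meas_cV g ->
  measurable_fun [set: mR * n.-tuple mR] (fun u => g (ccons u.1 (colt u.2))).
Proof.
move=> mg; rewrite (_ : (fun u => _) = (g \o @colt _) \o @tcons R n).
  by apply: measurableT_comp => //; exact: measurable_tcons.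
by apply/funext => -[x t] /=; rewrite colt_tcons.
Qed.

Lemma eintS n (g : 'cV[R]_n.+1 -> \bar R) : meas_cV g -> (forall x, 0 <= g x) ->
  eint g = \int[lebesgue_measure \x lebesgue_tuple R n]_u
             g (ccons u.1 (colt u.2)).
Proof.
move=> mg g0.
(* By definition, the measure in dimension [n.+1] is this pushforward of a product measure. *)
transitivity (\int[pushforward (lebesgue_measure \x lebesgue_tuple R n)
    (@tcons R n)]_t g (colt t)); first by [].
rewrite ge0_integral_pushforward//; first last.
- exact: measurable_tcons.
rewrite preimage_setT; apply: eq_integral => -[x t] _ /=.
by rewrite colt_tcons.
Qed.

(** Tonelli with the head coordinate outside, suited to maps that fix the head; [eintS2] has the
    tail outside, for maps that fix the tail. *)
Lemma eintS1 n (g : 'cV[R]_n.+1 -> \bar R) : meas_cV g -> (forall x, 0 <= g x) ->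
  eint g = \int[lebesgue_measure]_x eint (fun y => g (ccons x y)).
Proof.
move=> mg g0; rewrite eintS// fubini_tonelli1//.
exact: meas_cV_ccons.
Qed.

Lemma eintS2 n (g : 'cV[R]_n.+1 -> \bar R) : meas_cV g -> (forall x, 0 <= g x) ->
  eint g = eint (fun y => \int[lebesgue_measure]_x g (ccons x y)).
Proof.
move=> mg g0; rewrite eintS// fubini_tonelli2//.
exact: meas_cV_ccons.
Qed.

Lemma eint0 (g : 'cV[R]_0 -> \bar R) : meas_cV g -> eint g = g 0%R.
Proof.
move=> mg; rewrite /eint /= integral_dirac// diracT mul1e; congr g.
by apply/colP => -[].
Qed.

End columns.

Section affine.
Context (R : realType).
Local Notation mR := (measurableTypeR R).
Local Open Scope ereal_scope.

Lemma measurable_affine (a b : R) :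
  measurable_fun [set: mR] ((fun x : R => a * x + b)%R : mR -> mR).
Proof.
by apply: continuous_measurable_fun => x; apply: cvgD; [apply: cvgMl_tmp|apply: cvg_cst].
Qed.

(** Lebesgue measure is determined by its values on half-open intervals, so it suffices to compute
    their preimages. *)
Lemma lebesgue_measure_affine (a b : R) (A : set mR) : a != 0%R -> measurable A ->
  lebesgue_measure A = `|a|%:E * pushforward (@lebesgue_measure R)
    ((fun x : R => a * x + b)%R : mR -> mR) A.
Proof.
move=> a0 mA.
pose nu : {measure set mR -> \bar R} :=
  measure_function_pushforward__canonical__measure_function_Measure
    (@lebesgue_measure R) (measurable_affine a b).
pose nu' : {measure set mR -> \bar R} := mscale (NngNum (normr_ge0 a)) nu.
rewrite (@lebesgue_measure_unique R nu')//= => _ [[u v]] _ <-.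
rewrite /mscale/= /pushforward lebesgue_measure_itv/= lte_fin.
have [{}a0|a0'|a0'] := ltgtP a 0%R; last by rewrite a0' eqxx in a0.
(* A negative slope exchanges the open and the closed end of the interval. *)
- rewrite (_ : _ @^-1` _ = `[((v - b) / a)%R, ((u - b) / a)%R[%classic); last first.
    apply/seteqP; split=> x /=; rewrite !in_itv/= ler_ndivrMr// ltr_ndivlMr//.
      by rewrite [(x * a)%R]mulrC => /andP[? ?]; apply/andP; split; lra.
    by rewrite [(x * a)%R]mulrC => /andP[? ?]; apply/andP; split; lra.
  rewrite lebesgue_measure_itv/= lte_fin ltr_nM2r ?invr_lt0// ltrD2r.
  case: ifPn => uv; last by rewrite mule0.
  rewrite ltr0_norm// -!EFinD -EFinM; congr (_%:E).
  by field; rewrite lt_eqF.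
- rewrite (_ : _ @^-1` _ = `]((u - b) / a)%R, ((v - b) / a)%R]%classic); last first.
    apply/seteqP; split=> x /=; rewrite !in_itv/= ltr_pdivrMr// ler_pdivlMr//.
      by rewrite [(x * a)%R]mulrC => /andP[? ?]; apply/andP; split; lra.
    by rewrite [(x * a)%R]mulrC => /andP[? ?]; apply/andP; split; lra.
  rewrite lebesgue_measure_itv/= lte_fin ltr_pM2r ?invr_gt0// ltrD2r.
  case: ifPn => uv; last by rewrite mule0.
  rewrite gtr0_norm// -!EFinD -EFinM; congr (_%:E).
  by field; rewrite gt_eqF.
Qed.

Lemma ge0_integral_affine (a b : R) (g : R -> \bar R) : a != 0%R ->
  measurable_fun [set: mR] (g : mR -> _) -> (forall x, 0 <= g x) ->
  \int[@lebesgue_measure R]_x g (a * x + b)%R =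
  `|a|^-1%:E * \int[@lebesgue_measure R]_x g x.
Proof.
move=> a0 mg g0.
pose f := (fun x : R => a * x + b)%R : mR -> mR.
have mf : measurable_fun [set: mR] f by exact: measurable_affine.
pose nu : {measure set mR -> \bar R} :=
  measure_function_pushforward__canonical__measure_function_Measure
    (@lebesgue_measure R) mf.
have -> : \int[@lebesgue_measure R]_x g x = \int[mscale (NngNum (normr_ge0 a)) nu]_x g x.
  by apply: eq_measure_integral => A mA _; exact: (lebesgue_measure_affine b a0 mA).
rewrite ge0_integral_mscale//= muleA -EFinM mulVf ?normr_eq0// mul1e.
by rewrite ge0_integral_pushforward.
Qed.

Definition scales n (phi : 'cV[R]_n -> 'cV[R]_n) (c : R) := meas_map phi /\
  forall g, meas_cV g -> (forall x, 0 <= g x) ->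
    eint (g \o phi) = c%:E * eint g.

Lemma meas_map_comp n (phi psi : 'cV[R]_n -> 'cV[R]_n) :
  meas_map phi -> meas_map psi -> meas_map (phi \o psi).
Proof.
move=> mphi /meas_mapP mpsi i.
rewrite (_ : (fun t => _) =
  (fun t => phi (colt t) i ord0 : mR) \o (fun t => tcol (psi (colt t)))).
  exact: measurableT_comp.
by apply/funext => t /=; rewrite tcolK.
Qed.

Lemma scales_comp n (phi psi : 'cV[R]_n -> 'cV[R]_n) c d :
  scales phi c -> scales psi d -> scales (phi \o psi) (c * d).
Proof.
move=> [mphi phiP] [mpsi psiP]; split; first exact: meas_map_comp.
move=> g mg g0; rewrite (_ : g \o (phi \o psi) = (g \o phi) \o psi)//.
rewrite psiP; first by rewrite phiP// muleA -EFinM (mulrC d).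
  exact: meas_cV_comp.
by move=> x; exact: g0.
Qed.

Lemma integral_cV_scales n (phi psi : 'cV[R]_n -> 'cV[R]_n) c f :
  (0 < c)%R -> cancel psi phi ->
  scales phi c -> scales psi c^-1 ->
  integral_cV (f \o phi) = (c * integral_cV f)%R.
Proof.
move=> c0 psiK [mphi phiP] [mpsi psiP].
pose f' (t : n.-tuple mR) := (f (colt t))%:E.
pose tl (chi : 'cV[R]_n -> 'cV[R]_n) (t : n.-tuple mR) := tcol (chi (colt t)).
have tr chi d : meas_map chi ->
    (forall g, meas_cV g -> (forall x, 0 <= g x) -> eint (g \o chi) = d%:E * eint g) ->
    transfers (lebesgue_tuple R n) (lebesgue_tuple R n) (tl chi) d.
  move=> mchi chiP; split; first exact: meas_mapP.
  move=> g mg g0.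
  have gE : (g \o @tcol R n) \o @colt R n = g.
    by apply/funext => t /=; rewrite coltK.
  rewrite -[in RHS]gE; apply: (chiP (g \o @tcol R n)).
    by rewrite /meas_cV gE.
  by move=> x; exact: g0.
have tlK chi xi : cancel chi xi -> cancel (tl chi) (tl xi).
  by move=> chiK t; rewrite /tl tcolK chiK coltK.
have := integral_bijective (tlK _ _ psiK) c0
  (tr _ _ mphi phiP) (tr _ _ mpsi psiP) f'.
rewrite /f' /integral_cV /Rintegral.
under eq_integral do rewrite /tl tcolK.
(* [Rintegral] sends both infinite values to 0, so the identity persists for a non-integrable
   [f]. *)
move=> ->; move: (integral _ _ _) => [r| |]; first by rewrite -EFinM.
  by rewrite gt0_muley//= mulr0.
by rewrite gt0_muleNy//= mulr0.
Qed.

End affine.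

(** * Translations and invertible matrices *)

Section linear_change.
Context (R : realType).
Local Notation mR := (measurableTypeR R).
Local Open Scope ereal_scope.

Lemma meas_cV_section n (g : 'cV[R]_n.+1 -> \bar R) x : meas_cV g ->
  meas_cV (fun y => g (ccons x y)).
Proof.
move=> /meas_cV_ccons mg.
exact: (measurableT_comp mg (pair1_measurable x)).
Qed.

Lemma measurable_section n (g : 'cV[R]_n.+1 -> \bar R) y : meas_cV g ->
  measurable_fun [set: mR] (fun x : mR => g (ccons x y)).
Proof.
move=> /meas_cV_ccons mg.
have := measurableT_comp mg (pair2_measurable (tcol y)).
by rewrite /comp /= tcolK.
Qed.

Lemma measurable_eint n (g : 'cV[R]_n.+1 -> \bar R) : meas_cV g ->
  (forall x, 0 <= g x) ->
  measurable_fun [set: mR] (fun x : mR => eint (fun y => g (ccons x y))).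
Proof.
move=> /meas_cV_ccons mg g0.
exact: (@measurable_fun_fubini_tonelli_F _ _ _ _ R (lebesgue_tuple R n) _ mg
  (fun u => g0 (ccons u.1 (colt u.2)))).
Qed.

Lemma meas_cV_integral n (g : 'cV[R]_n.+1 -> \bar R) : meas_cV g ->
  (forall x, 0 <= g x) ->
  meas_cV (fun y => \int[lebesgue_measure]_x g (ccons x y)).
Proof.
move=> /meas_cV_ccons mg g0.
exact: (@measurable_fun_fubini_tonelli_G _ _ _ _ R (@lebesgue_measure R) _ mg
  (fun u => g0 (ccons u.1 (colt u.2)))).
Qed.

(** Tonelli over the head coordinate reduces the claim to the maps [f x] on the fibres, which all
    scale by the same [c]. In the companion [scales_fibre_head] the fibres are lines on which the
    map is affine. *)
Lemma scales_fibre_tail n (phi : 'cV[R]_n.+1 -> 'cV[R]_n.+1)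
    (f : R -> 'cV[R]_n -> 'cV[R]_n) (c : R) : (0 <= c)%R ->
  meas_map phi -> (forall x y, phi (ccons x y) = ccons x (f x y)) ->
  (forall x, scales (f x) c) -> scales phi c.
Proof.
move=> c0 mphi phiE fc; split=> // g mg g0.
rewrite (eintS1 (meas_cV_comp mphi mg) (fun x => g0 (phi x))).
under eq_integral => x _.
  rewrite (_ : (fun y => _) = (fun y => g (ccons x y)) \o f x); last first.
    by apply/funext => y /=; rewrite phiE.
  rewrite (fc x).2//; last exact: (meas_cV_section x mg).
  over.
rewrite ge0_integralZl//=; first by rewrite -eintS1.
- exact: measurable_eint.
- by move=> x _; exact: integral_ge0.
Qed.

Lemma scales_fibre_head n (phi : 'cV[R]_n.+1 -> 'cV[R]_n.+1)
    (a : R) (b : 'cV[R]_n -> R) : a != 0%R ->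
  meas_map phi -> (forall x y, phi (ccons x y) = ccons (a * x + b y)%R y) ->
  scales phi `|a|^-1.
Proof.
move=> a0 mphi phiE; split=> // g mg g0.
rewrite (eintS2 (meas_cV_comp mphi mg) (fun x => g0 (phi x))).
have E y : \int[@lebesgue_measure R]_x (g \o phi) (ccons x y) =
    `|a|^-1%:E * \int[@lebesgue_measure R]_x g (ccons x y).
  rewrite -(ge0_integral_affine (b y) a0 (measurable_section y mg))//.
  by apply: eq_integral => x _ /=; rewrite phiE.
rewrite {1}/eint; under eq_integral do rewrite E.
rewrite ge0_integralZl//=; first by rewrite eintS2.
- exact: (meas_cV_integral mg g0).
- by move=> x _; exact: integral_ge0.
Qed.

Lemma meas_map_translate n (b : 'cV[R]_n) : meas_map (fun x => x + b)%R.
Proof.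
move=> i; under eq_fun do rewrite !mxE.
by apply: measurable_funD => //; exact: measurable_tnth.
Qed.

Lemma meas_map_mulmx n (L : 'M[R]_n) : meas_map (mulmx L).
Proof.
move=> i; under eq_fun do rewrite !mxE.
apply: measurable_sum => j; apply: measurable_funM => //.
under eq_fun do rewrite mxE.
exact: measurable_tnth.
Qed.

Lemma cconsD n (x x' : R) (y y' : 'cV[R]_n) :
  (ccons x y + ccons x' y' = ccons (x + x') (y + y'))%R.
Proof. by rewrite /ccons (@add_col_mx _ 1) raddfD. Qed.

Lemma scales_translate n (b : 'cV[R]_n) : scales (fun x => x + b)%R 1.
Proof.
elim: n b => [|n IH] b.
  split; first exact: meas_map_translate.
  move=> g mg g0; rewrite mul1e; congr eint; apply/funext => x /=.
  by congr g; apply/colP => -[].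
(* The translation is split into a shift of the head and a shift of the tail, one for each fibre
   lemma. *)
rewrite (_ : (fun x => _) = (fun x => x + ccons (b ord0 ord0) 0)%R \o
  (fun x => x + ccons 0 (dsubmx (b : 'cV[R]_(1 + n))))%R); last first.
  by apply/funext => x /=; rewrite -addrA cconsD addr0 add0r -cconsE.
rewrite -[X in scales _ X](mulr1 1%R); apply: scales_comp.
  rewrite -[X in scales _ X]invr1 -[X in scales _ X^-1]normr1.
  apply: (@scales_fibre_head _ _ _ (fun=> b ord0 ord0)) => //.
    exact: meas_map_translate.
  by move=> x y; rewrite cconsD addr0 mul1r.
apply: (@scales_fibre_tail _ _ (fun _ y => y + _)%R) => //.
- exact: meas_map_translate.
- by move=> x y; rewrite cconsD addr0.
- by move=> x; exact: IH.
Qed.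

Lemma mul_block_ccons n (a : R) (e : 'rV[R]_n) (c : 'cV[R]_n) (D : 'M[R]_n) x y :
  ((block_mx (a%:M : 'M[R]_1) e c D : 'M[R]_n.+1) *m ccons x y =
   ccons (a * x + (e *m y) ord0 ord0) (x *: c + D *m y))%R.
Proof.
rewrite /ccons (@mul_block_col _ 1 n 1 n 1); congr (@col_mx _ 1 n 1 _ _).
  by rewrite -scalar_mxM [in LHS](mx11_scalar (e *m y)) -raddfD.
by rewrite mul_mx_scalar.
Qed.

Definition scales_mx n (L : 'M[R]_n) := scales (mulmx L) (`|\det L|^-1)%R.

Lemma scales_mxM n (L M : 'M[R]_n) :
  scales_mx L -> scales_mx M -> scales_mx (L *m M).
Proof.
move=> hL hM; rewrite /scales_mx det_mulmx normrM invfM.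
rewrite (_ : mulmx _ = mulmx L \o mulmx M); last first.
  by apply/funext => x /=; rewrite mulmxA.
exact: scales_comp.
Qed.

Lemma scales_mx_head n (a : R) (e : 'rV[R]_n) : a != 0%R ->
  scales_mx (block_mx (a%:M : 'M[R]_1) e 0 1%:M : 'M[R]_n.+1)%R.
Proof.
move=> a0; rewrite /scales_mx (@det_ublock _ 1 n) det1 mulr1 det_scalar1.
apply: (@scales_fibre_head _ _ _ (fun y => (e *m y) ord0 ord0)%R) => //.
  exact: meas_map_mulmx.
by move=> x y; rewrite mul_block_ccons scaler0 add0r mul1mx.
Qed.

Lemma scales_mx_lower n (c : 'cV[R]_n) :
  scales_mx (block_mx (1%:M : 'M[R]_1) 0 c 1%:M : 'M[R]_n.+1)%R.
Proof.
rewrite /scales_mx (@det_lblock _ 1 n) !det1 mulr1 normr1 invr1.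
apply: (@scales_fibre_tail _ _ (fun x y => y + x *: c)%R) => //.
- exact: meas_map_mulmx.
- by move=> x y; rewrite mul_block_ccons mul1r !mul0mx mxE addr0 mul1mx addrC.
- by move=> x; exact: scales_translate.
Qed.

Lemma scales_mx_diag n (D : 'M[R]_n) : scales_mx D ->
  scales_mx (block_mx (1%:M : 'M[R]_1) 0 0 D : 'M[R]_n.+1)%R.
Proof.
move=> hD.
rewrite /scales_mx (@det_ublock _ 1 n) det1 mul1r.
apply: (@scales_fibre_tail _ _ (fun x y => D *m y)%R) => //.
- exact: meas_map_mulmx.
- by move=> x y; rewrite mul_block_ccons mul1r !mul0mx mxE addr0 scaler0 add0r.
Qed.

End linear_change.

Section change_of_variables.
Context (R : realType).

(** Block elimination: [L] is a unipotent lower matrix, times a diagonal block matrix with the Schur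
    complement [S] as corner, times an upper matrix carrying the pivot. Invertibility of [L] passes
    to [S], which is one size smaller. *)
Lemma scales_mx_pivot n (L : 'M[R]_n.+1) :
  (forall M : 'M[R]_n, M \in unitmx -> scales_mx M) ->
  L \in unitmx -> L ord0 ord0 != 0 -> scales_mx L.
Proof.
move=> IH Lu.
pose a := L ord0 ord0; rewrite -/a => a0.
pose b : 'rV[R]_n := @ursubmx _ 1 n 1 n L.
pose c : 'cV[R]_n := @dlsubmx _ 1 n 1 n L.
pose D : 'M[R]_n := @drsubmx _ 1 n 1 n L.
pose S := D - (a^-1 *: c) *m b.
have LE : L = (block_mx (1%:M : 'M[R]_1) 0 (a^-1 *: c) 1%:M : 'M[R]_n.+1) *m
   ((block_mx (1%:M : 'M[R]_1) 0 0 S : 'M[R]_n.+1) *m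
    (block_mx (a%:M : 'M[R]_1) b 0 1%:M : 'M[R]_n.+1)).
  rewrite -[LHS](@submxK _ 1 n 1 n) !(@mulmx_block _ 1 n 1 n 1 n).
  rewrite !mul1mx !mul0mx !mulmx0 !mulmx1 !addr0 !add0r mul_mx_scalar.
  rewrite scalerA mulfV// scale1r /S addrC subrK [ulsubmx _]mx11_scalar.
  by congr (@block_mx _ 1 n 1 n (_%:M) _ _ _); rewrite !mxE; congr (L _ _); apply/val_inj.
have Su : S \in unitmx.
  move: Lu; rewrite LE !unitmxE !det_mulmx (@det_lblock _ 1 n) (@det_ublock _ 1 n 1%:M).
  by rewrite (@det_ublock _ 1 n) !det1 !mul1r !mulr1 unitrM => /andP[].
rewrite LE; apply: scales_mxM; first exact: scales_mx_lower.
by apply: scales_mxM; [exact/scales_mx_diag/IH|exact: scales_mx_head].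
Qed.

Lemma scales_unitmx n (L : 'M[R]_n) : L \in unitmx -> scales_mx L.
Proof.
elim: n L => [|n IH] L Lu.
  rewrite /scales_mx det_mx00 normr1 invr1; split; first exact: meas_map_mulmx.
  move=> g mg g0; rewrite mul1e; congr eint; apply/funext => x /=.
  by congr g; apply/colP => -[].
have [a0|] := eqVneq (L ord0 ord0) 0; last exact: scales_mx_pivot.
pose b : 'rV[R]_n := @ursubmx _ 1 n 1 n L.
pose c : 'cV[R]_n := @dlsubmx _ 1 n 1 n L.
pose D : 'M[R]_n := @drsubmx _ 1 n 1 n L.
have LE : L = (block_mx (0 : 'M[R]_1) b c D : 'M[R]_n.+1).
  rewrite -[LHS](@submxK _ 1 n 1 n) [ulsubmx _]mx11_scalar.
  rewrite [X in X%:M](_ : _ = 0) ?scalemx0 ?raddf0//.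
  by rewrite -a0 !mxE; congr (L _ _); apply/val_inj.
have c0 : c != 0.
  apply: contraTneq Lu => c0; rewrite LE c0 unitmxE (@det_ublock _ 1 n).
  by rewrite det_mx11 mxE mul0r unitr0.
(* A shear by [c^T] turns the vanishing pivot into the positive number [c^T c]. *)
pose E (s : R) : 'M[R]_n.+1 := block_mx (1%:M : 'M[R]_1) (s *: c^T) 0 1%:M.
have EK : E (-1) *m E 1 = 1%:M.
  rewrite /E (@mulmx_block _ 1 n 1 n 1 n) !mul0mx !mulmx0 !mul1mx !mulmx1.
  by rewrite !addr0 add0r -scalerDl addrN scale0r -scalar_mx_block.
rewrite -[L]mul1mx -EK -mulmxA; apply: scales_mxM.
  exact: scales_mx_head.
apply: scales_mx_pivot => //.
  by rewrite unitmx_mul Lu andbT unitmxE (@det_ublock _ 1 n) !det1 mulr1 unitr1.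
rewrite LE /E (@mulmx_block _ 1 n 1 n 1 n) mul1mx add0r.
have -> : ord0 = lshift n ord0 :> 'I_(1 + n) by exact: val_inj.
rewrite (@block_mxEul _ 1 n 1 n) scale1r mxE.
move: c0; apply: contra_neq => cc0; apply/colP => i.
have cc : \sum_j c j ord0 ^+ 2 = 0.
  by rewrite -[RHS]cc0; apply: eq_bigr => j _; rewrite [c^T _ _]mxE expr2.
have := psumr_eq0P (fun j (_ : true) => sqr_ge0 (c j ord0)) cc.
by move=> /(_ i isT)/eqP; rewrite sqrf_eq0 => /eqP ->; rewrite mxE.
Qed.

Lemma integral_cV_mulmx n (L : 'M[R]_n) (f : 'cV[R]_n -> R) : L \in unitmx ->
  integral_cV (fun x => f (L *m x)) = `|\det L|^-1 * integral_cV f.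
Proof.
move=> Lu; apply: (@integral_cV_scales _ _ (mulmx L) (mulmx (invmx L))).
- by rewrite invr_gt0 normr_gt0 -unitfE -unitmxE.
- by move=> x; rewrite mulKVmx.
- exact: scales_unitmx.
- have := @scales_unitmx n (invmx L); rewrite unitmx_inv /scales_mx det_inv.
  by rewrite normfV; exact.
Qed.

Lemma integral_cV_translate n (b : 'cV[R]_n) (f : 'cV[R]_n -> R) :
  integral_cV (fun x => f (x + b)) = integral_cV f.
Proof.
rewrite -[RHS]mul1r.
apply: (@integral_cV_scales _ _ (fun x => x + b) (fun x => x - b)) => //.
- by move=> x; rewrite subrK.
- exact: scales_translate.
- by rewrite invr1; exact: scales_translate.
Qed.

End change_of_variables.

(** * Integrals of rapidly decreasing functions *)

Section measurability.
Context (R : realType).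
Local Notation mR := (measurableTypeR R).

Definition rmeas n (f : 'cV[R]_n -> R) :=
  measurable_fun [set: n.-tuple mR] (fun t => f (colt t) : mR).

Lemma measurable_floor_preimage n (k z : 'cV[int]_n) :
  measurable [set t : n.-tuple mR |
    forall i, Num.floor ((k i ord0)%:~R * tnth t i) = z i ord0].
Proof.
rewrite (_ : mkset _ = \bigcap_(i in [set: 'I_n])
    ((fun t : n.-tuple mR => (k i ord0)%:~R * tnth t i : mR) @^-1`
      `[(z i ord0)%:~R, (z i ord0 + 1)%:~R[)).
  apply: fin_bigcap_measurable => [|i _]; first exact: finite_finset.
  rewrite -[X in measurable X]setTI.
  have : measurable_fun [set: n.-tuple mR]
      (fun t => (k i ord0)%:~R * tnth t i : mR).
    by apply: measurable_funM => //; exact: measurable_tnth.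
  by apply => //; exact: measurable_itv.
apply/seteqP; split => t /= h i; first by move=> _ /=; rewrite -h in_itv/= floor_itv.
by have := h i I; rewrite /= in_itv/= => /floor_def.
Qed.

(* The Borel sets of ['cV[R]_n] are here those generated by the coordinates, so
   measurability of a continuous function has to be proved: it is the limit of
   its compositions with roundings to finer and finer grids. *)
Lemma continuous_rmeas n (f : 'cV[R]_n -> R) : continuous f -> rmeas f.
Proof.
move=> cf.
pose fl k (t : n.-tuple mR) : 'cV[int]_n :=
  \col_i Num.floor ((k.+1%:Z)%:~R * tnth t i).
pose pt k (z : 'cV[int]_n) : 'cV[R]_n := \col_i ((z i ord0)%:~R / k.+1%:R).
apply: (@measurable_fun_cvg _ _ R _ (fun k t => f (pt k (fl k t)))).
  move=> k _ Y mY; rewrite setTI.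
  rewrite (_ : _ @^-1` Y = \bigcup_z
    ((fl k) @^-1` [set z] `&` [set _ | Y (f (pt k z))])); last first.
    apply/seteqP; split => [t /= Yt|t [z _ [<-]]//].
    by exists (fl k t).
  apply: countable_bigcupT_measurable => // z.
  apply: measurableI.
    have := measurable_floor_preimage (\col_i k.+1%:Z) z.
    congr measurable; apply/seteqP; split => t /=.
      by move=> h; apply/colP => i; rewrite mxE -h mxE.
    by move=> <- i; rewrite !mxE.
  have [h|h] := pselect (Y (f (pt k z))).
    by rewrite (_ : mkset _ = setT)//; apply/seteqP; split.
  by rewrite (_ : mkset _ = set0)//; apply/seteqP; split.
move=> t _; apply: (continuous_cvg _ (cf (colt t))).
apply/cvgrPdist_lt => e e0.
have : \forall k \near \oo, (k.+1%:R^-1 : R) < e.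
  exact: (near_infty_natSinv_lt (PosNum e0)).
apply: filterS => k ke; apply: le_lt_trans ke.
rewrite [leLHS]/Num.Def.normr/= mx_normrE; apply/bigmax_leP; split => [|[i j] _ /=].
  by rewrite invr_ge0.
rewrite !mxE/=.
have k0 : 0 < k.+1%:R :> R by [].
have /andP[h1 h2] := floor_itv ((k.+1%:Z)%:~R * tnth t i).
rewrite intrD in h2.
set w := (Num.floor _)%:~R in h1 h2 *.
rewrite (_ : tnth t i - _ = (k.+1%:R * tnth t i - w) / k.+1%:R); last first.
  by field; rewrite gt_eqF.
rewrite normrM [X in _ * X]ger0_norm ?invr_ge0// ler_piMl ?invr_ge0//.
rewrite ger0_norm; first by rewrite lerBlDl; apply: ltW.
by rewrite subr_ge0.
Qed.

Lemma rmeas_EFin n (f : 'cV[R]_n -> R) : rmeas f -> meas_cV (EFin \o f).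
Proof. by move=> mf; apply/measurable_EFinP. Qed.

Lemma rmeas_coord n (i : 'I_n) : rmeas (fun x => x i ord0).
Proof. by rewrite /rmeas; under eq_fun do rewrite mxE; exact: measurable_tnth. Qed.

End measurability.

Section decay.
Context (R : realType).
Local Notation mR := (measurableTypeR R).

(** An unnormalised product of Cauchy densities. It serves as integrable majorant, its integral
    being an explicit power of pi, and up to the factor 2^n it is the Fourier transform of
    [expk]. *)
Definition dec n (x : 'cV[R]_n) : R := \prod_i (1 + x i ord0 ^+ 2)^-1.

Lemma dec1_gt0 (x : R) : 0 < (1 + x ^+ 2)^-1.
Proof. by rewrite invr_gt0 ltr_wpDr// sqr_ge0. Qed.

Lemma dec_gt0 n (x : 'cV[R]_n) : 0 < dec x.
Proof. by apply: prodr_gt0 => i _; exact: dec1_gt0. Qed.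

Lemma dec_ge0 n (x : 'cV[R]_n) : 0 <= dec x.
Proof. exact/ltW/dec_gt0. Qed.

Lemma prod_ccons n (h : R -> R) x (y : 'cV[R]_n) :
  \prod_i h (ccons x y i ord0) = h x * \prod_i h (y i ord0).
Proof.
rewrite big_ord_recl; congr (h _ * _).
  rewrite (_ : ord0 = lshift n ord0 :> 'I_(1 + n)); last exact: val_inj.
  by rewrite (@col_mxEu _ 1) mxE.
apply: eq_bigr => i _; congr h.
rewrite (_ : lift ord0 i = rshift 1 i :> 'I_(1 + n)); last exact: val_inj.
by rewrite (@col_mxEd _ 1).
Qed.

Lemma continuous_dec1 : continuous (fun x : R => (1 + x ^+ 2)^-1).
Proof. exact: continuous_oneDsqrV. Qed.

Lemma measurable_dec1 : measurable_fun [set: mR] (fun x : R => (1 + x ^+ 2)^-1 : mR).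
Proof. exact: continuous_measurable_fun continuous_dec1. Qed.

Lemma rmeas_prod n (h : R -> R) : measurable_fun [set: mR] (h : mR -> mR) ->
  rmeas (fun x : 'cV[R]_n => \prod_i h (x i ord0)).
Proof.
move=> mh; apply: measurable_prod => i _.
by apply: measurableT_comp => //; exact: rmeas_coord.
Qed.

Lemma rmeas_dec n : rmeas (@dec n).
Proof. exact: rmeas_prod measurable_dec1. Qed.

Lemma integral_dec1 :
  (\int[@lebesgue_measure R]_x ((1 + x ^+ 2)^-1)%:E = pi%:E)%E.
Proof.
rewrite (@ge0_symfun_integralT _ (fun x : R => (1 + x ^+ 2)^-1)).
- rewrite (_ : [set x | _] = `[0, +oo[%classic); last first.
    by apply/seteqP; split => x/=; rewrite in_itv/= andbT.
  by rewrite integral0y_oneDsqr -EFinM mulrC divfK.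
- by move=> x; exact/ltW/dec1_gt0.
- exact: continuous_dec1.
- by move=> x /=; rewrite sqrrN.
Qed.

Lemma eint_dec n : eint (EFin \o @dec n) = (pi ^+ n)%:E.
Proof.
have md n' := rmeas_EFin (@rmeas_dec n').
elim: n => [|n IH]; first by rewrite eint0//= /dec big_ord0.
rewrite eintS1//; last by move=> x; rewrite lee_fin dec_ge0.
under eq_integral => x _.
  rewrite /eint; under eq_integral => t _.
    rewrite /= /dec (@prod_ccons _ (fun x => (1 + x ^+ 2)^-1)) EFinM.
    over.
  rewrite ge0_integralZl//=; last 3 first.
  - exact: md.
  - by move=> t _; rewrite lee_fin dec_ge0.
  - by rewrite lee_fin; exact/ltW/dec1_gt0.
  rewrite -[integral _ _ _]/(eint (EFin \o @dec n)) IH.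
  over.
rewrite ge0_integralZr//=; last 3 first.
- by apply/measurable_EFinP; exact: measurable_dec1.
- by move=> x _; rewrite lee_fin; exact/ltW/dec1_gt0.
- by rewrite lee_fin exprn_ge0// pi_ge0.
by rewrite integral_dec1 -EFinM exprS.
Qed.

End decay.

Section tame.
Context (R : realType).

(** A pointwise form of integrability that passes at once to sums and to products with bounded
    measurable functions. *)
Definition tame n (f : 'cV[R]_n -> R) :=
  rmeas f /\ exists K, forall x, `|f x| <= K * dec x.

Lemma le_integrable_dec n (f : 'cV[R]_n -> R) K : rmeas f ->
  (forall x, `|f x| <= K * dec x) ->
  (lebesgue_tuple R n).-integrable setT (fun t => (f (colt t))%:E).
Proof.
move=> mf fK.
apply: (@le_integrable _ _ _ _ _ _ _ (fun t => (K%:E * (dec (colt t))%:E)%E)) => //.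
- exact/measurable_EFinP.
- by move=> t _; rewrite /= lee_fin (le_trans (fK _))// ler_norm.
- apply: integrableZl => //; apply/integrableP; split.
    by apply/measurable_EFinP; exact: rmeas_dec.
  under eq_integral do rewrite gee0_abs ?lee_fin ?dec_ge0//.
  by have := eint_dec R n; rewrite /eint /= => ->; rewrite ltry.
Qed.

Lemma tame_integrable n (f : 'cV[R]_n -> R) : tame f ->
  (lebesgue_tuple R n).-integrable setT (fun t => (f (colt t))%:E).
Proof. by move=> [mf [K fK]]; exact: le_integrable_dec mf fK. Qed.

Lemma tame_dec n : tame (@dec R n).
Proof.
split; first exact: rmeas_dec.
by exists 1 => x; rewrite mul1r ger0_norm// dec_ge0.
Qed.

Lemma tameD n (f g : 'cV[R]_n -> R) : tame f -> tame g -> tame (fun x => f x + g x).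
Proof.
move=> [mf [K fK]] [mg [M gM]]; split; first exact: measurable_funD.
exists (K + M) => x; rewrite mulrDl (le_trans (ler_normD _ _))//.
by rewrite lerD.
Qed.

Lemma tameMb n (g f : 'cV[R]_n -> R) M : rmeas g -> (forall x, `|g x| <= M) ->
  tame f -> tame (fun x => g x * f x).
Proof.
move=> mg gM [mf [K fK]]; split; first exact: measurable_funM.
exists (M * K) => x; rewrite normrM -mulrA.
by apply: ler_pM => //; exact: gM.
Qed.

Lemma tameZ n c (f : 'cV[R]_n -> R) : tame f -> tame (fun x => c * f x).
Proof. by apply: (@tameMb _ (fun=> c) _ `|c|) => //; exact: measurable_cst. Qed.

Lemma tameN n (f : 'cV[R]_n -> R) : tame f -> tame (fun x => - f x).
Proof.
by move=> /(tameZ (-1)); congr tame; apply/funext => x; rewrite mulN1r.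
Qed.

Lemma tameB n (f g : 'cV[R]_n -> R) : tame f -> tame g -> tame (fun x => f x - g x).
Proof. by move=> tf tg; apply: tameD => //; exact: tameN. Qed.

Lemma integral_cVD n (f g : 'cV[R]_n -> R) : tame f -> tame g ->
  integral_cV (fun x => f x + g x) = integral_cV f + integral_cV g.
Proof. by move=> tf tg; apply: RintegralD => //; exact: tame_integrable. Qed.

Lemma integral_cVB n (f g : 'cV[R]_n -> R) : tame f -> tame g ->
  integral_cV (fun x => f x - g x) = integral_cV f - integral_cV g.
Proof. by move=> tf tg; apply: RintegralB => //; exact: tame_integrable. Qed.

Lemma integral_cVZ n c (f : 'cV[R]_n -> R) : tame f ->
  integral_cV (fun x => c * f x) = c * integral_cV f.
Proof. by move=> tf; apply: RintegralZl => //; exact: tame_integrable. Qed.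

Lemma integral_cVN n (f : 'cV[R]_n -> R) : tame f ->
  integral_cV (fun x => - f x) = - integral_cV f.
Proof.
by move=> tf; rewrite -mulN1r -integral_cVZ//; congr integral_cV;
  apply/funext => x; rewrite mulN1r.
Qed.

Lemma integral_cV_dec n : integral_cV (@dec R n) = pi ^+ n.
Proof.
have := eint_dec R n; rewrite /eint /integral_cV /Rintegral.
by rewrite /= => ->.
Qed.

Lemma ler_integral_cV n (f : 'cV[R]_n -> R) K : rmeas f ->
  (forall x, `|f x| <= K * dec x) -> `|integral_cV f| <= K * pi ^+ n.
Proof.
move=> mf fK; have tf : tame f by split=> //; exists K.
apply: le_trans (le_normr_Rintegral _ (tame_integrable tf)) _ => //.
rewrite -integral_cV_dec -integral_cVZ; last exact: tame_dec.
apply: le_Rintegral => //.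
- exact: integrable_abse (tame_integrable tf).
- exact: tame_integrable (tameZ _ (tame_dec _)).
Qed.

Lemma cvg_integral_cV n (f_ : nat -> 'cV[R]_n -> R) f K :
  (forall k, rmeas (f_ k)) -> rmeas f ->
  (forall k x, `|f_ k x| <= K * dec x) ->
  (forall x, f_ k x @[k --> \oo] --> f x) ->
  integral_cV (f_ k) @[k --> \oo] --> integral_cV f.
Proof.
move=> mf_ mf fK f_f.
have tf_ k : tame (f_ k) by split=> //; exists K.
(* The bound passes to the pointwise limit, which makes [f] integrable as well. *)
have fKl x : `|f x| <= K * dec x.
  have h : `|f_ k x| @[k --> \oo] --> `|f x| by apply: cvg_norm; exact: f_f.
  rewrite -(cvg_lim _ h)//; apply: limr_le; first by apply/cvg_ex; eexists; exact: h.
  by apply: nearW => k; exact: fK.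
have tf : tame f by split=> //; exists K.
apply: fine_cvg; rewrite fineK; last by apply: integrable_fin_num => //; exact: tame_integrable.
apply: (@dominated_cvg _ _ _ (lebesgue_tuple R n) setT measurableT
  (fun k t => (f_ k (colt t))%:E) (fun t => (f (colt t))%:E)
  (fun t => (K * dec (colt t))%:E)) => //.
- by move=> k; apply/measurable_EFinP; exact: mf_.
- by move=> t _; apply: cvg_EFin; [exact: nearW|exact: f_f].
- exact: tame_integrable (tameZ _ (@tame_dec n)).
- by move=> k t _; rewrite lee_fin.
Qed.

End tame.

Local Open Scope complex_scope.

(** * Complex-valued integrands *)

Section complex_facts.
Context (R : realType).
Implicit Types (x y z : R[i]) (t : R).
Local Notation normc := Normc.normc.

Lemma Re_addc x y : complex.Re (x + y) = complex.Re x + complex.Re y.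
Proof. by case: x y => [? ?] [? ?]. Qed.
Lemma Im_addc x y : complex.Im (x + y) = complex.Im x + complex.Im y.
Proof. by case: x y => [? ?] [? ?]. Qed.
Lemma Re_oppc x : complex.Re (- x) = - complex.Re x. Proof. by case: x. Qed.
Lemma Im_oppc x : complex.Im (- x) = - complex.Im x. Proof. by case: x. Qed.
Lemma Re_mulc x y : complex.Re (x * y) =
  complex.Re x * complex.Re y - complex.Im x * complex.Im y.
Proof. by case: x y => [? ?] [? ?]. Qed.
Lemma Im_mulc x y : complex.Im (x * y) =
  complex.Re x * complex.Im y + complex.Im x * complex.Re y.
Proof. by case: x y => [? ?] [? ?]. Qed.
Lemma Re_conjc x : complex.Re (x^*) = complex.Re x. Proof. by case: x. Qed.
Lemma Im_conjc x : complex.Im (x^*) = - complex.Im x. Proof. by case: x. Qed.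

Lemma complex_ext x y :
  complex.Re x = complex.Re y -> complex.Im x = complex.Im y -> x = y.
Proof. by case: x y => [? ?] [? ?] /= -> ->. Qed.

Definition ReImE := (Re_addc, Im_addc, Re_oppc, Im_oppc, Re_mulc, Im_mulc, Re_conjc, Im_conjc).

Lemma normcE z : normc z = Num.sqrt (complex.Re z ^+ 2 + complex.Im z ^+ 2).
Proof. by case: z. Qed.

Lemma normc_ge0 z : 0 <= normc z.
Proof. by rewrite normcE sqrtr_ge0. Qed.

Lemma ler_Re_normc z : `|complex.Re z| <= normc z.
Proof. by rewrite normcE -sqrtr_sqr ler_wsqrtr// lerDl sqr_ge0. Qed.

Lemma ler_Im_normc z : `|complex.Im z| <= normc z.
Proof. by rewrite normcE -sqrtr_sqr ler_wsqrtr// lerDr sqr_ge0. Qed.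

Lemma normc_addc x y : normc (x + y) <= normc x + normc y.
Proof. by have := ler_normD x y; rewrite -lecR rmorphD. Qed.

Lemma normc_conjc x : normc x^* = normc x.
Proof. by rewrite !normcE !ReImE sqrrN. Qed.

Lemma normc_real t : normc t%:C = `|t|.
Proof. by rewrite normcE /= expr0n addr0 sqrtr_sqr. Qed.

Lemma normc_i : normc 'i = 1 :> R.
Proof. by rewrite normcE /= expr0n expr1n add0r sqrtr1. Qed.

Lemma normc_le_ReIm z : normc z <= `|complex.Re z| + `|complex.Im z|.
Proof.
rewrite {1}(_ : z = (complex.Re z)%:C + 'i * (complex.Im z)%:C); last exact: complexE.
apply: le_trans (normc_addc _ _) _; rewrite Normc.normcM !normc_real.
by rewrite normc_i mul1r.
Qed.

Lemma conjc_mulc x y : conjc (x * y) = conjc x * conjc y.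
Proof. by apply: complex_ext; rewrite !ReImE; ring. Qed.

Lemma conjc_conjc x : x^*^* = x.
Proof. by apply: complex_ext; rewrite !ReImE ?opprK. Qed.

Lemma conjc_realc t : t%:C^* = t%:C.
Proof. by apply: complex_ext; rewrite //= oppr0. Qed.

Lemma cisD s t : cis (s + t) = cis s * cis t :> R[i].
Proof. by apply: complex_ext; rewrite ReImE /= ?cosD ?sinD; ring. Qed.

Lemma cis0 : cis 0 = 1 :> R[i].
Proof. by rewrite /cis cos0 sin0. Qed.

Lemma normc_cis t : normc (cis t) = 1.
Proof. by rewrite normcE /= cos2Dsin2 sqrtr1. Qed.

Lemma conjc_cis t : (cis t)^* = cis (- t).
Proof. by rewrite /cis /= cosN sinN. Qed.

End complex_facts.

Section cintegral.
Context (R : realType).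
Local Notation mR := (measurableTypeR R).
Local Notation normc := Normc.normc.

Definition cmeas n (f : cfun R n) := rmeas (re_fun f) /\ rmeas (im_fun f).

Definition ctame n (f : cfun R n) := tame (re_fun f) /\ tame (im_fun f).

Lemma ctameP n (f : cfun R n) :
  ctame f <-> cmeas f /\ exists K, forall x, normc (f x) <= K * dec x.
Proof.
split=> [[[mr [K rK]] [mi [M iM]]]|[[mr mi] [K fK]]].
  split=> //; exists (K + M) => x; apply: le_trans (normc_le_ReIm _) _.
  by rewrite mulrDl lerD//; [exact: rK|exact: iM].
by split; split=> //; exists K => x; apply: le_trans (fK x);
  [exact: ler_Re_normc|exact: ler_Im_normc].
Qed.

Lemma ctame_meas n (f : cfun R n) : ctame f -> cmeas f.
Proof. by move=> /ctameP[]. Qed.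

Lemma cmeasM n (f g : cfun R n) : cmeas f -> cmeas g -> cmeas (fun x => f x * g x).
Proof.
move=> [fr fi] [gr gi]; rewrite /cmeas /re_fun /im_fun /rmeas.
split; under eq_fun do rewrite ?Re_mulc ?Im_mulc.
  by apply: measurable_funB; apply: measurable_funM.
by apply: measurable_funD; apply: measurable_funM.
Qed.

Lemma cmeas_cst n (c : R[i]) : cmeas (fun _ : 'cV[R]_n => c).
Proof. by split; exact: measurable_cst. Qed.

Lemma cmeas_cis n (q : 'cV[R]_n -> R) : rmeas q -> cmeas (fun x => cis (q x)).
Proof.
move=> mq; split.
  apply: (measurableT_comp (continuous_measurable_fun (@continuous_cos R)) mq).
apply: (measurableT_comp (continuous_measurable_fun (@continuous_sin R)) mq).
Qed.

Lemma ctameMb n (g f : cfun R n) M : cmeas g -> (forall x, normc (g x) <= M) ->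
  ctame f -> ctame (fun x => g x * f x).
Proof.
move=> mg gM /ctameP[mf [K fK]]; apply/ctameP; split; first exact: cmeasM.
exists (M * K) => x; rewrite Normc.normcM -mulrA.
by apply: ler_pM => //; exact: normc_ge0.
Qed.

Lemma ctameZ n c (f : cfun R n) : ctame f -> ctame (fun x => c * f x).
Proof. by apply: (@ctameMb _ (fun=> c) _ (normc c)) => //; exact: cmeas_cst. Qed.

Lemma ctame_cisM n (q : 'cV[R]_n -> R) (f : cfun R n) : rmeas q ->
  ctame f -> ctame (fun x => cis (q x) * f x).
Proof.
move=> /cmeas_cis mq; apply: (@ctameMb _ (fun x => cis (q x)) _ 1) => // x.
by rewrite normc_cis.
Qed.

Lemma ctameB n (f g : cfun R n) : ctame f -> ctame g -> ctame (fun x => f x - g x).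
Proof.
move=> [fr fi] [gr gi]; rewrite /ctame /re_fun /im_fun.
by split; under eq_fun do rewrite ?Re_addc ?Im_addc ?Re_oppc ?Im_oppc; exact: tameB.
Qed.

Lemma ctameJ n (f : cfun R n) : ctame f -> ctame (fun x => (f x)^*).
Proof.
move=> [fr fi]; rewrite /ctame /re_fun /im_fun.
by split; [under eq_fun do rewrite Re_conjc|under eq_fun do rewrite Im_conjc; exact: tameN].
Qed.

Lemma cintegralD n (f g : cfun R n) : ctame f -> ctame g ->
  cintegral (fun x => f x + g x) = cintegral f + cintegral g.
Proof.
move=> [fr fi] [gr gi]; apply: complex_ext; rewrite ReImE /= -integral_cVD//;
by congr integral_cV; apply/funext => x; rewrite /re_fun /im_fun !ReImE.
Qed.

Lemma cintegralB n (f g : cfun R n) : ctame f -> ctame g ->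
  cintegral (fun x => f x - g x) = cintegral f - cintegral g.
Proof.
move=> [fr fi] [gr gi]; apply: complex_ext; rewrite !ReImE /= -integral_cVB//;
by congr integral_cV; apply/funext => x; rewrite /re_fun /im_fun !ReImE.
Qed.

Lemma cintegralZ n c (f : cfun R n) : ctame f ->
  cintegral (fun x => c * f x) = c * cintegral f.
Proof.
move=> [fr fi]; apply: complex_ext; rewrite !ReImE /= -!integral_cVZ//.
  rewrite -integral_cVB; [|exact: tameZ..].
  by congr integral_cV; apply/funext => x; rewrite /re_fun /im_fun !ReImE.
rewrite -integral_cVD; [|exact: tameZ..].
by congr integral_cV; apply/funext => x; rewrite /re_fun /im_fun !ReImE.
Qed.

Lemma cintegralJ n (f : cfun R n) : ctame f ->
  cintegral (fun x => (f x)^*) = (cintegral f)^*.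
Proof.
move=> [fr fi]; apply: complex_ext; rewrite !ReImE /= -?integral_cVN//;
by congr integral_cV; apply/funext => x; rewrite /re_fun /im_fun !ReImE.
Qed.

Lemma cintegral_mulmx n (L : 'M[R]_n) (f : cfun R n) : L \in unitmx ->
  cintegral (fun x => f (L *m x)) = (`|\det L|^-1)%:C * cintegral f.
Proof.
move=> Lu; apply: complex_ext; rewrite !ReImE /= mul0r ?subr0 ?addr0.
  exact: integral_cV_mulmx (re_fun f) Lu.
exact: integral_cV_mulmx (im_fun f) Lu.
Qed.

Lemma cintegral_translate n (b : 'cV[R]_n) (f : cfun R n) :
  cintegral (fun x => f (x + b)) = cintegral f.
Proof.
apply: complex_ext; first exact: integral_cV_translate (re_fun f).
exact: integral_cV_translate (im_fun f).
Qed.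

(** The factor 2 comes from estimating the real and the imaginary part separately. *)
Lemma normc_cintegral_le n (f : cfun R n) K : cmeas f ->
  (forall x, normc (f x) <= K * dec x) ->
  normc (cintegral f) <= 2 * K * pi ^+ n.
Proof.
move=> [mr mi] fK; apply: le_trans (normc_le_ReIm _) _.
rewrite mulrDl mul1r mulrDl lerD//=; apply: ler_integral_cV => // x.
  exact: le_trans (ler_Re_normc _) (fK x).
exact: le_trans (ler_Im_normc _) (fK x).
Qed.

Lemma fubini_cV n m (g : 'cV[R]_n -> 'cV[R]_m -> R) K :
  measurable_fun [set: n.-tuple mR * m.-tuple mR]
    (fun u => g (colt u.1) (colt u.2) : mR) ->
  (forall x y, `|g x y| <= K * dec x * dec y) ->
  integral_cV (fun x => integral_cV (g x)) =
  integral_cV (fun y => integral_cV (fun x => g x y)).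
Proof.
move=> mg gK.
have rg1 x : rmeas (g x).
  rewrite /rmeas; have := measurableT_comp mg (pair1_measurable (tcol x)).
  by rewrite /comp /= tcolK.
have rg2 y : rmeas (fun x => g x y).
  rewrite /rmeas; have := measurableT_comp mg (pair2_measurable (tcol y)).
  by rewrite /comp /= tcolK.
have t1 x : tame (g x) by split=> //; exists (K * dec x) => y; exact: gK.
have t2 y : tame (fun x => g x y).
  by split=> //; exists (K * dec y) => x; rewrite mulrAC; exact: gK.
(* The inner integrals are finite, so no default value of [fine] intervenes between real and
   extended integrals. *)
have E1 x : ((integral_cV (g x))%:E = \int[lebesgue_tuple R m]_s (g x (colt s))%:E)%E.
  by rewrite fineK//; apply: integrable_fin_num => //; exact: tame_integrable.
have E2 y : ((integral_cV (fun x => g x y))%:E =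
    \int[lebesgue_tuple R n]_s (g (colt s) y)%:E)%E.
  rewrite fineK//; apply: integrable_fin_num => //.
  exact: (tame_integrable (t2 y)).
rewrite {1 3}/integral_cV /Rintegral; congr fine.
under eq_integral do rewrite E1.
under [RHS]eq_integral do rewrite E2.
apply: (@Fubini _ _ _ _ _ _ _ (fun u => (g (colt u.1) (colt u.2))%:E)).
apply/integrable12ltyP; first exact/measurable_EFinP.
(* The constant [K] carries no sign hypothesis; its absolute value keeps the majorant
   nonnegative. *)
apply: (@le_lt_trans _ _ (\int[lebesgue_tuple R n]_x
    ((`|K| * pi ^+ m)%:E * (dec (colt x))%:E))%E); last first.
  rewrite ge0_integralZl//=; last 3 first.
  - by apply/measurable_EFinP; exact: rmeas_dec.
  - by move=> t _; rewrite lee_fin dec_ge0.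
  - by rewrite lee_fin mulr_ge0// exprn_ge0// pi_ge0.
  by have := eint_dec R n; rewrite /eint /= => ->; rewrite -EFinM ltry.
apply: ge0_le_integral => //.
- by move=> x _; exact: integral_ge0.
- apply: (@measurable_fun_fubini_tonelli_F _ _ _ _ R (lebesgue_tuple R m)
    (fun u => `|(g (colt u.1) (colt u.2))%:E|%E)) => //.
  by apply: measurableT_comp => //; exact/measurable_EFinP.
- by apply: measurable_funeM; apply/measurable_EFinP; exact: rmeas_dec.
move=> t _; apply: (@le_trans _ _ (\int[lebesgue_tuple R m]_y
    ((`|K| * dec (colt t))%:E * (dec (colt y))%:E))%E).
  apply: ge0_le_integral => //.
  - by apply: measurableT_comp => //; apply/measurable_EFinP; exact: (rg1 (colt t)).
  - by apply: measurable_funeM; apply/measurable_EFinP; exact: (@rmeas_dec R m).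
  - move=> y _; rewrite -EFinM lee_fin; apply: le_trans (gK _ _) _.
    by rewrite ler_wpM2r ?dec_ge0// ler_wpM2r ?dec_ge0// ler_norm.
rewrite ge0_integralZl//=; last 3 first.
- by apply/measurable_EFinP; exact: rmeas_dec.
- by move=> y _; rewrite lee_fin dec_ge0.
- by rewrite lee_fin mulr_ge0// dec_ge0.
have := eint_dec R m; rewrite /eint /= => ->.
by rewrite -!EFinM lee_fin mulrAC.
Qed.

Lemma cfubini n m (g : 'cV[R]_n -> 'cV[R]_m -> R[i]) K :
  measurable_fun [set: n.-tuple mR * m.-tuple mR]
    (fun u => complex.Re (g (colt u.1) (colt u.2)) : mR) ->
  measurable_fun [set: n.-tuple mR * m.-tuple mR]
    (fun u => complex.Im (g (colt u.1) (colt u.2)) : mR) ->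
  (forall x y, normc (g x y) <= K * dec x * dec y) ->
  cintegral (fun x => cintegral (g x)) =
  cintegral (fun y => cintegral (fun x => g x y)).
Proof.
move=> mr mi gK; apply: complex_ext => /=.
  apply: (fubini_cV (g := fun x y => complex.Re (g x y)) mr) => x y.
  exact: le_trans (ler_Re_normc _) (gK x y).
apply: (fubini_cV (g := fun x y => complex.Im (g x y)) mi) => x y.
exact: le_trans (ler_Im_normc _) (gK x y).
Qed.

End cintegral.

(** * Schwartz functions *)

Section differentiability.
Context (R : realType) (m : nat).
Local Notation V := 'cV[R]_m.
Local Notation e_ i := (delta_mx i ord0 : V).

Lemma normr_coord (x : V) i : `|x i ord0| <= `|x|.
Proof.
rewrite [leRHS]/Num.Def.normr/= mx_normrE.
by apply: (le_bigmax _ (fun ij : 'I_m * 'I_1 => `|x ij.1 ij.2|) (i, ord0)).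
Qed.

Lemma dotDr (d x y : V) : dot d (x + y) = dot d x + dot d y.
Proof. by rewrite /dot -big_split; apply: eq_bigr => i _; rewrite mxE mulrDr. Qed.

Lemma dotC (x y : V) : dot x y = dot y x.
Proof. by apply: eq_bigr => i _; rewrite mulrC. Qed.

Lemma dotDl (d x y : V) : dot (x + y) d = dot x d + dot y d.
Proof. by rewrite dotC dotDr !(dotC d). Qed.

Lemma dotZr c (d x : V) : dot d (c *: x) = c * dot d x.
Proof. by rewrite /dot mulr_sumr; apply: eq_bigr => i _; rewrite mxE mulrCA. Qed.

Lemma dotZl c (d x : V) : dot (c *: d) x = c * dot d x.
Proof. by rewrite dotC dotZr dotC. Qed.

Lemma dotNr (d x : V) : dot d (- x) = - dot d x.
Proof. by rewrite -scaleN1r dotZr mulN1r. Qed.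

Lemma dotNl (d x : V) : dot (- d) x = - dot d x.
Proof. by rewrite dotC dotNr dotC. Qed.

Lemma dot0r (d : V) : dot d 0 = 0.
Proof. by rewrite -(scale0r 0) dotZr mul0r. Qed.

Lemma dot0l (d : V) : dot 0 d = 0.
Proof. by rewrite dotC dot0r. Qed.

Lemma dot_delta (d : V) i : dot d (e_ i) = d i ord0.
Proof.
rewrite /dot (bigD1 i)//= big1 => [|j ji]; last by rewrite mxE (negbTE ji) mulr0.
by rewrite mxE !eqxx mulr1 addr0.
Qed.

Lemma ler_dot (d x : V) : `|dot d x| <= m%:R * `|d| * `|x|.
Proof.
apply: le_trans (ler_norm_sum _ _ _) _.
apply: (@le_trans _ _ (\sum_(i < m) `|d| * `|x|)).
  by apply: ler_sum => i _; rewrite normrM ler_pM// normr_coord.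
by rewrite sumr_const card_ord -mulrA mulr_natl.
Qed.

Lemma dot_sumE (d : V) : d = \sum_i d i ord0 *: e_ i.
Proof.
apply/colP => k; rewrite summxE (bigD1 k)//= big1 => [|j jk].
  by rewrite !mxE !eqxx mulr1 addr0.
by rewrite !mxE eq_sym (negbTE jk) mulr0.
Qed.

(** A quadratic remainder is little-o of the increment. The gradients of linear and quadratic forms
    and of the Fourier transform are all obtained this way. *)
Lemma differentiable_quad (f : V -> R) x (d : V) C :
  (forall h, `|h| <= 1 -> `|f (x + h) - f x - dot d h| <= C * `|h| ^+ 2) ->
  differentiable f x /\ forall v, 'D_v f x = dot d v.
Proof.
move=> fC.
have dlin : linear (dot d : V -> R) by move=> c u v; rewrite dotDr dotZr.
pose dL : {linear V -> R} := HB.pack (dot d : V -> R)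
  (GRing.isLinear.Build _ _ _ _ _ dlin).
have cd : continuous dL.
  apply: bounded_linear_continuous.
  apply/linear_boundedP.
  apply: filterS (nbhs_pinfty_ge (num_real (m%:R * `|d|))) => M hM u.
  by apply: le_trans (ler_dot _ _) _; rewrite ler_wpM2r.
have fd : (f : V -> R^o) \o shift x = cst (f x : R^o) + (dL : V -> R^o) +o_ (0 : V) (id : V -> V).
  apply/(@eqaddoP R V R V) => _/posnumP[e].
  have C0 : 0 < `|C| + 1 by rewrite ltr_wpDl.
  (* Within this radius C |h|^2 is at most e |h|; the added 1 covers the case C = 0. *)
  apply/nbhs_ballP; exists (Num.min 1 ((`|C| + 1)^-1 * e%:num)) => /=.
    by rewrite lt_min ltr01 mulr_gt0// invr_gt0.
  move=> h; rewrite -ball_normE/= sub0r normrN lt_min => /andP[/ltW h1 /ltW he].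
  rewrite (_ : _ h = f (x + h) - f x - dot d h); last first.
    by rewrite /= !fctE /= opprD addrA [h + x]addrC.
  apply: le_trans (fC _ h1) _.
  apply: (@le_trans _ _ (`|C| * `|h| * `|h|)).
    by rewrite expr2 mulrA ler_wpM2r// ler_wpM2r// ler_norm.
  rewrite ler_wpM2r//.
  apply: (@le_trans _ _ ((`|C| + 1) * `|h|)); first by rewrite ler_wpM2r// lerDl.
  by rewrite -ler_pdivlMl.
have dE := diff_unique cd fd.
have df : differentiable f x.
  by apply/diff_locallyP; rewrite dE.
by split=> // v; rewrite deriveE// dE.
Qed.

End differentiability.

Section schwartz_class.
Context (R : realType) (m : nat).
Local Notation V := 'cV[R]_m.
Local Notation e_ i := (delta_mx i ord0 : V).
Local Notation normc := Normc.normc.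
Implicit Types f g : cfun R m.

Definition cD i f : cfun R m := fun x =>
  'D_(e_ i) (re_fun f) x +i* 'D_(e_ i) (im_fun f) x.

Definition cdiff f :=
  forall x, differentiable (re_fun f) x /\ differentiable (im_fun f) x.

Definition rapid f :=
  forall N, exists C, forall x, (1 + `|x|) ^+ N * normc (f x) <= C.

(** [partial] differentiates along the last index of the list first. Exposing that index replaces a
    function by its derivative, which is the shape that coinduction calls for. *)
Lemma partial_rcons l i (f : V -> R) :
  partial (rcons l i) f = partial l ('D_(e_ i) f).
Proof. by elim: l => //= j l ->. Qed.

Lemma cpartial_rcons l i f : cpartial (rcons l i) f = cpartial l (cD i f).
Proof. by rewrite /cpartial !partial_rcons. Qed.

(** Coinduction: Schwartz functions form the largest class of differentiable, rapidly decreasing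
    functions closed under partial derivatives. Taking for [P] all functions of a given shape
    replaces Leibniz and chain rules for iterated derivatives by a single differentiation. *)
Lemma schwartz_coind (P : cfun R m -> Prop) :
  (forall f, P f -> [/\ cdiff f, rapid f & forall i, P (cD i f)]) ->
  forall f, P f -> schwartz f.
Proof.
move=> HP f Pf.
have Pl l g : P g -> P (cpartial l g).
  elim/last_ind: l g => [|l i IH] g Pg.
    rewrite (_ : cpartial _ _ = g)//; apply/funext => x.
    by rewrite /cpartial /= /re_fun /im_fun; case: (g x).
  by rewrite cpartial_rcons; apply: IH; have [_ _] := HP _ Pg.
split=> [l x|l x|N l].
- by have [/(_ x)[]] := HP _ (Pl l _ Pf).
- by have [/(_ x)[]] := HP _ (Pl l _ Pf).
- by have [_ /(_ N)] := HP _ (Pl l _ Pf).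
Qed.

Lemma schwartz_cdiff f : schwartz f -> cdiff f.
Proof. by move=> [sr si _] x; split; [exact: (sr [::])|exact: (si [::])]. Qed.

Lemma schwartz_rapid f : schwartz f -> rapid f.
Proof.
move=> [_ _ sf] N; have [C fC] := sf N [::]; exists C => x.
by apply: le_trans (fC x); rewrite /cpartial /= /re_fun /im_fun; case: (f x).
Qed.

Lemma schwartz_cD i f : schwartz f -> schwartz (cD i f).
Proof.
move=> [sr si sf]; split=> [l x|l x|N l].
- by have := sr (rcons l i) x; rewrite partial_rcons.
- by have := si (rcons l i) x; rewrite partial_rcons.
- by have := sf N (rcons l i); rewrite cpartial_rcons.
Qed.

Lemma base_ge0 (x : V) N : 0 <= (1 + `|x|) ^+ N.
Proof. by rewrite exprn_ge0// addr_ge0. Qed.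

Lemma rapidD f g : rapid f -> rapid g -> rapid (fun x => f x + g x).
Proof.
move=> rf rg N; have [C fC] := rf N; have [D gD] := rg N.
exists (C + D) => x; apply: (@le_trans _ _ ((1 + `|x|) ^+ N * (normc (f x) + normc (g x)))).
  by rewrite ler_wpM2l ?base_ge0// normc_addc.
by rewrite mulrDr lerD.
Qed.

Lemma rapid_bound f g K k : (forall x, normc (g x) <= K * (1 + `|x|) ^+ k * normc (f x)) ->
  rapid f -> rapid g.
Proof.
move=> gf rf N; have [C fC] := rf (N + k)%N; exists (`|K| * C) => x.
apply: (@le_trans _ _ (`|K| * ((1 + `|x|) ^+ (N + k) * normc (f x)))); last by rewrite ler_wpM2l.
apply: le_trans (ler_wpM2l (base_ge0 x N) (gf x)) _.
rewrite exprD; set a := (_ ^+ N); set b := (_ ^+ k).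
rewrite (_ : a * (K * b * normc (f x)) = K * (a * b * normc (f x))); last by ring.
by rewrite ler_wpM2r ?ler_norm// !mulr_ge0 ?base_ge0 ?normc_ge0.
Qed.

Lemma rapidM_bounded (h : V -> R[i]) f K : (forall x, normc (h x) <= K) ->
  rapid f -> rapid (fun x => h x * f x).
Proof.
move=> hK; apply: (@rapid_bound _ _ K 0) => x.
by rewrite expr0 mulr1 Normc.normcM ler_wpM2r ?normc_ge0.
Qed.

Lemma deriveM_fun (u v : V -> R) w x : differentiable u x -> differentiable v x ->
  'D_w (fun y => u y * v y) x = u x * 'D_w v x + v x * 'D_w u x.
Proof. by move=> du dv; apply: (@deriveM _ _ u v); exact: diff_derivable. Qed.

Lemma deriveD_fun (u v : V -> R) w x : differentiable u x -> differentiable v x ->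
  'D_w (fun y => u y + v y) x = 'D_w u x + 'D_w v x.
Proof. by move=> du dv; apply: (@deriveD _ _ _ u v); exact: diff_derivable. Qed.

Lemma deriveB_fun (u v : V -> R) w x : differentiable u x -> differentiable v x ->
  'D_w (fun y => u y - v y) x = 'D_w u x - 'D_w v x.
Proof. by move=> du dv; apply: (@deriveB _ _ _ u v); exact: diff_derivable. Qed.

Lemma deriveN_fun (u : V -> R) w x : differentiable u x ->
  'D_w (fun y => - u y) x = - 'D_w u x.
Proof. by move=> du; apply: (@deriveN _ _ _ u); exact: diff_derivable. Qed.

Lemma re_funM f g : re_fun (fun x => f x * g x) =
  (fun x => re_fun f x * re_fun g x - im_fun f x * im_fun g x).
Proof. by apply/funext => x; rewrite /re_fun Re_mulc. Qed.

Lemma im_funM f g : im_fun (fun x => f x * g x) =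
  (fun x => re_fun f x * im_fun g x + im_fun f x * re_fun g x).
Proof. by apply/funext => x; rewrite /im_fun Im_mulc. Qed.

Lemma re_funD f g : re_fun (fun x => f x + g x) = (fun x => re_fun f x + re_fun g x).
Proof. by apply/funext => x; rewrite /re_fun Re_addc. Qed.

Lemma im_funD f g : im_fun (fun x => f x + g x) = (fun x => im_fun f x + im_fun g x).
Proof. by apply/funext => x; rewrite /im_fun Im_addc. Qed.

Lemma im_funJ f : im_fun (fun x => (f x)^*) = (fun x => - im_fun f x).
Proof. by apply/funext => x; rewrite /im_fun Im_conjc. Qed.

Lemma re_funJ f : re_fun (fun x => (f x)^*) = re_fun f.
Proof. by apply/funext => x; rewrite /re_fun Re_conjc. Qed.

Lemma cdiffM f g : cdiff f -> cdiff g -> cdiff (fun x => f x * g x).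
Proof.
move=> df dg x; have [fr fi] := df x; have [gr gi] := dg x.
rewrite re_funM im_funM; split.
  by apply: differentiableB; exact: differentiableM.
by apply: differentiableD; exact: differentiableM.
Qed.

Lemma cdiffD f g : cdiff f -> cdiff g -> cdiff (fun x => f x + g x).
Proof.
move=> df dg x; have [fr fi] := df x; have [gr gi] := dg x.
by rewrite re_funD im_funD; split; exact: differentiableD.
Qed.

Lemma cdiffJ f : cdiff f -> cdiff (fun x => (f x)^*).
Proof.
move=> df x; have [fr fi] := df x.
by rewrite re_funJ im_funJ; split=> //; exact: differentiableN.
Qed.

Lemma cdiff_cst c : cdiff (fun=> c).
Proof. by move=> x; split; exact: differentiable_cst. Qed.

Lemma cD_M i f g : cdiff f -> cdiff g ->
  cD i (fun x => f x * g x) = (fun x => cD i f x * g x + f x * cD i g x).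
Proof.
move=> df dg; apply/funext => x; have [fr fi] := df x; have [gr gi] := dg x.
apply: complex_ext; rewrite !ReImE /= ?re_funM ?im_funM.
  rewrite deriveB_fun; [|exact: differentiableM..].
  by rewrite !deriveM_fun// /re_fun /im_fun; ring.
rewrite deriveD_fun; [|exact: differentiableM..].
by rewrite !deriveM_fun// /re_fun /im_fun; ring.
Qed.

Lemma cD_D i f g : cdiff f -> cdiff g ->
  cD i (fun x => f x + g x) = (fun x => cD i f x + cD i g x).
Proof.
move=> df dg; apply/funext => x; have [fr fi] := df x; have [gr gi] := dg x.
by apply: complex_ext; rewrite !ReImE /= ?re_funD ?im_funD deriveD_fun.
Qed.

Lemma cD_J i f : cdiff f -> cD i (fun x => (f x)^*) = (fun x => (cD i f x)^*).
Proof.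
move=> df; apply/funext => x; have [fr fi] := df x.
by rewrite /cD re_funJ im_funJ deriveN_fun.
Qed.

Lemma cD_cst i c : cD i (fun=> c) = (fun=> 0).
Proof.
by apply/funext => x; apply: complex_ext; rewrite /= [LHS]derive_cst.
Qed.

Lemma cdiffZ c f : cdiff f -> cdiff (fun x => c * f x).
Proof. by move=> df; apply: cdiffM => //; exact: cdiff_cst. Qed.

Lemma cD_Z i c f : cdiff f -> cD i (fun x => c * f x) = (fun x => c * cD i f x).
Proof.
move=> df; rewrite cD_M//; last exact: cdiff_cst.
by rewrite cD_cst; apply/funext => x; rewrite mul0r add0r.
Qed.

Lemma schwartz0 : schwartz (fun _ : V => 0 : R[i]).
Proof.
apply: (@schwartz_coind (fun f => f = fun=> 0)) => // _ ->; split.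
- exact: cdiff_cst.
- by move=> N; exists 0 => x; rewrite Normc.normc0 mulr0.
- by move=> i; rewrite cD_cst.
Qed.

Lemma schwartz_lin c f g : schwartz f -> schwartz g ->
  schwartz (fun x => c * f x + g x).
Proof.
move=> sf sg.
apply: (@schwartz_coind (fun h => exists f g, [/\ schwartz f, schwartz g &
  h = fun x => c * f x + g x])); last by exists f, g.
move=> _ [{}f [{}g [{}sf {}sg ->]]].
have [df dg] := (schwartz_cdiff sf, schwartz_cdiff sg); split.
- by apply: cdiffD => //; exact: cdiffZ.
- apply: rapidD (schwartz_rapid sg); apply: rapidM_bounded (schwartz_rapid sf).
  by move=> x; exact: lexx.
- move=> i; exists (cD i f), (cD i g); split; try exact: schwartz_cD.
  by rewrite cD_D ?cD_Z//; exact: cdiffZ.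
Qed.

Lemma schwartzD f g : schwartz f -> schwartz g -> schwartz (fun x => f x + g x).
Proof.
move=> sf sg; have := schwartz_lin 1 sf sg; congr schwartz.
by apply/funext => x; rewrite mul1r.
Qed.

Lemma schwartzZ c f : schwartz f -> schwartz (fun x => c * f x).
Proof.
move=> sf; have := schwartz_lin c sf schwartz0; congr schwartz.
by apply/funext => x; rewrite addr0.
Qed.

Lemma schwartz_sum (I : Type) (r : seq I) (F : I -> cfun R m) :
  (forall i, schwartz (F i)) -> schwartz (fun x => \sum_(i <- r) F i x).
Proof.
move=> sF; elim: r => [|i r IH].
  by under eq_fun do rewrite big_nil; exact: schwartz0.
by under eq_fun do rewrite big_cons; exact: schwartzD.
Qed.

Lemma schwartzJ f : schwartz f -> schwartz (fun x => (f x)^*).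
Proof.
move=> sf.
apply: (@schwartz_coind (fun h => exists2 f, schwartz f & h = fun x => (f x)^*)); last by exists f.
move=> _ [{}f {}sf ->]; have df := schwartz_cdiff sf; split.
- exact: cdiffJ.
- apply: (@rapid_bound f _ 1 0) (schwartz_rapid sf) => x.
  by rewrite normc_conjc mulr1 mul1r.
- by move=> i; exists (cD i f); [exact: schwartz_cD|rewrite cD_J].
Qed.

Lemma cdiff_real (q : V -> R) : (forall x, differentiable q x) ->
  cdiff (fun x => (q x)%:C).
Proof. by move=> dq x; split; [exact: dq|exact: differentiable_cst]. Qed.

Lemma cD_real i (q : V -> R) : cD i (fun x => (q x)%:C) = (fun x => ('D_(e_ i) q x)%:C).
Proof.
by apply/funext => x; apply: complex_ext; rewrite //= [LHS]derive_cst.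
Qed.

Lemma derive_dot (d : V) x v : 'D_v (dot d) x = dot d v.
Proof.
have [//|_ ->//] := @differentiable_quad R m (dot d) x d 0.
by move=> h _; rewrite dotDr addrAC addrK subrr normr0 mul0r.
Qed.

Lemma differentiable_dot (d : V) x : differentiable (dot d : V -> R) x.
Proof.
have [//|//] := @differentiable_quad R m (dot d) x d 0.
by move=> h _; rewrite dotDr addrAC addrK subrr normr0 mul0r.
Qed.

Lemma schwartz_dotM (d : V) f : schwartz f ->
  schwartz (fun x => (dot d x)%:C * f x).
Proof.
move=> sf.
(* Differentiating the linear factor leaves a term without it; the summand [g] absorbs such terms
   and so closes the class. *)
apply: (@schwartz_coind (fun h => exists f g, [/\ schwartz f, schwartz g &
  h = fun x => (dot d x)%:C * f x + g x])); last first.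
  exists f, (fun=> 0); split => //; first exact: schwartz0.
  by apply/funext => x; rewrite addr0.
move=> _ [{}f [g [{}sf sg ->]]].
have [df dg] := (schwartz_cdiff sf, schwartz_cdiff sg).
have dd : cdiff (fun x => (dot d x)%:C) by exact/cdiff_real/differentiable_dot.
split.
- by apply: cdiffD => //; exact: cdiffM.
- apply: rapidD (schwartz_rapid sg).
  apply: (@rapid_bound f _ (m%:R * `|d|) 1) (schwartz_rapid sf) => x.
  rewrite Normc.normcM ler_wpM2r ?normc_ge0// normc_real.
  by apply: le_trans (ler_dot _ _) _; rewrite expr1 ler_wpM2l// lerDr.
- move=> i; exists (cD i f), (fun x => (d i ord0)%:C * f x + cD i g x).
  split; [exact: schwartz_cD|exact/schwartz_lin/schwartz_cD|].
  rewrite cD_D ?cD_M//; last exact: cdiffM.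
  apply/funext => x; rewrite cD_real derive_dot dot_delta addrA; congr (_ + _).
  by rewrite addrC.
Qed.

Lemma schwartz_coordM j f : schwartz f -> schwartz (fun x => (x j ord0)%:C * f x).
Proof.
move=> sf; have := schwartz_dotM (e_ j) sf; congr schwartz.
by apply/funext => x; rewrite dotC dot_delta.
Qed.

Lemma differentiable_cis (q : V -> R) : (forall x, differentiable q x) ->
  cdiff (fun x => cis (q x)).
Proof.
move=> dq x; split.
  apply: (@differentiable_comp _ _ _ _ q cos) => //.
  by apply/derivable1_diffP; exact: derivable_cos.
apply: (@differentiable_comp _ _ _ _ q sin) => //.
by apply/derivable1_diffP; exact: derivable_sin.
Qed.

Lemma derive_comp (u : R -> R) (q : V -> R) x v :
  differentiable q x -> derivable u (q x) 1 ->
  'D_v (fun y => u (q y)) x = 'D_1 u (q x) * 'D_v q x.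
Proof.
move=> dq du.
have du' : differentiable u (q x) by exact/derivable1_diffP.
rewrite (@deriveE _ _ _ (u \o q)); last exact: differentiable_comp.
rewrite diff_comp//= (deriv1E du) derive1E (deriveE v dq).
by rewrite mulrC.
Qed.

Lemma cD_cis i (q : V -> R) : (forall x, differentiable q x) ->
  cD i (fun x => cis (q x)) = (fun x => 'i * ('D_(e_ i) q x)%:C * cis (q x)).
Proof.
move=> dq; apply/funext => x; apply: complex_ext; rewrite !ReImE /=.
  rewrite [LHS](derive_comp _ (dq x) (@derivable_cos R (q x))).
  by rewrite derive_val; ring.
rewrite [LHS](derive_comp _ (dq x) (@derivable_sin R (q x))).
by rewrite derive_val; ring.
Qed.

(** Meant for real polynomials of degree at most two: the phases of the Heisenberg operators, of
    [Vhat] and of the Fourier kernel. *)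
Definition affine_gradient (q : V -> R) :=
  (forall x, differentiable q x) /\
  forall i, exists d b, forall x, 'D_(e_ i) q x = dot d x + b.

(** Each derivative is again [cis (q x)] times a Schwartz function, because the gradient of [q]
    contributes only an affine factor. *)
Lemma schwartz_cisM (q : V -> R) f : affine_gradient q -> schwartz f ->
  schwartz (fun x => cis (q x) * f x).
Proof.
move=> [dq aq] sf.
apply: (@schwartz_coind (fun h => exists2 f, schwartz f &
  h = fun x => cis (q x) * f x)); last by exists f.
move=> _ [{}f {}sf ->].
have df := schwartz_cdiff sf.
have dc := differentiable_cis dq; split.
- exact: cdiffM.
- by apply: rapidM_bounded (schwartz_rapid sf) => x; rewrite normc_cis.
- move=> i; have [d [b qE]] := aq i.
  exists (fun x => 'i * ((dot d x)%:C * f x) + ('i * b%:C * f x + cD i f x)).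
    apply: schwartz_lin; first exact: schwartz_dotM.
    by apply: schwartz_lin => //; exact: schwartz_cD.
  rewrite cD_M// cD_cis//; apply/funext => x; rewrite qE rmorphD /=.
  by ring.
Qed.

End schwartz_class.

Section schwartz_integration.
Context (R : realType).
Local Notation normc := Normc.normc.

(** The norm is the largest modulus of a coordinate, so each of the [m] factors 1 + x_i^2 is at most
    (1 + |x|)^2. *)
Lemma base_dec_ge1 m (x : 'cV[R]_m) : 1 <= (1 + `|x|) ^+ (2 * m) * dec x.
Proof.
rewrite exprM -[m in (_ ^+ _) ^+ m]card_ord -prodr_const /dec -big_split /=.
rewrite [leLHS](_ : _ = \prod_(i < m) 1); last by rewrite big1.
apply: ler_prod => i _; rewrite ler01/=.
rewrite ler_pdivlMr ?ltr_wpDr ?sqr_ge0// mul1r sqrrD expr1n mul1r.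
rewrite -addrA lerD2l -[leLHS]add0r; apply: lerD; first by rewrite mulrn_wge0.
by rewrite -[leLHS]real_normK ?num_real// lerXn2r ?nnegrE// normr_coord.
Qed.

Lemma rapid_decay m (f : cfun R m) k : rapid f ->
  exists2 C, 0 <= C & forall x, (1 + `|x|) ^+ k * normc (f x) <= C * dec x.
Proof.
move=> rf; have [C fC] := rf (2 * m + k)%N.
have C0 : 0 <= C by apply: le_trans (fC 0); rewrite mulr_ge0 ?base_ge0 ?normc_ge0.
exists C => // x; apply: (@le_trans _ _ ((1 + `|x|) ^+ (2 * m) * dec x *
    ((1 + `|x|) ^+ k * normc (f x)))).
  by rewrite ler_peMl ?base_dec_ge1// mulr_ge0 ?base_ge0 ?normc_ge0.
rewrite mulrAC mulrA -exprD; apply: ler_wpM2r (fC x); exact: dec_ge0.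
Qed.

Lemma cdiff_continuous m (f : cfun R m) : cdiff f ->
  continuous (re_fun f) /\ continuous (im_fun f).
Proof.
by move=> df; split => x; have [? ?] := df x; exact: differentiable_continuous.
Qed.

Lemma cdiff_cmeas m (f : cfun R m) : cdiff f -> cmeas f.
Proof. by move=> /cdiff_continuous[? ?]; split; exact: continuous_rmeas. Qed.

Lemma schwartz_ctame m (f : cfun R m) : schwartz f -> ctame f.
Proof.
move=> sf; apply/ctameP; split; first exact/cdiff_cmeas/schwartz_cdiff.
have [C _ fC] := rapid_decay 0 (schwartz_rapid sf).
by exists C => x; have := fC x; rewrite expr0 mul1r.
Qed.

Lemma mulmx_dot m (L : 'M[R]_m) x i : (L *m x) i ord0 = dot (row i L)^T x.
Proof. by rewrite mxE; apply: eq_bigr => j _; rewrite !mxE. Qed.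

Lemma ler_mulmx m (L : 'M[R]_m) : exists2 K, 0 <= K &
  forall x : 'cV[R]_m, `|L *m x| <= K * `|x|.
Proof.
exists (\sum_i m%:R * `|(row i L)^T|) => [|x].
  by apply: sumr_ge0 => i _; rewrite mulr_ge0.
rewrite [leLHS]/Num.Def.normr/= mx_normrE; apply/bigmax_leP; split => [|[i j] _ /=].
  by rewrite mulr_ge0// sumr_ge0// => k _; rewrite mulr_ge0.
rewrite ord1 mulmx_dot; apply: le_trans (ler_dot _ _) _.
rewrite ler_wpM2r// (bigD1 i)//= lerDl.
by rewrite sumr_ge0// => k _; rewrite mulr_ge0.
Qed.

Lemma differentiable_affine m (L : 'M[R]_m) (b x : 'cV[R]_m) :
  differentiable (fun y => L *m y + b) x.
Proof.
apply: differentiableD; last exact: differentiable_cst.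
apply: linear_differentiable.
apply: bounded_linear_continuous; apply/linear_boundedP.
have [K _ LK] := ler_mulmx L.
apply: filterS (nbhs_pinfty_ge (num_real K)) => M hM u.
by apply: le_trans (LK u) _; rewrite ler_wpM2r.
Qed.

Lemma derive_affine m (L : 'M[R]_m) (b : 'cV[R]_m) (u : 'cV[R]_m -> R) x v :
  'D_v (fun y => u (L *m y + b)) x = 'D_(L *m v) u (L *m x + b).
Proof.
rewrite /derive; set F := (X in lim (X @ _) = _); set G := (X in _ = lim (X @ _)).
suff -> : F = G by [].
by apply/funext => h; rewrite /F /G /= mulmxDr -scalemxAr addrA.
Qed.

Lemma derive_sum m (u : 'cV[R]_m -> R) x v : differentiable u x ->
  'D_v u x = \sum_i v i ord0 * 'D_(delta_mx i ord0) u x.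
Proof.
move=> du; rewrite deriveE// {1}[v]dot_sumE linear_sum.
by apply: eq_bigr => i _; rewrite linearZ [in RHS]deriveE.
Qed.

Lemma schwartz_affine m (L : 'M[R]_m) (b : 'cV[R]_m) (f : cfun R m) :
  L \in unitmx -> schwartz f -> schwartz (fun x => f (L *m x + b)).
Proof.
move=> Lu sf.
apply: (@schwartz_coind _ _ (fun h => exists2 f, schwartz f &
  h = fun x => f (L *m x + b))); last by exists f.
move=> _ [{}f {}sf ->]; have df := schwartz_cdiff sf; split.
- move=> x; have [fr fi] := df (L *m x + b); split.
    apply: (@differentiable_comp _ _ _ _ (fun x => L *m x + b) (re_fun f)) => //.
    exact: differentiable_affine.
  apply: (@differentiable_comp _ _ _ _ (fun x => L *m x + b) (im_fun f)) => //.
  exact: differentiable_affine.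
- move=> N; have [C fC] := schwartz_rapid sf N.
  have [K K0 LK] := ler_mulmx (invmx L).
  (* From x = L^-1 (y - b) one gets 1 + |x| <= 1 + K (|y| + |b|), which is at most K' (1 + |y|). *)
  pose K' := 1 + K + K * `|b|.
  exists (K' ^+ N * C) => x; set y := L *m x + b.
  have K'0 : 0 <= K' by rewrite !addr_ge0// mulr_ge0.
  have xy : 1 + `|x| <= K' * (1 + `|y|).
    have -> : x = invmx L *m (y - b) by rewrite /y addrK mulKmx.
    apply: (@le_trans _ _ (1 + K * (`|y| + `|b|))).
      by rewrite lerD2l (le_trans (LK _))// ler_wpM2l// ler_normB.
    rewrite /K' !mulrDl !mulrDr !mul1r !mulr1.
    have := mulr_ge0 K0 (normr_ge0 b); have := normr_ge0 y.
    have := mulr_ge0 (mulr_ge0 K0 (normr_ge0 b)) (normr_ge0 y).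
    by lra.
  apply: (@le_trans _ _ (K' ^+ N * (1 + `|y|) ^+ N * normc (f y))).
    rewrite ler_wpM2r ?normc_ge0// -exprMn.
    by rewrite lerXn2r ?nnegrE//; apply: mulr_ge0 => //; apply: addr_ge0.
  by rewrite -mulrA ler_wpM2l ?exprn_ge0.
- move=> i; exists (fun y => \sum_j (L j i)%:C * cD j f y).
    by apply: schwartz_sum => j; apply: schwartzZ; exact: schwartz_cD.
  apply/funext => x; have [fr fi] := df (L *m x + b).
  have Le j : (L *m (delta_mx i ord0 : 'cV[R]_m)) j ord0 = L j i.
    by rewrite mulmx_dot dot_delta !mxE.
  apply: complex_ext; rewrite /cD /=.
    rewrite (_ : complex.Re _ = \sum_j complex.Re ((L j i)%:C * cD j f (L *m x + b))); last first.
      by elim/big_rec2: _ => //= j y1 y2 _ <-; rewrite !ReImE.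
    rewrite [LHS](@derive_affine _ L b (re_fun f)) derive_sum//.
    by apply: eq_bigr => j _; rewrite Le !ReImE /= mul0r subr0.
  rewrite (_ : complex.Im _ = \sum_j complex.Im ((L j i)%:C * cD j f (L *m x + b))); last first.
    by elim/big_rec2: _ => //= j y1 y2 _ <-; rewrite !ReImE.
  rewrite [LHS](@derive_affine _ L b (im_fun f)) derive_sum//.
  by apply: eq_bigr => j _; rewrite Le !ReImE /= mul0r addr0.
Qed.

Lemma schwartz_mulmx m (L : 'M[R]_m) (f : cfun R m) :
  L \in unitmx -> schwartz f -> schwartz (fun x => f (L *m x)).
Proof.
move=> Lu /(schwartz_affine 0 Lu); congr schwartz.
by apply/funext => x; rewrite addr0.
Qed.

Lemma schwartz_translate m (b : 'cV[R]_m) (f : cfun R m) :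
  schwartz f -> schwartz (fun x => f (x + b)).
Proof.
move=> /(schwartz_affine b (unitmx1 _ _)); congr schwartz.
by apply/funext => x; rewrite mul1mx.
Qed.

End schwartz_integration.

(** * Fourier transform and inversion *)

Section mean_value.
Context (R : realType).
Local Notation normc := Normc.normc.

Lemma MVT_between (f : R -> R) (t : R) : (forall x, derivable f x 1) -> t != 0 ->
  exists2 c, `|c| <= `|t| & f t - f 0 = 'D_1 f c * t.
Proof.
move=> df t0.
have df' (x : R) : is_derive x (1 : R) f ('D_1 f x) by exact/derivableP.
have cf (i : interval R) : {within [set` i], continuous f}.
  by apply: derivable_within_continuous => x _.
have [t_lt0|t_gt0|/eqP] := ltgtP t 0; last by rewrite (negbTE t0).
  have [c] := MVT t_lt0 (fun x _ => df' x) (cf _).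
  rewrite in_itv/= => /andP[tc c0] E; exists c.
    by rewrite !ltr0_norm// lerN2 ltW.
  by rewrite -[LHS]opprB E sub0r mulrN opprK.
have [c] := MVT t_gt0 (fun x _ => df' x) (cf _).
rewrite in_itv/= => /andP[c0 ct] E; exists c; first by rewrite !gtr0_norm// ltW.
by rewrite E subr0.
Qed.

Lemma ler_norm_MVT (f : R -> R) (t B : R) : (forall x, derivable f x 1) ->
  (forall x, `|x| <= `|t| -> `|'D_1 f x| <= B) -> `|f t - f 0| <= B * `|t|.
Proof.
move=> df fB; have [->|t0] := eqVneq t 0; first by rewrite subrr !normr0 mulr0.
have [c ct ->] := MVT_between df t0.
by rewrite normrM ler_wpM2r// fB.
Qed.

Lemma ler_sin (t : R) : `|sin t| <= `|t|.
Proof.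
have := @ler_norm_MVT sin t 1; rewrite sin0 subr0 mul1r; apply.
  by move=> x; exact: derivable_sin.
by move=> x _; rewrite derive_val ler_norml cos_geN1 cos_le1.
Qed.

Lemma ler_cos1 (t : R) : `|cos t - 1| <= `|t| ^+ 2.
Proof.
have := @ler_norm_MVT cos t `|t|; rewrite cos0 expr2; apply.
  by move=> x; exact: derivable_cos.
by move=> x xt; rewrite derive_val normrN (le_trans (ler_sin x)).
Qed.

Lemma ler_cos1' (t : R) : `|cos t - 1| <= `|t|.
Proof.
have := @ler_norm_MVT cos t 1; rewrite cos0 mul1r; apply.
  by move=> x; exact: derivable_cos.
by move=> x xt; rewrite derive_val normrN ler_norml sin_geN1 sin_le1.
Qed.

Lemma ler_sin_sub (t : R) : `|sin t - t| <= `|t| ^+ 2.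
Proof.
have := @ler_norm_MVT (fun x => sin x - x) t `|t|.
rewrite sin0 !subr0 expr2; apply.
  by move=> x; apply: derivableB; [exact: derivable_sin|exact: derivable_id].
move=> x xt; rewrite (@deriveB _ _ _ sin id) ?derive_id; last 2 first.
- exact: derivable_sin.
- exact: derivable_id.
by rewrite derive_val (le_trans (ler_cos1' x)).
Qed.

Lemma normc_cis_sub (t : R) : normc (cis t - 1 - 'i * t%:C) <= 2 * `|t| ^+ 2.
Proof.
apply: le_trans (normc_le_ReIm _) _.
rewrite (_ : complex.Re _ = cos t - 1); last by rewrite !ReImE /=; ring.
rewrite (_ : complex.Im _ = sin t - t); last by rewrite !ReImE /=; ring.
by rewrite mulrDl mul1r lerD// ?ler_cos1// ler_sin_sub.
Qed.

End mean_value.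

Section integral_derivative.
Context (R : realType) (m : nat).
Local Notation V := 'cV[R]_m.

Lemma derivable_line (u : V -> R) (x v : V) (s : R) :
  derivable u (x + s *: v) v -> derivable (fun s : R => u (x + s *: v)) s 1.
Proof.
rewrite /derivable; set F := (X in cvg (X @ _) -> _); set G := (X in _ -> cvg (X @ _)).
suff -> : F = G by [].
apply/funext => h; rewrite /F /G /= scaler1 scalerDl.
by congr (_ *: (u _ - _)); rewrite addrCA.
Qed.

Lemma derive_line (u : V -> R) (x v : V) (s : R) :
  'D_1 (fun s : R => u (x + s *: v)) s = 'D_v u (x + s *: v).
Proof.
rewrite /derive; set F := (X in lim (X @ _) = _); set G := (X in _ = lim (X @ _)).
suff -> : F = G by [].
apply/funext => h; rewrite /F /G /= scaler1 scalerDl.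
by congr (_ *: (u _ - _)); rewrite addrCA.
Qed.

(** By translation invariance the difference quotients of [u] along [v] have integral 0. The mean
    value theorem on the segment bounds them uniformly, and dominated convergence carries the
    vanishing over to the derivative. *)
Lemma integral_derive0 (u : V -> R) (v : V) C : tame u ->
  (forall x, differentiable u x) -> rmeas ('D_v u) ->
  (forall x, (1 + `|x|) ^+ (2 * m) * `|'D_v u x| <= C) ->
  integral_cV ('D_v u) = 0.
Proof.
move=> tu du mDu DuC.
pose t_ k : R := k.+1%:R^-1.
have t0 k : 0 < t_ k by rewrite invr_gt0.
pose f_ k (x : V) := (t_ k)^-1 * (u (x + t_ k *: v) - u x).
have mtr (b : V) : rmeas (fun x => u (x + b)).
  apply: continuous_rmeas => x; apply: differentiable_continuous.
  have -> : (fun x => u (x + b)) = (fun x => u (1%:M *m x + b)).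
    by apply/funext => y; rewrite mul1mx.
  by apply: (@differentiable_comp _ _ _ _ (fun x => 1%:M *m x + b) u);
    [exact: differentiable_affine|exact: du].
have C0 : 0 <= C by apply: le_trans (DuC 0); rewrite mulr_ge0 ?base_ge0.
(* For |s| <= 1 one has 1 + |x| <= (2 + |v|) (1 + |x + s v|); the exponent 2 m is the one that
   [base_dec_ge1] trades for [dec]. *)
pose K := (2 + `|v|) ^+ (2 * m) * C.
have K0 : 0 <= K by rewrite mulr_ge0// exprn_ge0// addr_ge0.
have Kb (x : V) s : `|s| <= 1 -> `|'D_v u (x + s *: v)| <= K * dec x.
  move=> s1; set y := x + s *: v.
  have xy : 1 + `|x| <= (2 + `|v|) * (1 + `|y|).
    have -> : x = y - s *: v by rewrite /y addrK.
    apply: (@le_trans _ _ (1 + (`|y| + `|s| * `|v|))).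
      by rewrite lerD2l -normrZ ler_normB.
    have := mulr_ge0 (normr_ge0 v) (normr_ge0 y).
    have : `|s| * `|v| <= `|v| by rewrite ler_piMl.
    by have := normr_ge0 y; rewrite mulrDl !mulrDr !mulr1; lra.
  apply: (@le_trans _ _ ((1 + `|x|) ^+ (2 * m) * dec x * `|'D_v u y|)).
    by rewrite ler_peMl// base_dec_ge1.
  rewrite mulrAC ler_wpM2r ?dec_ge0//.
  apply: (@le_trans _ _ (((2 + `|v|) * (1 + `|y|)) ^+ (2 * m) * `|'D_v u y|)).
    by rewrite ler_wpM2r// lerXn2r ?nnegrE// mulr_ge0// addr_ge0.
  by rewrite exprMn -mulrA ler_wpM2l// ?DuC// exprn_ge0// addr_ge0.
have f_dec k x : `|f_ k x| <= K * dec x.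
  have := @ler_norm_MVT _ (fun s => u (x + s *: v)) (t_ k) (K * dec x).
  rewrite scale0r addr0 => H.
  rewrite /f_ normrM normfV ler_pdivrMl ?normr_gt0 ?gt_eqF// mulrC.
  apply: H => s; first exact/derivable_line/diff_derivable.
  move=> st; rewrite derive_line; apply: Kb; apply: le_trans st _.
  by rewrite gtr0_norm// invf_le1// ler1n.
have mf_ k : rmeas (f_ k).
  apply: measurable_funM => //; apply: measurable_funB; first exact: mtr.
  exact: tu.1.
have fcv x : f_ k x @[k --> \oo] --> 'D_v u x.
  have : derivable u x v by exact: diff_derivable.
  rewrite /derivable /derive => cu.
  (* The limit defining a derivative is taken over punctured neighbourhoods of 0, so the steps must
     also be nonzero. *)
  have tc : t_ k @[k --> \oo] --> (0 : R)^'.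
    move=> A [e /= e0 eA].
    apply: filterS (near_infty_natSinv_lt (PosNum e0)) => k ke /=.
    apply: eA => /=; last by rewrite gt_eqF.
    by rewrite sub0r normrN gtr0_norm.
  have := cvg_comp _ _ tc cu.
  apply: cvg_trans; apply: near_eq_cvg; apply: nearW => k /=.
  by rewrite /f_ [x + _]addrC.
have := cvg_integral_cV mf_ mDu f_dec fcv.
have int0 k : integral_cV (f_ k) = 0.
  (* The translate inherits its majorant from the difference quotient rather than from [u]
     directly. *)
  have tut : tame (fun x => u (x + t_ k *: v)).
    have -> : (fun x => u (x + t_ k *: v)) = (fun x => t_ k * f_ k x + u x).
      apply/funext => x; rewrite /f_ mulrA mulfV ?gt_eqF// mul1r.
      by rewrite subrK.
    by apply: tameD => //; apply: tameZ; split=> //; exists K.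
  rewrite integral_cVZ; last exact: tameB.
  by rewrite integral_cVB// integral_cV_translate subrr mulr0.
under eq_fun do rewrite int0.
by move=> /cvg_lim <-//; rewrite lim_cst.
Qed.

Lemma cintegral_cD0 (g : cfun R m) j : schwartz g -> cintegral (cD j g) = 0.
Proof.
move=> sg; have dg := schwartz_cdiff sg; have [tr ti] := schwartz_ctame sg.
have sDg := schwartz_cD j sg.
have [mr mi] := ctame_meas (schwartz_ctame sDg).
have [C DC] := schwartz_rapid sDg (2 * m)%N.
apply: complex_ext => /=.
  apply: (@integral_derive0 (re_fun g) _ C) => // x; first by have [] := dg x.
  apply: le_trans (DC x); rewrite ler_wpM2l ?base_ge0//.
  exact: (ler_Re_normc (cD j g x)).
apply: (@integral_derive0 (im_fun g) _ C) => // x; first by have [] := dg x.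
apply: le_trans (DC x); rewrite ler_wpM2l ?base_ge0//.
exact: (ler_Im_normc (cD j g x)).
Qed.

End integral_derivative.

Section quadratic_phase.
Context (R : realType) (m : nat).

Lemma dot_mulmx (P : 'M[R]_m) (x y : 'cV[R]_m) : dot (P *m x) y = dot x (P^T *m y).
Proof.
have dotE (u v : 'cV[R]_m) : dot u v = (u^T *m v) ord0 ord0.
  by rewrite mxE; apply: eq_bigr => i _; rewrite mxE.
by rewrite !dotE trmx_mul mulmxA.
Qed.

Lemma affine_gradient_quadratic (P : 'M[R]_m) (b : 'cV[R]_m) (c : R) :
  affine_gradient (fun x => dot (P *m x) x + dot b x + c).
Proof.
have [K K0 PK] := ler_mulmx P.
have H x : differentiable (fun x => dot (P *m x) x + dot b x + c) x /\
    forall v, 'D_v (fun x => dot (P *m x) x + dot b x + c) x =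
      dot ((P + P^T) *m x + b) v.
  apply: (@differentiable_quad _ _ _ _ _ (m%:R * K)) => h _.
  (* The polynomial has degree two, so its first-order remainder is exactly this quadratic form. *)
  rewrite (_ : _ - _ = dot (P *m h) h).
    apply: le_trans (ler_dot _ _) _.
    by rewrite expr2 !mulrA ler_wpM2r// -!mulrA ler_wpM2l// PK.
  rewrite mulmxDr !dotDr !dotDl mulmxDl !dotDl.
  by rewrite (dotC (P^T *m x)) (dot_mulmx P h x); ring.
split=> [x|i]; first by have [] := H x.
exists (row i (P + P^T))^T, (b i ord0) => x; have [_ ->] := H x.
by rewrite dot_delta mxE mulmx_dot.
Qed.

Lemma affine_gradient_dot (b : 'cV[R]_m) (k c : R) :
  affine_gradient (fun x => k * dot b x + c).
Proof.
have := affine_gradient_quadratic 0 (k *: b) c; congr affine_gradient.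
by apply/funext => x; rewrite mul0mx dot0l add0r dotZl.
Qed.

End quadratic_phase.

Section fourier.
Context (R : realType) (hbar : R) (hbar_gt0 : 0 < hbar) (m : nat).
Local Notation V := 'cV[R]_m.
Local Notation e_ i := (delta_mx i ord0 : V).
Local Notation normc := Normc.normc.

Definition phase (p x : V) : R := - (dot p x / hbar).

(** Unnormalised: the power of 2 pi hbar enters with inversion, and the metaplectic factor is
    restored as [kappa] in the treatment of [Jhat]. *)
Definition ft (f : cfun R m) : cfun R m :=
  fun p => cintegral (fun x => cis (phase p x) * f x).

Lemma phaseDl p q x : phase (p + q) x = phase p x + phase q x.
Proof. by rewrite /phase dotDl mulrDl opprD. Qed.

Lemma phaseDr p q x : phase p (q + x) = phase p q + phase p x.
Proof. by rewrite /phase dotDr mulrDl opprD. Qed.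

Lemma phaseC p x : phase p x = phase x p.
Proof. by rewrite /phase dotC. Qed.

Lemma affine_gradient_phase p : affine_gradient (phase p).
Proof.
have := affine_gradient_dot p (- hbar^-1) 0; congr affine_gradient.
by apply/funext => x; rewrite addr0 mulNr mulrC.
Qed.

Lemma schwartz_phase p f : schwartz f -> schwartz (fun x => cis (phase p x) * f x).
Proof. by move=> sf; apply: schwartz_cisM => //; exact: affine_gradient_phase. Qed.

Lemma rmeas_phase p : rmeas (phase p).
Proof.
apply: continuous_rmeas => x; apply: differentiable_continuous.
by have [] := affine_gradient_phase p.
Qed.

Lemma ctame_phase p (f : cfun R m) : ctame f -> ctame (fun x => cis (phase p x) * f x).
Proof. by apply: ctame_cisM; exact: rmeas_phase. Qed.

Lemma ft_lin c (f g : cfun R m) p : ctame f -> ctame g ->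
  ft (fun x => c * f x + g x) p = c * ft f p + ft g p.
Proof.
move=> tf tg; rewrite /ft -cintegralZ; last exact: ctame_phase.
rewrite -cintegralD; [|exact/ctameZ/ctame_phase|exact: ctame_phase].
congr cintegral; apply/funext => x; ring.
Qed.

Lemma ft_sum (I : Type) (r : seq I) (c : I -> R[i]) (F : I -> cfun R m) p :
  (forall i, schwartz (F i)) ->
  ft (fun x => \sum_(i <- r) c i * F i x) p = \sum_(i <- r) c i * ft (F i) p.
Proof.
move=> sF; elim: r => [|i r IH].
  rewrite big_nil /ft (_ : (fun _ => _) = fun=> 0 * 0); last first.
    by apply/funext => x; rewrite big_nil mulr0 mul0r.
  rewrite (@cintegralZ _ _ 0 (fun=> 0)) ?mul0r//.
  exact/schwartz_ctame/schwartz0.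
rewrite big_cons -IH -ft_lin; last 2 first.
- exact/schwartz_ctame/sF.
- apply/schwartz_ctame; apply: (@schwartz_sum _ _ _ r (fun i x => c i * F i x)) => j.
  exact: schwartzZ.
by congr ft; apply/funext => x; rewrite big_cons.
Qed.

(** Multiplication by the factor that differentiation in p_j brings down from [cis (phase p x)]. *)
Definition mulX j (f : cfun R m) : cfun R m :=
  fun x => - 'i * (hbar^-1)%:C * ((x j ord0)%:C * f x).

Lemma schwartz_mulX j f : schwartz f -> schwartz (mulX j f).
Proof. by move=> sf; apply: schwartzZ; exact: schwartz_coordM. Qed.

(** Differentiation under the integral sign in quantitative form. The second-order remainder of
    [cis (phase h x)] costs |h|^2 |x|^2, and the rapid decay of [f] pays for |x|^2. *)
Lemma ft_taylor f p : schwartz f -> exists C, forall h,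
  normc (ft f (p + h) - ft f p - \sum_j (h j ord0)%:C * ft (mulX j f) p)
    <= C * `|h| ^+ 2.
Proof.
move=> sf.
have [C C0 fC] := rapid_decay 2 (schwartz_rapid sf).
have sm h : schwartz (fun x => \sum_j (h j ord0)%:C * mulX j f x).
  by apply: schwartz_sum => j; apply: schwartzZ; exact: schwartz_mulX.
(* The 2 is that of [normc_cis_sub], and m / hbar comes from |phase h x| <= m |h| |x| / hbar. The
   outer 2 and the power of pi in the witness below come from [normc_cintegral_le]. *)
pose K := 2 * (m%:R / hbar) ^+ 2.
exists (2 * (K * C) * pi ^+ m) => h.
rewrite -ft_sum; last by move=> j; exact: schwartz_mulX.
have tp q g' : schwartz g' -> ctame (fun x => cis (phase q x) * g' x).
  by move=> sg'; apply: ctame_phase; exact: schwartz_ctame.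
rewrite /ft -cintegralB; [|exact: tp..].
rewrite -cintegralB; [|by apply: ctameB; exact: tp|exact: tp].
set g := (fun x => _).
have gE x : g x = cis (phase p x) *
    ((cis (phase h x) - 1 - 'i * (phase h x)%:C) * f x).
  rewrite /g phaseDl cisD.
  rewrite (_ : \sum_j _ = 'i * (phase h x)%:C * f x); first by ring.
  rewrite /phase /dot mulr_suml -sumrN rmorph_sum mulr_sumr mulr_suml.
  apply: eq_bigr => j _; rewrite /mulX !rmorphN !rmorphM /=; ring.
have -> : 2 * (K * C) * pi ^+ m * `|h| ^+ 2 = 2 * (K * `|h| ^+ 2 * C) * pi ^+ m by ring.
apply: normc_cintegral_le.
  by apply/ctame_meas/ctameB; [apply: ctameB|]; exact: tp.
move=> x; rewrite gE !Normc.normcM normc_cis mul1r.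
apply: (@le_trans _ _ (K * `|h| ^+ 2 * ((1 + `|x|) ^+ 2 * normc (f x)))); last first.
  rewrite -[leRHS]mulrA; apply: ler_wpM2l (fC x).
  by apply: mulr_ge0; [apply: mulr_ge0; rewrite ?sqr_ge0|rewrite exprn_ge0].
rewrite mulrA; apply: ler_wpM2r; first exact: normc_ge0.
apply: le_trans (normc_cis_sub _) _.
have -> : K * `|h| ^+ 2 * (1 + `|x|) ^+ 2 =
    2 * ((m%:R * `|h| * (1 + `|x|)) / hbar) ^+ 2 by rewrite /K; field; rewrite gt_eqF.
have b0 : 0 <= m%:R * `|h| * (1 + `|x|) / hbar.
  apply: divr_ge0; last exact: ltW.
  by apply: mulr_ge0; [apply: mulr_ge0|apply: addr_ge0].
apply: ler_wpM2l => //; rewrite lerXn2r ?nnegrE//.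
rewrite /phase normrN normrM [X in _ * X]gtr0_norm ?invr_gt0//.
apply: ler_wpM2r; first by rewrite invr_ge0 ltW.
apply: le_trans (ler_dot _ _) _.
by apply: ler_wpM2l; [apply: mulr_ge0|rewrite lerDr].
Qed.

Lemma ft_diff f : schwartz f ->
  cdiff (ft f) /\ forall j, cD j (ft f) = ft (mulX j f).
Proof.
move=> sf.
(* [part] stands for the real or the imaginary part; the argument uses only real linearity and
   domination by the modulus. *)
have H (part : R[i] -> R) p : (forall x y, part (x + y) = part x + part y) ->
    (forall x, part (- x) = - part x) ->
    (forall (c : R) x, part (c%:C * x) = c * part x) ->
    (forall x, `|part x| <= normc x) ->
    differentiable (fun q => part (ft f q)) p /\
    forall v, 'D_v (fun q => part (ft f q)) p =
      dot (\col_j part (ft (mulX j f) p)) v.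
  move=> partD partN partZ part_le; have [C HC] := ft_taylor p sf.
  apply: (@differentiable_quad _ _ _ _ _ C) => h _.
  apply: le_trans (HC h); apply: le_trans (part_le _).
  rewrite !partD !partN (_ : part (\sum_j _) = dot (\col_j part (ft (mulX j f) p)) h)//.
  have part0 : part 0 = 0 by rewrite -(mul0r 0) -[X in X * _](rmorph0 (real_complex R)) partZ mul0r.
  rewrite (big_morph part partD part0); apply: eq_bigr => j _.
  by rewrite partZ mxE mulrC.
have ReZ (c : R) (x : R[i]) : complex.Re (c%:C * x) = c * complex.Re x.
  by rewrite ReImE /= mul0r subr0.
have ImZ (c : R) (x : R[i]) : complex.Im (c%:C * x) = c * complex.Im x.
  by rewrite ReImE /= mul0r addr0.
have Hr p := H (@complex.Re R) p (@Re_addc R) (@Re_oppc R) ReZ (@ler_Re_normc R).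
have Hi p := H (@complex.Im R) p (@Im_addc R) (@Im_oppc R) ImZ (@ler_Im_normc R).
split=> [p|j]; first by have [[? _] [? _]] := (Hr p, Hi p).
apply/funext => p; have [[_ Er] [_ Ei]] := (Hr p, Hi p).
apply: complex_ext.
  by apply: etrans (Er (e_ j)) _; rewrite dot_delta mxE.
by apply: etrans (Ei (e_ j)) _; rewrite dot_delta mxE.
Qed.

(** Integration by parts: the j-th derivative in x of [cis (phase p x) * f x] has integral 0, and
    the product rule splits it into the two sides. *)
Lemma ft_cD j f p : schwartz f ->
  ft (cD j f) p = 'i * (p j ord0 / hbar)%:C * ft f p.
Proof.
move=> sf.
have df := schwartz_cdiff sf.
have [dq _] := affine_gradient_phase p.
have := cintegral_cD0 j (schwartz_phase p sf).
rewrite cD_M//; last exact: differentiable_cis.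
rewrite cD_cis// /ft -cintegralZ; last exact/ctame_phase/schwartz_ctame.
have Dp x : 'D_(e_ j) (phase p) x = - (p j ord0 / hbar).
  have [|_ ->] := @differentiable_quad R m (phase p) x (- hbar^-1 *: p) 0.
    move=> h _; rewrite phaseDr dotZl /phase.
    by rewrite (_ : _ - _ = 0) ?normr0 ?mul0r//; ring.
  by rewrite dotZl dot_delta mulNr mulrC.
under eq_fun => x do rewrite Dp.
move=> H; apply/eqP; rewrite -subr_eq0 -cintegralB.
- rewrite -[X in _ == X]H; apply/eqP; congr cintegral; apply/funext => x.
  by rewrite rmorphN; ring.
- exact/ctame_phase/schwartz_ctame/schwartz_cD.
- exact/ctameZ/ctame_phase/schwartz_ctame.
Qed.

(** Each further power of |p| is bounded by the sum of the |p_j|, and a factor p_j is traded for a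
    derivative of [f]. The induction therefore ranges over all Schwartz functions. *)
Lemma ft_rapid f : schwartz f -> rapid (ft f).
Proof.
move=> sf N; elim: N f sf => [|N IH] f sf.
  have /ctameP[mf [K fK]] := schwartz_ctame sf.
  exists (2 * K * pi ^+ m) => p; rewrite expr0 mul1r.
  apply: normc_cintegral_le; first exact/ctame_meas/ctame_phase/schwartz_ctame.
  by move=> x; rewrite Normc.normcM normc_cis mul1r.
have [C fC] := IH f sf.
have [D fD] := choice (fun j => IH (cD j f) (schwartz_cD j sf)).
exists (C + \sum_j hbar * D j) => p.
have np : `|p| <= \sum_j `|p j ord0|.
  rewrite [leLHS]/Num.Def.normr/= mx_normrE; apply/bigmax_leP.
  split=> [|[i j] _ /=]; first by rewrite sumr_ge0.
  by rewrite ord1 (bigD1 i)//= lerDl sumr_ge0.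
rewrite exprSr -mulrA mulrDl mul1r mulrDr lerD//.
apply: (@le_trans _ _ ((1 + `|p|) ^+ N * (\sum_j `|p j ord0| * normc (ft f p)))).
  by rewrite ler_wpM2l ?base_ge0// -mulr_suml ler_wpM2r ?normc_ge0.
rewrite mulr_sumr; apply: ler_sum => j _.
rewrite -ler_pdivrMl//; apply: le_trans (fD j p).
rewrite ft_cD// !Normc.normcM normc_real mulrCA ler_wpM2l ?base_ge0//.
rewrite normrM [`|hbar^-1|]gtr0_norm ?invr_gt0//.
by rewrite normc_i mul1r mulrA [hbar^-1 * _]mulrC.
Qed.

Lemma schwartz_ft f : schwartz f -> schwartz (ft f).
Proof.
move=> sf.
apply: (@schwartz_coind _ _ (fun g => exists2 f, schwartz f & g = ft f)); last by exists f.
move=> _ [{}f {}sf ->]; have [df Df] := ft_diff sf; split => //.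
- exact: ft_rapid.
- by move=> j; exists (mulX j f); [exact: schwartz_mulX|exact: Df].
Qed.

End fourier.

(** * The exponential kernel and its Fourier transform *)

Section exponential_integral.
Context (R : realType).

(** exp(|x|) is the square of exp(|x|/2), hence at least (1 + |x|/2)^2, which is at least (1 +
    x^2)/4. *)
Lemma expRN_norm_le (x : R) : expR (- `|x|) <= 4 * (1 + x ^+ 2)^-1.
Proof.
rewrite expRN ler_pdivlMr ?ltr_wpDr ?sqr_ge0// ler_pdivrMl ?expR_gt0// mulrC.
have -> : `|x| = `|x| / 2 + `|x| / 2 by lra.
rewrite expRD; have := expR_ge1Dx (`|x| / 2).
set e := expR _; have := normr_ge0 x; rewrite -(real_normK (num_real x)) => x0 h.
have : (1 + `|x| / 2) * (1 + `|x| / 2) <= e * e by rewrite ler_pM// addr_ge0// divr_ge0.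
by lra.
Qed.

Lemma continuous_exp_cos (h : R -> R) (a : R) : continuous h ->
  continuous (fun y : R => expR (- h y) * (1 + cos (y * a))).
Proof.
move=> ch x.
apply: (@continuousM _ _ (fun y => expR (- h y)) (fun y => 1 + cos (y * a))).
  exact: (continuous_comp (continuousN (ch x)) (@continuous_expR R (- h x))).
have c1 : {for x, continuous (cst 1 : R -> R)} by exact: cst_continuous.
exact: (continuousD c1
  (continuous_comp (@mulrr_continuous R a x) (@continuous_cos R (x * a)))).
Qed.

(** Adding 1 to the cosine makes the integrand nonnegative, as the fundamental theorem on a
    half-line used here demands; [integral_exp_cos1] removes the extra term. *)
Lemma integral0y_exp_cos (a : R) :
  (\int[@lebesgue_measure R]_(x in `[0%R, +oo[)
     (expR (- x) * (1 + cos (x * a)))%:E = (1 + (1 + a ^+ 2)^-1)%:E)%E.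
Proof.
(* An antiderivative: the derivative of exp(-x) (a sin(a x) - cos(a x)) is (1 + a^2) exp(-x) cos(a
   x). It tends to 0 at infinity. *)
pose F (x : R) := - expR (- x) + (1 + a ^+ 2)^-1 * (expR (- x) * (a * sin (x * a) - cos (x * a))).
have a0 : 1 + a ^+ 2 != 0 by rewrite gt_eqF// ltr_wpDr ?sqr_ge0.
have dF (x : R) : is_derive x (1 : R) F (expR (- x) * (1 + cos (x * a))).
  have dm : is_derive x (1 : R) (fun x => x * a) a.
    by apply: is_derive_eq; rewrite scaler0 add0r -[a *: 1]/(a * 1) mulr1.
  have de : is_derive x (1 : R) (fun x => expR (- x)) (- expR (- x)).
    rewrite -mulrN1; exact: (@is_derive1_comp _ expR (fun x => - x)).
  have ds : is_derive x (1 : R) (fun x => sin (x * a)) (cos (x * a) * a).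
    exact: (@is_derive1_comp _ sin (fun x => x * a)).
  have dc : is_derive x (1 : R) (fun x => cos (x * a)) (- sin (x * a) * a).
    exact: (@is_derive1_comp _ cos (fun x => x * a)).
  apply: is_derive_eq.
  rewrite /GRing.scale/=; field; exact: a0.
have cf := @continuous_exp_cos id a (fun x : R => @cvg_id _ (nbhs x)).
rewrite (@ge0_continuous_FTC2y _ _ F 0 0).
- rewrite -EFinB /F !(oppr0, expR0, mul0r, sin0, cos0, mulr0, sub0r, mul1r, mulrN, mulr1).
  by rewrite opprB opprK addrC.
- by move=> x x0; rewrite mulr_ge0 ?expR_ge0// -lerBlDl sub0r cos_geN1.
- exact: continuous_subspaceT cf.
- rewrite /F -[X in _ --> X]addr0; apply: cvgD.
    by rewrite -[X in _ --> X]oppr0; apply: cvgN; exact: cvgr_expR.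
  rewrite -(mulr0 (1 + a ^+ 2)^-1); apply: cvgMl_tmp.
  apply: (@squeeze_cvgr _ _ _ _ (fun x => - (expR (- x) * (`|a| + 1)))
     (fun x => expR (- x) * (`|a| + 1))).
  + apply: nearW => x; rewrite -ler_norml normrM gtr0_norm ?expR_gt0//.
    rewrite ler_wpM2l ?expR_ge0// (le_trans (ler_normB _ _))// normrM lerD//.
      by rewrite ler_piMr// ler_norml sin_geN1 sin_le1.
    by rewrite ler_norml cos_geN1 cos_le1.
  + rewrite -[X in _ --> X]oppr0 -(mul0r (`|a| + 1)); apply: cvgN.
    by apply: cvgMr_tmp; exact: cvgr_expR.
  + rewrite -[X in _ --> X](mul0r (`|a| + 1)).
    by apply: cvgMr_tmp; exact: cvgr_expR.
- by move=> x _; have [] := dF x.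
- apply: cvg_at_right_filter; apply: differentiable_continuous.
  by apply/derivable1_diffP; have [] := dF 0.
- by move=> x _; rewrite derive1E; have [_] := dF x.
Qed.

Lemma integral_exp_cos (a : R) :
  (\int[@lebesgue_measure R]_x
     (expR (- `|x|) * (1 + cos (x * a)))%:E = (2 * (1 + (1 + a ^+ 2)^-1))%:E)%E.
Proof.
rewrite (@ge0_symfun_integralT _ (fun x : R => expR (- `|x|) * (1 + cos (x * a)))).
- rewrite (_ : [set x | _] = `[0, +oo[%classic); last first.
    by apply/seteqP; split => x/=; rewrite in_itv/= andbT.
  rewrite [in RHS]EFinM -integral0y_exp_cos; congr (_ * _)%E.
  apply: eq_integral => x; rewrite inE/= in_itv/= andbT => x0.
  by rewrite ger0_norm.
- by move=> x; rewrite mulr_ge0 ?expR_ge0// -lerBlDl sub0r cos_geN1.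
- by apply: continuous_exp_cos => x; exact: norm_continuous.
- by move=> x /=; rewrite normrN mulNr cosN.
Qed.

End exponential_integral.

Section product_integral.
Context (R : realType).
Local Notation mR := (measurableTypeR R).

Lemma sum_ccons n (h : R -> R) x (y : 'cV[R]_n) :
  \sum_i h (ccons x y i ord0) = h x + \sum_i h (y i ord0).
Proof.
rewrite big_ord_recl; congr (h _ + _).
  rewrite (_ : ord0 = lshift n ord0 :> 'I_(1 + n)); last exact: val_inj.
  by rewrite (@col_mxEu _ 1) mxE.
apply: eq_bigr => i _; congr h.
rewrite (_ : lift ord0 i = rshift 1 i :> 'I_(1 + n)); last exact: val_inj.
by rewrite (@col_mxEd _ 1).
Qed.

Lemma dot_ccons n x x' (y y' : 'cV[R]_n) :
  dot (ccons x y) (ccons x' y') = x * x' + dot y y'.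
Proof.
rewrite /dot big_ord_recl; congr (_ * _ + _).
- rewrite (_ : ord0 = lshift n ord0 :> 'I_(1 + n)); last exact: val_inj.
  by rewrite (@col_mxEu _ 1) mxE.
- rewrite (_ : ord0 = lshift n ord0 :> 'I_(1 + n)); last exact: val_inj.
  by rewrite (@col_mxEu _ 1) mxE.
apply: eq_bigr => i _.
rewrite (_ : lift ord0 i = rshift 1 i :> 'I_(1 + n)); last exact: val_inj.
by rewrite !(@col_mxEd _ 1).
Qed.

Lemma dec_ccons n x (y : 'cV[R]_n) : dec (ccons x y) = (1 + x ^+ 2)^-1 * dec y.
Proof. exact: (prod_ccons (fun x => (1 + x ^+ 2)^-1)). Qed.

Lemma integrable_dec1 (a : R -> R) K : measurable_fun [set: mR] (a : mR -> mR) ->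
  (forall x, `|a x| <= K * (1 + x ^+ 2)^-1) ->
  (@lebesgue_measure R).-integrable [set: mR] (fun x : mR => (a x)%:E).
Proof.
move=> ma aK.
apply: (@le_integrable _ mR R lebesgue_measure [set: mR] measurableT _
  (fun x : mR => (K%:E * ((1 + x ^+ 2)^-1)%:E)%E)).
- exact/measurable_EFinP.
- by move=> t _; rewrite /= lee_fin (le_trans (aK _))// ler_norm.
- apply: integrableZl => //; apply/integrableP; split.
    by apply/measurable_EFinP; exact: measurable_dec1.
  under eq_integral do rewrite gee0_abs ?lee_fin ?(ltW (dec1_gt0 _))//.
  by rewrite integral_dec1 ltry.
Qed.

Lemma tame_ccons n (g : 'cV[R]_n.+1 -> R) (a : R -> R) (A : 'cV[R]_n -> R) K :
  rmeas g -> (forall x y, g (ccons x y) = a x * A y) ->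
  (forall x, `|a x| <= K * (1 + x ^+ 2)^-1) -> tame A -> tame g.
Proof.
move=> mg gE aK [_ [M AM]]; split=> //; exists (K * M) => z.
rewrite (cconsE z) gE dec_ccons normrM mulrACA.
by apply: ler_pM => //; exact: AM.
Qed.

(** Separation of variables for integrands of either sign: integrability on the product space is
    established first, so that Fubini can replace the Tonelli of [eintS1]. *)
Lemma integral_cV_ccons n (g : 'cV[R]_n.+1 -> R) (a : R -> R) (A : 'cV[R]_n -> R) K :
  rmeas g -> (forall x y, g (ccons x y) = a x * A y) ->
  measurable_fun [set: mR] (a : mR -> mR) ->
  (forall x, `|a x| <= K * (1 + x ^+ 2)^-1) -> tame A ->
  integral_cV g = (\int[@lebesgue_measure R]_x a x) * integral_cV A.
Proof.
move=> mg gE ma aK tA.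
have tg := tame_ccons mg gE aK tA.
have iA := tame_integrable tA.
have ia := integrable_dec1 ma aK.
have ig : (pushforward (@lebesgue_measure R \x lebesgue_tuple R n)%E
    (@tcons R n)).-integrable setT (fun t => (g (colt t))%:E).
  exact: (tame_integrable tg).
have mtc := @measurable_tcons R n.
have E : (fun u : mR * n.-tuple mR => (a u.1 * A (colt u.2))%:E) =
    (fun t => (g (colt t))%:E) \o @tcons R n.
  by apply/funext => -[x t] /=; rewrite colt_tcons gE.
have mgt : measurable_fun [set: n.+1.-tuple mR] (fun t => (g (colt t))%:E).
  exact/measurable_EFinP.
have igt : (@lebesgue_measure R \x lebesgue_tuple R n)%E.-integrable setT
    (fun u => (a u.1 * A (colt u.2))%:E).
  rewrite E; move: ig => /integrableP[_ gt].
  apply/integrableP; split; first exact: measurableT_comp.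
  move: gt; rewrite ge0_integral_pushforward//.
  exact: measurableT_comp.
transitivity (fine (\int[(@lebesgue_measure R \x lebesgue_tuple R n)%E]_u
    (a u.1 * A (colt u.2))%:E)).
  rewrite /integral_cV /Rintegral; congr fine.
  rewrite E in igt *.
  exact: (integral_pushforward mtc mgt igt measurableT).
rewrite -(integral12_prod_meas1 igt) /fubini_F /=.
under eq_integral => x _.
  under eq_integral do rewrite EFinM.
  rewrite integralZl//.
  rewrite -[integral _ _ _]fineK; last exact: integrable_fin_num.
  over.
rewrite integralZr// fineM//; exact: integrable_fin_num.
Qed.

End product_integral.

Section exponential_kernel.
Context (R : realType).
Local Notation mR := (measurableTypeR R).

Definition expk n (p : 'cV[R]_n) : R := expR (- \sum_i `|p i ord0|).

Lemma expk_gt0 n (p : 'cV[R]_n) : 0 < expk p.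
Proof. exact: expR_gt0. Qed.

Lemma expk_le1 n (p : 'cV[R]_n) : expk p <= 1.
Proof. by rewrite -expR0 ler_expR oppr_le0 sumr_ge0. Qed.

Lemma expk_ccons n x (y : 'cV[R]_n) : expk (ccons x y) = expR (- `|x|) * expk y.
Proof. by rewrite /expk (sum_ccons (fun x => `|x|)) opprD expRD. Qed.

Lemma expk_le_dec n (p : 'cV[R]_n) : expk p <= 4 ^+ n * dec p.
Proof.
elim: n p => [|n IH] p; first by rewrite expr0 mul1r /dec big_ord0 expk_le1.
rewrite (cconsE p) expk_ccons dec_ccons exprS mulrACA.
by apply: ler_pM; [exact: expR_ge0|exact: expR_ge0|exact: expRN_norm_le|exact: IH].
Qed.

Lemma continuous_expk n : continuous (@expk n).
Proof.
have cs : continuous (fun p : 'cV[R]_n => \sum_i `|p i ord0|).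
  elim: (index_enum _) => [|i r IH].
    by under eq_fun do rewrite big_nil; exact: cst_continuous.
  under eq_fun do rewrite big_cons.
  have ci : continuous (fun q : 'cV[R]_n => `|q i ord0|).
    move=> q; apply: (@continuous_comp _ _ _ (fun q : 'cV[R]_n => q i ord0)
      (fun r : R => `|r|)); first exact: coord_continuous.
    exact: norm_continuous.
  by move=> p; exact: (continuousD (ci p) (IH p)).
move=> p; exact: (continuous_comp (continuousN (cs p)) (@continuous_expR R _)).
Qed.

Lemma rmeas_comp n k (phi : 'cV[R]_n -> 'cV[R]_k) (f : 'cV[R]_k -> R) :
  meas_map phi -> rmeas f -> rmeas (fun x => f (phi x)).
Proof.
move=> /meas_mapP mphi mf; rewrite /rmeas.
rewrite (_ : (fun t => _) =
  (fun t => f (colt t) : mR) \o (fun t => tcol (phi (colt t)))).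
  exact: measurableT_comp.
by apply/funext => t /=; rewrite tcolK.
Qed.

Lemma rmeas_dot n (u : 'cV[R]_n) : rmeas (dot u).
Proof.
apply: continuous_rmeas => x; apply: differentiable_continuous.
exact: differentiable_dot.
Qed.

Lemma ctame_expk n : ctame (fun p : 'cV[R]_n => (expk p)%:C).
Proof.
apply/ctameP; split.
  split; last exact: measurable_cst.
  exact: (continuous_rmeas (@continuous_expk n)).
exists (4 ^+ n) => p; rewrite normc_real gtr0_norm ?expk_gt0//.
exact: expk_le_dec.
Qed.

Lemma ctame_cis_expk n (u : 'cV[R]_n) : ctame (fun p => cis (- dot u p) * (expk p)%:C).
Proof.
apply: ctame_cisM (ctame_expk n).
by apply: measurableT_comp => //; exact: rmeas_dot.
Qed.

Lemma integral_exp_cos1 (a : R) :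
  \int[@lebesgue_measure R]_x (expR (- `|x|) * cos (x * a)) = 2 * (1 + a ^+ 2)^-1.
Proof.
have mexp : measurable_fun [set: mR] (fun x : R => expR (- `|x|) : mR).
  by do 2 apply: measurableT_comp => //; exact: measurable_normr.
have mcos b : measurable_fun [set: mR] (fun x : R => cos (x * b) : mR).
  apply: continuous_measurable_fun => x.
  exact: (continuous_comp (@mulrr_continuous R b x) (@continuous_cos R (x * b))).
have iexp b : (@lebesgue_measure R).-integrable [set: mR]
    (EFin \o (fun x : mR => expR (- `|x|) * cos (x * b))).
  apply: (@integrable_dec1 _ _ 4); first exact: (measurable_funM mexp (mcos b)).
  move=> x; apply: le_trans (expRN_norm_le x).
  rewrite normrM gtr0_norm ?expR_gt0// ler_piMr ?expR_ge0//.
  by rewrite ler_norml cos_geN1 cos_le1.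
have E b : \int[@lebesgue_measure R]_x (expR (- `|x|) * cos (x * 0)) +
    \int[@lebesgue_measure R]_x (expR (- `|x|) * cos (x * b)) =
    2 * (1 + (1 + b ^+ 2)^-1).
  rewrite -RintegralD//; [|exact: iexp..].
  rewrite -[RHS]/(fine (_)%:E) -integral_exp_cos /Rintegral; congr fine.
  by apply: eq_integral => x _; rewrite mulr0 cos0 mulrDr.
(* [E 0] is twice the integral of exp(-|x|), and so supplies the term to subtract in [E a]. *)
move: (E a) (E 0); rewrite expr0n addr0 invr1.
move: (Rintegral _ _ _) (Rintegral _ _ _) => I0 Ia; clear => ? ?; lra.
Qed.

Lemma cintegral_even_real n (G : cfun R n) : ctame G ->
  (forall p, G (- p) = (G p)^*) -> complex.Im (cintegral G) = 0.
Proof.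
move=> tG GN.
have u1 : (- 1%:M : 'M[R]_n) \in unitmx.
  by rewrite -scaleN1r unitmxZ ?unitmx1// unitfE oppr_eq0 oner_eq0.
have := cintegral_mulmx G u1.
rewrite -scaleN1r detZ det1 mulr1 normrX normrN1 expr1n invr1 mul1r.
under eq_fun => p do rewrite scaleN1r mulNmx mul1mx GN.
rewrite cintegralJ// => /(congr1 (@complex.Im R)); rewrite !ReImE => H; lra.
Qed.

Lemma cintegral_expk n (u : 'cV[R]_n) :
  cintegral (fun p => cis (- dot u p) * (expk p)%:C) = (2 ^+ n * dec u)%:C.
Proof.
have Im0 m (v : 'cV[R]_m) :
    complex.Im (cintegral (fun p => cis (- dot v p) * (expk p)%:C)) = 0.
  apply: cintegral_even_real; first exact: ctame_cis_expk.
  move=> p; rewrite conjc_mulc conjc_cis conjc_realc dotNr; congr (_ * (expR (- _))%:C).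
  by apply: eq_bigr => i _; rewrite mxE normrN.
apply: complex_ext; last exact: Im0.
elim: n u => [|n IH] u.
  rewrite /= /integral_cV /Rintegral /= integral_dirac//; last first.
    by apply/measurable_EFinP; exact: (ctame_cis_expk u).1.1.
  rewrite diracT mul1e /= /re_fun ReImE /= /dot big_ord0 oppr0 cos0.
  by rewrite /expk big_ord0 oppr0 expR0 /dec big_ord0; ring.
pose u' : 'cV[R]_n := dsubmx (u : 'cV[R]_(1 + n)).
pose G (p : 'cV[R]_n) : R[i] := cis (- dot u' p) * (expk p)%:C.
have [tGr tGi] : ctame G := ctame_cis_expk u'.
(* One product in the addition formula for the cosine: [b] is the cosine or sine of the head, [A]
   the matching part of [G] on the tail. The two products are added, because [im_fun G] carries the
   minus sign. *)
pose g (b : R -> R) (A : 'cV[R]_n -> R) (z : 'cV[R]_n.+1) :=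
  (expR (- `|z ord0 ord0|) * b (z ord0 ord0 * u ord0 ord0)) *
  A (dsubmx (z : 'cV[R]_(1 + n))).
have c0 x (y : 'cV[R]_n) : ccons x y ord0 ord0 = x.
  rewrite [X in ccons _ _ X](_ : _ = lshift n ord0 :> 'I_(1 + n)); last exact: val_inj.
  by rewrite (@col_mxEu _ 1) mxE.
have gE b A x y : g b A (ccons x y) = (expR (- `|x|) * b (x * u ord0 ord0)) * A y.
  by rewrite /g c0 /ccons (@col_mxKd _ 1).
have mexp : measurable_fun [set: mR] (fun x : R => expR (- `|x|) : mR).
  by do 2 apply: measurableT_comp => //; exact: measurable_normr.
have mb (b : R -> R) : continuous b ->
    measurable_fun [set: mR] (fun x : R => expR (- `|x|) * b (x * u ord0 ord0) : mR).
  move=> cb; apply: (measurable_funM mexp).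
  apply: continuous_measurable_fun => x.
  exact: (continuous_comp (@mulrr_continuous R (u ord0 ord0) x) (cb _)).
have bK (b : R -> R) : (forall x, `|b x| <= 1) -> forall x,
    `|expR (- `|x|) * b (x * u ord0 ord0)| <= 4 * (1 + x ^+ 2)^-1.
  move=> b1 x; apply: le_trans (expRN_norm_le x).
  by rewrite normrM gtr0_norm ?expR_gt0// ler_piMr ?expR_ge0.
have mg b A : continuous b -> tame A -> rmeas (g b A).
  move=> cb [mA _]; apply: measurable_funM.
    apply: (measurableT_comp (mb _ cb) (rmeas_coord _)).
  apply: (@rmeas_comp _ _ (fun z : 'cV[R]_n.+1 => dsubmx (z : 'cV[R]_(1 + n)))) => // i.
  by under eq_fun do rewrite !mxE; exact: measurable_tnth.
have cos1 x : `|cos x| <= 1 :> R by rewrite ler_norml cos_geN1 cos_le1.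
have sin1 x : `|sin x| <= 1 :> R by rewrite ler_norml sin_geN1 sin_le1.
have cc := @continuous_cos R; have cs := @continuous_sin R.
have tg b A : continuous b -> (forall x, `|b x| <= 1) -> tame A -> tame (g b A).
  by move=> cb b1 tA; apply: (tame_ccons (mg _ _ cb tA) (gE b A) (bK _ b1) tA).
have -> : complex.Re (cintegral (fun p => cis (- dot u p) * (expk p)%:C)) =
    integral_cV (fun z => g cos (re_fun G) z + g sin (im_fun G) z).
  congr integral_cV; apply/funext => z.
  rewrite (cconsE z) !gE (cconsE u) /re_fun /im_fun /G dot_ccons expk_ccons.
  rewrite -/u' !ReImE /= c0 !opprD cosD sinD !cosN !sinN (mulrC (u _ _)); ring.
rewrite integral_cVD; [|exact: tg..].
rewrite (integral_cV_ccons (mg _ _ cc tGr) (gE _ _) (mb _ cc) (bK _ cos1) tGr).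
rewrite (integral_cV_ccons (mg _ _ cs tGi) (gE _ _) (mb _ cs) (bK _ sin1) tGi).
(* The product with the sine vanishes through its tail factor, an integral already known to be
   real. *)
rewrite integral_exp_cos1 (_ : integral_cV (im_fun G) = 0); last exact: Im0.
rewrite (_ : integral_cV (re_fun G) = 2 ^+ n * dec u'); last exact: IH.
by rewrite mulr0 addr0 mulrACA -exprS [in RHS](cconsE u) -/u' dec_ccons.
Qed.

End exponential_kernel.

(** * Multiplication formula and Fourier inversion *)

Section joint_measurability.
Context (R : realType) (n m : nat).
Local Notation mR := (measurableTypeR R).
Implicit Types G H : 'cV[R]_n -> 'cV[R]_m -> R[i].

Definition jmeas G :=
  measurable_fun [set: n.-tuple mR * m.-tuple mR]
    (fun u => complex.Re (G (colt u.1) (colt u.2)) : mR) /\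
  measurable_fun [set: n.-tuple mR * m.-tuple mR]
    (fun u => complex.Im (G (colt u.1) (colt u.2)) : mR).

Lemma jmeasM G H : jmeas G -> jmeas H -> jmeas (fun x y => G x y * H x y).
Proof.
move=> [Gr Gi] [Hr Hi]; split.
  under eq_fun do rewrite Re_mulc.
  by apply: measurable_funB; apply: measurable_funM.
under eq_fun do rewrite Im_mulc.
by apply: measurable_funD; apply: measurable_funM.
Qed.

Lemma jmeas_fst f : cmeas f -> jmeas (fun x _ => f x).
Proof.
by move=> [fr fi]; split;
  [exact: (measurableT_comp fr measurable_fst)|exact: (measurableT_comp fi measurable_fst)].
Qed.

Lemma jmeas_snd f : cmeas f -> jmeas (fun _ y => f y).
Proof.
by move=> [fr fi]; split;
  [exact: (measurableT_comp fr measurable_snd)|exact: (measurableT_comp fi measurable_snd)].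
Qed.

End joint_measurability.

Section inversion.
Context (R : realType) (hbar : R) (hbar_gt0 : 0 < hbar) (m : nat).
Local Notation V := 'cV[R]_m.
Local Notation mR := (measurableTypeR R).
Local Notation normc := Normc.normc.
Local Notation ft := (@ft R hbar m).
Local Notation phase := (@phase R hbar m).

Lemma jmeas_phase : jmeas (fun p x : V => cis (phase p x)).
Proof.
have mp : measurable_fun [set: m.-tuple mR * m.-tuple mR]
    (fun u => phase (colt u.1) (colt u.2) : mR).
  apply: measurableT_comp => //; apply: measurable_funM => //.
  apply: measurable_sum => i; apply: measurable_funM.
    by apply: (measurableT_comp (@rmeas_coord _ _ i) measurable_fst).
  by apply: (measurableT_comp (@rmeas_coord _ _ i) measurable_snd).
split.
  exact: (measurableT_comp (continuous_measurable_fun (@continuous_cos R)) mp).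
exact: (measurableT_comp (continuous_measurable_fun (@continuous_sin R)) mp).
Qed.

(** Fubini, together with the symmetry of the kernel in [p] and [x]. *)
Lemma ft_mult (f g : cfun R m) : ctame f -> ctame g ->
  cintegral (fun p => ft f p * g p) = cintegral (fun x => f x * ft g x).
Proof.
move=> tf tg.
have /ctameP[mf [K fK]] := tf; have /ctameP[mg [M gM]] := tg.
have [Jr Ji] : jmeas (fun p x : V => g p * cis (phase p x) * f x).
  apply: (jmeasM (G := fun p x : V => g p * cis (phase p x)) (H := fun _ x => f x)).
    apply: (jmeasM (G := fun p x : V => g p)); last exact: jmeas_phase.
    exact: jmeas_fst.
  exact: jmeas_snd.
transitivity (cintegral (fun p => cintegral (fun x => g p * cis (phase p x) * f x))).
  congr cintegral; apply/funext => p; rewrite mulrC -cintegralZ; last exact: ctame_phase.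
  by congr cintegral; apply/funext => x; rewrite mulrA.
rewrite (@cfubini _ _ _ _ (M * K)).
- congr cintegral; apply/funext => x; rewrite -cintegralZ; last exact: ctame_phase.
  by congr cintegral; apply/funext => p; rewrite phaseC; ring.
- exact: Jr.
- exact: Ji.
- move=> p x; rewrite !Normc.normcM normc_cis mulr1.
  rewrite (_ : M * K * dec p * dec x = (M * dec p) * (K * dec x)); last by ring.
  by apply: ler_pM; [exact: normc_ge0|exact: normc_ge0|exact: gM|exact: fK].
Qed.

(** Uniqueness of limits on the two sides of an identity, each with its own majorant; this is how
    eps tends to 0 in [ft_ft]. *)
Lemma dominated_cintegral_eq n1 n2 (F_ : nat -> cfun R n1) (G_ : nat -> cfun R n2)
    F G K1 K2 :
  (forall k, cmeas (F_ k)) -> cmeas F -> (forall k, cmeas (G_ k)) -> cmeas G ->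
  (forall k x, normc (F_ k x) <= K1 * dec x) ->
  (forall k x, normc (G_ k x) <= K2 * dec x) ->
  (forall x, complex.Re (F_ k x) @[k --> \oo] --> complex.Re (F x)) ->
  (forall x, complex.Im (F_ k x) @[k --> \oo] --> complex.Im (F x)) ->
  (forall x, complex.Re (G_ k x) @[k --> \oo] --> complex.Re (G x)) ->
  (forall x, complex.Im (G_ k x) @[k --> \oo] --> complex.Im (G x)) ->
  (forall k, cintegral (F_ k) = cintegral (G_ k)) -> cintegral F = cintegral G.
Proof.
move=> mF_ mF mG_ mG F1 G2 cFr cFi cGr cGi FG.
have Fr k x : `|complex.Re (F_ k x)| <= K1 * dec x by exact: le_trans (ler_Re_normc _) (F1 k x).
have Fi k x : `|complex.Im (F_ k x)| <= K1 * dec x by exact: le_trans (ler_Im_normc _) (F1 k x).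
have Gr k x : `|complex.Re (G_ k x)| <= K2 * dec x by exact: le_trans (ler_Re_normc _) (G2 k x).
have Gi k x : `|complex.Im (G_ k x)| <= K2 * dec x by exact: le_trans (ler_Im_normc _) (G2 k x).
apply: complex_ext.
  have hF := cvg_integral_cV (fun k => (mF_ k).1) mF.1 Fr cFr.
  have hG := cvg_integral_cV (fun k => (mG_ k).1) mG.1 Gr cGr.
  rewrite /= -(cvg_lim _ hF)// -(cvg_lim _ hG)//; congr (limn _).
  by apply/funext => k; exact: (congr1 (@complex.Re R) (FG k)).
have hF := cvg_integral_cV (fun k => (mF_ k).2) mF.2 Fi cFi.
have hG := cvg_integral_cV (fun k => (mG_ k).2) mG.2 Gi cGi.
rewrite /= -(cvg_lim _ hF)// -(cvg_lim _ hG)//; congr (limn _).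
by apply/funext => k; exact: (congr1 (@complex.Im R) (FG k)).
Qed.

(** For c <= 1, c^2 (1 + t^2) <= 1 + (c t)^2 in every coordinate. *)
Lemma dec_scale (c : R) (p : V) : 0 < c <= 1 -> dec (c *: p) <= (c ^- 2) ^+ m * dec p.
Proof.
move=> /andP[c0 c1].
rewrite -[m in X in _ <= X * _]card_ord -prodr_const /dec -big_split /=.
apply: ler_prod => i _; rewrite (ltW (dec1_gt0 _))/= mxE -invfM.
rewrite lef_pV2 ?posrE ?mulr_gt0 ?exprn_gt0 ?ltr_wpDr ?sqr_ge0//.
rewrite mulrDr mulr1 exprMn lerD2r -(expr1n _ 2).
by rewrite lerXn2r ?nnegrE// ltW.
Qed.

Let eps k : R := k.+1%:R^-1.

Let eps_gt0 k : 0 < eps k. Proof. by rewrite invr_gt0. Qed.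
Let eps_le1 k : eps k <= 1. Proof. by rewrite invf_le1// ler1n. Qed.
Let cvg_eps : eps k @[k --> \oo] --> (0 : R). Proof. exact: cvg_harmonic. Qed.

Let kern y k : cfun R m := fun p => cis (phase y p) * (expk (eps k *: p))%:C.

Let cmeas_expk k : cmeas (fun p : V => (expk (eps k *: p))%:C).
Proof.
split; last exact: measurable_cst.
apply: continuous_rmeas => p.
apply: (@continuous_comp _ _ _ (fun p : V => eps k *: p) (@expk R m)).
  exact: scaler_continuous.
exact: continuous_expk.
Qed.

Let ctame_kern y k : ctame (kern y k).
Proof.
apply: ctame_phase; apply/ctameP; split; first exact: cmeas_expk.
exists (4 ^+ m * (eps k ^- 2) ^+ m) => p.
rewrite normc_real gtr0_norm ?expk_gt0//; apply: le_trans (expk_le_dec _) _.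
by rewrite -mulrA ler_wpM2l ?exprn_ge0// dec_scale// eps_gt0 eps_le1.
Qed.

(** The substitution q = eps p reduces this to [cintegral_expk]. As a function of [x] the result is
    a Poisson kernel that concentrates at -y when eps tends to 0. *)
Let ft_kern y k x : ft (kern y k) x =
  ((eps k)^-1 ^+ m * (2 ^+ m * dec ((hbar * eps k)^-1 *: (x + y))))%:C.
Proof.
pose w : 'cV[R]_m := (hbar * eps k)^-1 *: (x + y).
have eu : ((eps k)%:M : 'M[R]_m) \in unitmx.
  by rewrite unitmxE det_scalar unitrX// unitfE gt_eqF.
apply: etrans (esym (rmorphM (real_complex R) _ _)).
apply: etrans (congr1 ( *%R _) (cintegral_expk w)).
have := cintegral_mulmx (fun q => cis (- dot w q) * (expk q)%:C) eu.
rewrite det_scalar normrX gtr0_norm// -exprVn => E.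
apply: etrans _ E.
congr cintegral; apply/funext => p; rewrite /kern mulrA -cisD mul_scalar_mx.
congr (cis _ * _); rewrite dotZr dotZl dotDl /phase; field.
by rewrite !gt_eqF.
Qed.

(** The multiplication formula pairs [ft f] with [kern y k] and [f] with its transform. As [k]
    grows, the first pairing tends to the left-hand side, and the second, rescaled around -y, to
    f(-y) times the integral of a fixed kernel. *)
Lemma ft_ft (f : cfun R m) y : schwartz f ->
  ft (ft f) y = ((2 * pi * hbar) ^+ m)%:C * f (- y).
Proof.
move=> sf; have tf := schwartz_ctame sf; have sft := schwartz_ft hbar_gt0 sf.
have [K K0 ftK] := rapid_decay 0 (schwartz_rapid sft).
have [C fC] := schwartz_rapid sf 0%N.
have [dfr dfi] := cdiff_continuous (schwartz_cdiff sf).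
have mdec : cmeas (fun u : V => (2 ^+ m * dec u)%:C).
  by split; [apply: measurable_funM => //; exact: rmeas_dec|exact: measurable_cst].
pose L k (u : V) := (hbar * eps k) *: u - y.
have cL u : L k u @[k --> \oo] --> - y.
  rewrite -[X in _ --> X]add0r -(scale0r u); apply: cvgB; last exact: cvg_cst.
  apply: cvgZr_tmp; rewrite -(mulr0 hbar); apply: cvgMl_tmp; exact: cvg_eps.
(* The second pairing after the substitution x = L k u: the factor eps^-m of [ft_kern] and the
   Jacobian (hbar eps)^m leave hbar^m. [G] is the pointwise limit. *)
pose G_ k : cfun R m := fun u => (hbar ^+ m)%:C * (f (L k u) * (2 ^+ m * dec u)%:C).
pose G : cfun R m := fun u => (hbar ^+ m)%:C * (f (- y) * (2 ^+ m * dec u)%:C).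
have tdec : ctame (fun u : V => (2 ^+ m * dec u)%:C).
  apply/ctameP; split => //; exists (2 ^+ m) => u.
  by rewrite normc_real ger0_norm// mulr_ge0 ?exprn_ge0 ?dec_ge0.
have GE : cintegral G = ((2 * pi * hbar) ^+ m)%:C * f (- y).
  rewrite /G cintegralZ; last exact: ctameZ.
  rewrite cintegralZ//.
  have -> : cintegral (fun u : V => (2 ^+ m * dec u)%:C) = ((2 * pi) ^+ m)%:C.
    apply: complex_ext => /=.
      by rewrite /re_fun /= integral_cVZ ?integral_cV_dec ?exprMn//; exact: tame_dec.
    rewrite -[RHS](mul0r (integral_cV (@dec R m))) -integral_cVZ; last exact: tame_dec.
    by congr integral_cV; apply/funext => u; rewrite mul0r.
  rewrite (_ : (2 * pi * hbar) ^+ m = hbar ^+ m * (2 * pi) ^+ m); last first.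
    by rewrite -exprMn mulrC.
  have -> : (hbar ^+ m * (2 * pi) ^+ m)%:C = (hbar ^+ m)%:C * ((2 * pi) ^+ m)%:C.
    exact: (rmorphM (real_complex R)).
  by ring.
have mfL k : cmeas (fun u => f (L k u)).
  have eu : ((hbar * eps k)%:M : 'M[R]_m) \in unitmx.
    by rewrite unitmxE det_scalar unitrX// unitfE gt_eqF// mulr_gt0.
  have := ctame_meas (schwartz_ctame (schwartz_affine (- y) eu sf)); congr cmeas.
  by apply/funext => u; rewrite mul_scalar_mx.
have fC' u : normc (f u) <= C by have := fC u; rewrite expr0 mul1r.
have tG_ k : ctame (fun u => f (L k u) * (2 ^+ m * dec u)%:C).
  exact: ctameMb (mfL k) (fun u => fC' (L k u)) tdec.
have ek (p : V) : expk (eps k *: p) @[k --> \oo] --> (1 : R).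
  have e0 : expk (0 : V) = 1 :> R.
    by rewrite /expk big1 ?oppr0 ?expR0// => i _; rewrite mxE normr0.
  rewrite -[X in _ --> X]e0.
  have e1 : eps k *: p @[k --> \oo] --> (0 : V).
    by rewrite -(scale0r p); apply: cvgZr_tmp; exact: cvg_eps.
  exact: (@cvg_comp _ _ _ (fun k => eps k *: p) (@expk R m) _ _ _ e1 (@continuous_expk R m 0)).
rewrite -GE.
(* On the left [expk] is at most 1 and [ft f] is dominated by [K * dec]; on the right [f] is bounded
   by [C] and [dec] is already a factor. *)
apply: (@dominated_cintegral_eq _ _ (fun k p => ft f p * kern y k p) G_ _ _ K
  (hbar ^+ m * (C * 2 ^+ m))).
- by move=> k; apply: cmeasM; apply: ctame_meas => //; exact: schwartz_ctame.
- exact/ctame_meas/ctame_phase/schwartz_ctame.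
- by move=> k; exact/ctame_meas/ctameZ/tG_.
- by apply/ctame_meas/ctameZ/ctameZ.
- move=> k p; rewrite !Normc.normcM normc_cis mul1r normc_real gtr0_norm ?expk_gt0//.
  have := ftK p; rewrite expr0 mul1r; apply: le_trans.
  by rewrite ler_piMr ?normc_ge0// expk_le1.
- move=> k u; rewrite !Normc.normcM !normc_real.
  rewrite !ger0_norm ?mulr_ge0 ?exprn_ge0 ?dec_ge0//; last exact: ltW.
  rewrite -mulrA ler_wpM2l ?exprn_ge0//; first exact: ltW.
  by rewrite mulrA -mulrA -[X in _ <= X]mulrA ler_wpM2r ?mulr_ge0 ?exprn_ge0 ?dec_ge0.
- move=> p; set c := cis (phase y p) * ft f p.
  have -> : (fun k => complex.Re (ft f p * kern y k p)) =
      (fun k => expk (eps k *: p) * complex.Re c).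
    by apply/funext => k; rewrite /c /kern !ReImE /=; ring.
  by rewrite -[X in _ --> X]mul1r; apply: cvgMr_tmp; exact: ek.
- move=> p; set c := cis (phase y p) * ft f p.
  have -> : (fun k => complex.Im (ft f p * kern y k p)) =
      (fun k => expk (eps k *: p) * complex.Im c).
    by apply/funext => k; rewrite /c /kern !ReImE /=; ring.
  by rewrite -[X in _ --> X]mul1r; apply: cvgMr_tmp; exact: ek.
- move=> u.
  have H z : complex.Re ((hbar ^+ m)%:C * (z * (2 ^+ m * dec u)%:C)) =
      hbar ^+ m * (2 ^+ m * dec u) * complex.Re z by rewrite !ReImE /=; ring.
  under eq_fun do rewrite H.
  rewrite H; apply: cvgMl_tmp.
  exact: (@cvg_comp _ _ _ (L^~ u) (re_fun f) _ _ _ (cL u) (dfr _)).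
- move=> u.
  have H z : complex.Im ((hbar ^+ m)%:C * (z * (2 ^+ m * dec u)%:C)) =
      hbar ^+ m * (2 ^+ m * dec u) * complex.Im z by rewrite !ReImE /=; ring.
  under eq_fun do rewrite H.
  rewrite H; apply: cvgMl_tmp.
  exact: (@cvg_comp _ _ _ (L^~ u) (im_fun f) _ _ _ (cL u) (dfi _)).
- move=> k; rewrite (ft_mult tf (ctame_kern y k)).
  under eq_fun do rewrite ft_kern.
  pose c := hbar * eps k; have c0 : 0 < c by exact: mulr_gt0.
  have eu : ((c^-1)%:M : 'M[R]_m) \in unitmx.
    by rewrite unitmxE det_scalar unitrX// unitfE invr_eq0 gt_eqF.
  pose h : cfun R m := fun u => ((eps k)^-1 ^+ m)%:C * (f (L k u) * (2 ^+ m * dec u)%:C).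
  have -> : (fun x => f x * ((eps k)^-1 ^+ m * (2 ^+ m * dec (c^-1 *: (x + y))))%:C) =
      (fun x => h ((c^-1)%:M *m (x + y))).
    apply/funext => x; rewrite /h /L mul_scalar_mx scalerA mulfV ?gt_eqF// scale1r addrK.
    apply: etrans (congr1 ( *%R (f x)) (rmorphM (real_complex R) _ _)) _.
    by rewrite mulrCA.
  rewrite (cintegral_translate y (fun x => h ((c^-1)%:M *m x))) (cintegral_mulmx h eu).
  rewrite /h /G_ [in LHS]cintegralZ ?[in RHS]cintegralZ// mulrA; congr (_ * _).
  apply: etrans (esym (rmorphM (real_complex R) _ _)) _; congr (_%:C).
  rewrite det_scalar normrX gtr0_norm ?invr_gt0// !exprVn invrK /c exprMn.
  by rewrite -exprVn mulfK// gt_eqF// exprn_gt0// eps_gt0.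
Qed.

End inversion.

(** * Metaplectic operators *)

Section metaplectic_invariants.
Context (R : realType) (hbar : R) (hbar_gt0 : 0 < hbar) (n : nat).
Local Notation ft := (@ft R hbar n).
Local Notation phase := (@phase R hbar n).
Local Notation heis := (@heisenberg R hbar n).

Lemma ctame_schwartzM (f g : cfun R n) : schwartz f -> schwartz g ->
  ctame (fun x => f x * g x).
Proof.
move=> sf sg; have [C fC] := schwartz_rapid sf 0%N.
apply: (@ctameMb _ _ f _ C) (schwartz_ctame sg).
  exact/ctame_meas/schwartz_ctame.
by move=> x; have := fC x; rewrite expr0 mul1r.
Qed.

Lemma schwartz_heisenberg z (f : cfun R n) : schwartz f -> schwartz (heis z f).
Proof.
move=> /(schwartz_translate (- usubmx z)) sf; apply: schwartz_cisM sf.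
have := affine_gradient_dot (dsubmx z) hbar^-1
  (- (dot (dsubmx z) (usubmx z) / 2 / hbar)).
by congr affine_gradient; apply/funext => x; rewrite mulrBl mulrC.
Qed.

Lemma ftZ c (f : cfun R n) p : ctame f -> ft (fun x => c * f x) p = c * ft f p.
Proof.
move=> tf; rewrite /ft -cintegralZ; last exact: ctame_phase.
by congr cintegral; apply/funext => x; rewrite mulrCA.
Qed.

Lemma unitmxN1 k : (- 1%:M : 'M[R]_k) \in unitmx.
Proof. by rewrite -scaleN1r unitmxZ ?unitmx1// unitfE oppr_eq0 oner_eq0. Qed.

Lemma schwartzN (f : cfun R n) : schwartz f -> schwartz (fun x => f (- x)).
Proof.
move=> /(schwartz_mulmx (unitmxN1 n)); congr schwartz.
by apply/funext => x; rewrite mulNmx mul1mx.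
Qed.

Lemma cintegral_reflect (f : cfun R n) : cintegral (fun x => f (- x)) = cintegral f.
Proof.
have := cintegral_mulmx f (unitmxN1 n).
rewrite -scaleN1r detZ det1 mulr1 normrX normrN1 expr1n invr1 mul1r => <-.
by congr cintegral; apply/funext => x; rewrite scaleN1r mulNmx mul1mx.
Qed.

Lemma ft_reflect (f : cfun R n) p : ft (fun x => f (- x)) p = ft f (- p).
Proof.
rewrite /ft -[RHS]cintegral_reflect; congr cintegral; apply/funext => x.
by rewrite /phase dotNl dotNr opprK.
Qed.

Lemma ft_conjc (f : cfun R n) p : ctame f ->
  (ft f p)^* = ft (fun x => (f x)^*) (- p).
Proof.
move=> tf; rewrite /ft -cintegralJ; last exact: ctame_phase.
congr cintegral; apply/funext => x; rewrite conjc_mulc conjc_cis.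
by rewrite /phase dotNl mulNr.
Qed.

(** The conjugate of [ft g] is the reflected transform of the conjugate of [g]; after the
    multiplication formula a double transform appears, to which inversion applies. *)
Lemma parseval (f g : cfun R n) : schwartz f -> schwartz g ->
  cintegral (fun p => ft f p * conjc (ft g p)) =
  ((2 * pi * hbar) ^+ n)%:C * cintegral (fun x => f x * conjc (g x)).
Proof.
move=> sf sg; have sgc := schwartzJ sg.
rewrite ft_mult; [|exact: schwartz_ctame|exact/ctameJ/schwartz_ctame/schwartz_ft].
rewrite -cintegralZ; last exact: ctame_schwartzM.
congr cintegral; apply/funext => x; rewrite mulrCA; congr (_ * _).
rewrite (_ : (fun p => conjc (ft g p)) = (fun p => ft (fun y => conjc (g y)) (- p))).
  by rewrite ft_reflect ft_ft// opprK.
by apply/funext => p; rewrite ft_conjc//; exact: schwartz_ctame.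
Qed.

Lemma ft_heisenberg z (f : cfun R n) p : ctame f ->
  ft (heis z f) p = cis ((- dot (usubmx z) p + dot (usubmx z) (dsubmx z) / 2) / hbar) *
    ft f (p - dsubmx z).
Proof.
move=> tf; rewrite /ft -(cintegral_translate (usubmx z)) -cintegralZ; last exact: ctame_phase.
congr cintegral; apply/funext => x; rewrite /heisenberg addrK !mulrA -!cisD.
congr (cis _ * _); rewrite /phase !(dotDl, dotDr, dotNl).
rewrite (dotC (dsubmx z) (usubmx z)) (dotC p (usubmx z)); field.
by rewrite gt_eqF.
Qed.

(** What is required of a metaplectic operator on Schwartz functions: with surjectivity and
    injectivity [op_inv] is a genuine inverse, and isometry transports matrix coefficients. *)
Record schwartz_unitary (S : operator R n) : Prop := SchwartzUnitary {
  su_schwartz : forall f, schwartz f -> schwartz (S f);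
  su_surj : forall f, schwartz f -> exists2 g, schwartz g & S g = f;
  su_inj : forall f g, schwartz f -> schwartz g -> S f = S g -> f = g;
  su_isometry : forall f g, schwartz f -> schwartz g ->
    cintegral (fun x => S f x * conjc (S g x)) = cintegral (fun x => f x * conjc (g x)) }.

Definition covariant (S : operator R n) (s : 'M[R]_(n + n)) :=
  forall z f, schwartz f -> S (heis z f) = heis (s *m z) (S f).

Let kappa : R[i] := cis (- (n%:R * pi / 4)) * ((Num.sqrt (2 * pi * hbar)) ^- n)%:C.

Let JhatE f p : Jhat hbar f p = kappa * ft f p.
Proof. by rewrite /Jhat /fourier mulrA. Qed.

Let h0 : 0 < 2 * pi * hbar. Proof. by rewrite !mulr_gt0// pi_gt0. Qed.

Let D0 : ((2 * pi * hbar) ^+ n)%:C != 0.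
Proof.
apply/eqP => /(congr1 (@complex.Re R)) /=; apply/eqP.
by rewrite expf_neq0// gt_eqF.
Qed.

Let kappaK : kappa * conjc kappa * ((2 * pi * hbar) ^+ n)%:C = 1.
Proof.
rewrite /kappa conjc_mulc conjc_cis conjc_realc mulrACA -cisD subrr cis0 mul1r.
apply: complex_ext; rewrite !ReImE /=; last by ring.
rewrite !(mulr0, mul0r, subr0) -invfM -exprMn -expr2 sqr_sqrtr ?(ltW h0)// mulVf//.
by rewrite expf_neq0// gt_eqF.
Qed.

Let kappa0 : kappa != 0.
Proof. by apply/eqP => k0; move/eqP: kappaK; rewrite k0 !mul0r eq_sym oner_eq0. Qed.

Lemma schwartz_unitary_J : schwartz_unitary (Jhat hbar (n:=n)).
Proof.
split.
- move=> f sf; have := schwartzZ kappa (schwartz_ft hbar_gt0 sf); congr schwartz.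
  by apply/funext => p; rewrite JhatE.
- move=> f sf; have sfN := schwartzN sf.
  (* Two transforms compose to a multiple of the reflection, so the preimage is the transform of the
     reflected function, divided by the constants. *)
  exists (fun x => (kappa * ((2 * pi * hbar) ^+ n)%:C)^-1 * ft (fun y => f (- y)) x).
    exact/schwartzZ/schwartz_ft.
  apply/funext => p; rewrite JhatE ftZ; last exact/schwartz_ctame/schwartz_ft.
  by rewrite ft_ft// opprK; field; rewrite kappa0 D0.
- move=> f g sf sg fg.
  have E : ft f = ft g.
    by apply/funext => p; have := congr1 (@^~ p) fg; rewrite !JhatE; exact: mulfI.
  apply/funext => x; have := ft_ft hbar_gt0 (- x) sf.
  by rewrite E ft_ft// opprK => /(mulfI D0).
- move=> f g sf sg.
  transitivity (cintegral (fun p => kappa * conjc kappa * (ft f p * conjc (ft g p)))).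
    by congr cintegral; apply/funext => p; rewrite !JhatE conjc_mulc mulrACA.
  rewrite cintegralZ.
    by rewrite parseval// mulrA kappaK mul1r.
  by apply: ctame_schwartzM; [|apply: schwartzJ]; exact: schwartz_ft.
Qed.

Lemma usub_J (z : 'cV[R]_(n + n)) : usubmx (Jmx R n *m z) = dsubmx z.
Proof.
by rewrite -{1}(vsubmxK z) mul_block_col col_mxKu mul0mx mul1mx add0r.
Qed.

Lemma dsub_J (z : 'cV[R]_(n + n)) : dsubmx (Jmx R n *m z) = - usubmx z.
Proof.
by rewrite -{1}(vsubmxK z) mul_block_col col_mxKd mul0mx mulNmx mul1mx addr0.
Qed.

Lemma covariant_J : covariant (Jhat hbar (n:=n)) (Jmx R n).
Proof.
move=> z f sf; apply/funext => p; rewrite JhatE ft_heisenberg; last exact: schwartz_ctame.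
rewrite /heisenberg JhatE usub_J dsub_J mulrCA !dotNl; congr (cis _ * _); field.
by rewrite gt_eqF.
Qed.

End metaplectic_invariants.

Section metaplectic_cases.
Context (R : realType) (hbar : R) (hbar_gt0 : 0 < hbar) (n : nat).
Local Notation unitary := (@schwartz_unitary R n).
Local Notation covariant := (@covariant R hbar n).
Implicit Types (S : operator R n) (s : 'M[R]_(n + n)).

Let usub_block (A B C D : 'M[R]_n) (z : 'cV[R]_(n + n)) :
  usubmx (block_mx A B C D *m z) = A *m usubmx z + B *m dsubmx z.
Proof. by rewrite -{1}(vsubmxK z) mul_block_col col_mxKu. Qed.

Let dsub_block (A B C D : 'M[R]_n) (z : 'cV[R]_(n + n)) :
  dsubmx (block_mx A B C D *m z) = C *m usubmx z + D *m dsubmx z.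
Proof. by rewrite -{1}(vsubmxK z) mul_block_col col_mxKd. Qed.

Section dilation.
Variables (L : 'M[R]_n) (m : int) (Lu : L \in unitmx).

Let mu : R[i] := ((0 : R) +i* 1) ^ m * (Num.sqrt `|\det L|)%:C.

Let i_unit : ((0 : R) +i* 1) \is a @GRing.unit R[i].
Proof. by rewrite unitfE; apply/eqP => /(congr1 (@complex.Im R)) /= /eqP; rewrite oner_eq0. Qed.

Let i_conj : ((0 : R) +i* 1) * conjc ((0 : R) +i* 1) = 1.
Proof. by apply: complex_ext; rewrite !ReImE /=; ring. Qed.

Let im_conj : ((0 : R) +i* 1) ^ m * conjc (((0 : R) +i* 1) ^ m) = 1.
Proof.
rewrite (rmorphXz (@conjc R) m i_unit) -exprzMl ?i_conj ?exp1rz//.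
by rewrite unitfE fmorph_eq0 -unitfE.
Qed.

Let detL0 : 0 < `|\det L|. Proof. by rewrite normr_gt0 -unitfE -unitmxE. Qed.

Let mu_conj : mu * conjc mu = (`|\det L|)%:C.
Proof.
rewrite /mu conjc_mulc conjc_realc mulrACA im_conj mul1r.
apply: complex_ext; rewrite !ReImE /=; last by ring.
by rewrite !mulr0 subr0 -expr2 sqr_sqrtr ?(ltW detL0).
Qed.

Let mu0 : mu != 0.
Proof.
apply/eqP => E; move: mu_conj; rewrite E mul0r => /(congr1 (@complex.Re R)) /= H.
by move: detL0; rewrite -H ltxx.
Qed.

(** Isometry holds because |mu|^2 = |det L| cancels the Jacobian of x -> L x. *)
Lemma schwartz_unitary_M : unitary (Mhat L m).
Proof.
split.
- move=> f sf; exact/schwartzZ/schwartz_mulmx.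
- move=> f sf; exists (fun x => mu^-1 * f (invmx L *m x)).
    by apply/schwartzZ/schwartz_mulmx; rewrite ?unitmx_inv.
  by apply/funext => x; rewrite /Mhat -/mu mulmxA mulVmx// mul1mx mulVKf.
- move=> f g _ _ fg; apply/funext => x; have := congr1 (@^~ (invmx L *m x)) fg.
  by rewrite /Mhat -/mu mulmxA mulmxV// mul1mx => /(mulfI mu0).
- move=> f g sf sg.
  pose h x := f x * conjc (g x).
  transitivity (cintegral (fun x => mu * conjc mu * h (L *m x))).
    by congr cintegral; apply/funext => x; rewrite /h /Mhat -/mu conjc_mulc mulrACA.
  have th : ctame h by apply: ctame_schwartzM => //; exact: schwartzJ.
  rewrite (cintegral_mulmx (fun x => mu * conjc mu * h x) Lu) cintegralZ// mu_conj mulrA.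
  rewrite (_ : (`|\det L|^-1)%:C * (`|\det L|)%:C = 1) ?mul1r//.
  apply: complex_ext; rewrite !ReImE /=; last by ring.
  by rewrite mulr0 subr0 mulVf// gt_eqF.
Qed.

Lemma covariant_M : covariant (Mhat L m) (block_mx (invmx L) 0 0 L^T).
Proof.
move=> z f sf; apply/funext => x.
rewrite /Mhat /heisenberg usub_block dsub_block !mul0mx addr0 add0r.
rewrite mulrCA; congr (cis ((_ - _ / 2) / _) * (_ * f _)).
- by rewrite dot_mulmx trmxK.
- by rewrite dot_mulmx trmxK mulmxA mulmxV// mul1mx.
- by rewrite mulmxBr mulmxA mulmxV// mul1mx.
Qed.

End dilation.

Lemma schwartz_Vhat (P : 'M[R]_n) f : schwartz f -> schwartz (Vhat hbar P f).
Proof.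
move=> sf; apply: schwartz_cisM sf.
have := affine_gradient_quadratic ((2 * hbar)^-1 *: P) 0 0.
by congr affine_gradient; apply/funext => x; rewrite -scalemxAl dotZl dot0l !addr0 mulrC.
Qed.

Let VhatK (P : 'M[R]_n) f : Vhat hbar P (Vhat hbar (- P) f) = f.
Proof.
apply/funext => x; rewrite /Vhat mulrA -cisD mulNmx dotNl -mulrDl subrr mul0r.
by rewrite cis0 mul1r.
Qed.

Lemma schwartz_unitary_V (P : 'M[R]_n) : unitary (Vhat hbar P).
Proof.
split.
- exact: schwartz_Vhat.
- by move=> f sf; exists (Vhat hbar (- P) f); [exact: schwartz_Vhat|exact: VhatK].
- move=> f g _ _ fg; rewrite -(VhatK (- P) f) -(VhatK (- P) g) opprK.
  by rewrite fg.
- move=> f g sf sg; congr cintegral; apply/funext => x.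
  by rewrite /Vhat conjc_mulc conjc_cis mulrACA -cisD subrr cis0 mul1r.
Qed.

Lemma covariant_V (P : 'M[R]_n) : P^T = P ->
  covariant (Vhat hbar P) (block_mx 1%:M 0 P 1%:M).
Proof.
move=> PT z f sf; apply/funext => x.
rewrite /Vhat /heisenberg usub_block dsub_block !mul1mx !mul0mx addr0.
rewrite !mulrA -!cisD; congr (cis _ * _).
move: (usubmx z) (dsubmx z) => x0 p0.
have E : dot (P *m x) x0 = dot (P *m x0) x by rewrite dot_mulmx PT dotC.
rewrite mulmxBr !(dotDl, dotDr, dotNl, dotNr) E; field.
by rewrite gt_eqF.
Qed.

Lemma schwartz_unitary_comp S S' : unitary S -> unitary S' -> unitary (S \o S').
Proof.
move=> [S1 S2 S3 S4] [T1 T2 T3 T4]; split=> /=.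
- by move=> f /T1/S1.
- by move=> f /S2[g /T2[h sh <-] <-]; exists h.
- by move=> f g sf sg /S3 E; apply: T3 => //; apply: E; exact: T1.
- by move=> f g sf sg; rewrite S4 ?T4//; exact: T1.
Qed.

Lemma op_invP S f : unitary S -> schwartz f ->
  schwartz (op_inv S f) /\ S (op_inv S f) = f.
Proof.
move=> [_ S2 _ _] /S2[g sg gf].
by have := @xgetPex _ (fun=> 0) [set chi | schwartz chi /\ S chi = f] (ex_intro _ g (conj sg gf)).
Qed.

Lemma op_invK S f : unitary S -> schwartz f -> op_inv S (S f) = f.
Proof.
move=> uS sf; have [s1 e1] := op_invP uS (su_schwartz uS sf).
exact: (su_inj uS).
Qed.

Lemma schwartz_unitary_inv S : unitary S -> unitary (op_inv S).
Proof.
move=> uS; split.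
- by move=> f /(op_invP uS)[].
- by move=> f sf; exists (S f); [exact: su_schwartz|exact: op_invK].
- move=> f g /(op_invP uS)[_ {2}<-] /(op_invP uS)[_ {2}<-] ->.
  by [].
- move=> f g /(op_invP uS)[sf Sf] /(op_invP uS)[sg Sg].
  by rewrite -(su_isometry uS)// Sf Sg.
Qed.

Lemma schwartz_unitary_eq S S' : (forall f, schwartz f -> S f = S' f) ->
  unitary S -> unitary S'.
Proof.
move=> SS' [S1 S2 S3 S4]; split.
- by move=> f sf; rewrite -SS'//; exact: S1.
- by move=> f /S2[g sg gf]; exists g => //; rewrite -SS'.
- by move=> f g sf sg; rewrite -!SS'//; exact: S3.
- by move=> f g sf sg; rewrite -!SS'//; exact: S4.
Qed.

Lemma Mp_proj_unitary S s : Mp_proj hbar S s -> unitary S.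
Proof.
elim=> {S s} [|L m [Lu _]|P _|S S' s s' _ u _ u'|S s _ u|S S' s SS' _ u].
- exact: schwartz_unitary_J.
- exact: schwartz_unitary_M.
- exact: schwartz_unitary_V.
- exact: schwartz_unitary_comp.
- exact: schwartz_unitary_inv.
- exact: schwartz_unitary_eq SS' u.
Qed.

(** J^2 = -1 exhibits -J s^T J as a left inverse. *)
Lemma symplectic_unit s : s^T *m Jmx R n *m s = Jmx R n -> s \in unitmx.
Proof.
move=> h.
have JJ : Jmx R n *m Jmx R n = - 1%:M.
  rewrite /Jmx mulmx_block.
  rewrite !(mulmx0, mul0mx, mulmx1, mul1mx, mulNmx, mulmxN, addr0, add0r).
  by rewrite scalar_mx_block opp_block_mx !oppr0.
have : - (Jmx R n *m s^T *m Jmx R n) *m s = 1%:M.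
  by rewrite mulNmx -!mulmxA (mulmxA s^T) h JJ opprK.
by move=> /mulmx1_unit[].
Qed.

Lemma Mp_proj_covariant S s : Mp_proj hbar S s -> covariant S s.
Proof.
elim=> {S s} [|L m [Lu _]|P PT|S S' s s' _ c h' c'|S s h c|S S' s SS' _ c].
- exact: covariant_J.
- exact: covariant_M.
- exact: covariant_V.
- move=> z f sf /=; rewrite c' // c ?mulmxA//.
  exact: (su_schwartz (Mp_proj_unitary h') sf).
- move=> z f sf; have uS := Mp_proj_unitary h.
  have su := symplectic_unit (Mp_proj_symplectic h).
  have [si Si] := op_invP uS sf.
  (* With [f] written as [S (op_inv S f)] and [z] as s (s^-1 z), covariance of [S] applies from
     right to left. *)
  rewrite -[in LHS]Si -{1}(mul1mx z) -(mulmxV su) -mulmxA -c// op_invK//.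
  exact: schwartz_heisenberg.
- by move=> z f sf; rewrite -!SS'// ?c//; exact: schwartz_heisenberg.
Qed.

End metaplectic_cases.

(** * Covariance of Born-Jordan operators *)

Section covariance.
Context (R : realType) (hbar : R) (hbar_gt0 : 0 < hbar) (n : nat).
Local Notation V := 'cV[R]_n.
Local Notation normc := Normc.normc.
Local Notation heis := (@heisenberg R hbar n).
Implicit Types (S : operator R n) (s : 'M[R]_(n + n)).

Lemma ThetaN (z z' : 'cV[R]_(n + n)) :
  dot (dsubmx z') (usubmx z') = - dot (dsubmx z) (usubmx z) ->
  Theta hbar z' = Theta hbar z.
Proof. by move=> E; rewrite /Theta E mulNr oppr_eq0 sinN invrN mulrNN. Qed.

(** Existential, because the matrix given in the theorem may have been derived through [Vhat], whose
    shears in general change [Theta]. *)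
Lemma JM_group_Theta S : JM_group hbar S ->
  exists2 s, Mp_proj hbar S s & forall z, Theta hbar (s *m z) = Theta hbar z.
Proof.
elim=> {S} [|L m Lm|S S' _ [s h e] _ [s' h' e']|S _ [s h e]|S S' SS' _ [s h e]].
- exists (Jmx R n); first exact: Mp_proj_J.
  by move=> z; apply: ThetaN; rewrite usub_J dsub_J dotNl dotC.
- exists (block_mx (invmx L) 0 0 L^T); first exact: Mp_proj_M Lm.
  move=> z; rewrite -{1}(vsubmxK z) mul_block_col !mul0mx addr0 add0r.
  rewrite /Theta col_mxKu col_mxKd dot_mulmx trmxK mulmxA mulmxV ?mul1mx//.
  by case: Lm.
- exists (s *m s'); first exact: Mp_proj_comp.
  by move=> z; rewrite -mulmxA e e'.
- exists (invmx s); first exact: Mp_proj_inv.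
  move=> z; have su := symplectic_unit (Mp_proj_symplectic h).
  by rewrite -e mulmxA mulmxV// mul1mx.
- by exists s => //; exact: Mp_proj_eq h.
Qed.

Lemma cintegral0 m : cintegral (fun _ : 'cV[R]_m => 0 : R[i]) = 0.
Proof.
rewrite -[RHS](mul0r (cintegral (fun _ : 'cV[R]_m => 0 : R[i]))).
rewrite -cintegralZ; last exact/schwartz_ctame/schwartz0.
by congr cintegral; apply/funext => x; rewrite mul0r.
Qed.

(** Along the points x + k d the modulus keeps its value at [x]; if [d] were nonzero, these points
    would run off to infinity, against rapid decay. *)
Lemma schwartz_periodic (f : cfun R n) d x : schwartz f ->
  (forall y, normc (f (y + d)) = normc (f y)) -> normc (f x) != 0 -> d = 0.
Proof.
move=> sf fd fx0; apply/eqP; apply: contraT => d0.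
have [C fC] := schwartz_rapid sf 1.
have fk k : normc (f (x + k%:R *: d)) = normc (f x).
  elim: k => [|k IH]; first by rewrite scale0r addr0.
  by rewrite -natr1 scalerDl scale1r addrA fd.
have fxp : 0 < normc (f x) by rewrite lt_neqAle eq_sym fx0 normc_ge0.
have dp : 0 < `|d| by rewrite normr_gt0.
(* Beyond [B] the triangle inequality gives |x + k d| > C / |f x|, contradicting the decay bound at
   that point. *)
pose B := (C / normc (f x) + `|x|) / `|d|.
have [k Bk] : exists k : nat, B < k%:R.
  by exists (Num.bound `|B|); apply: le_lt_trans (ler_norm _) (archi_boundP _).
have := fC (x + k%:R *: d); rewrite expr1 fk -ler_pdivlMr// => H.
have : `|k%:R *: d| <= `|x + k%:R *: d| + `|x|.
  by rewrite -{1}(addrK x (k%:R *: d)) (addrC (k%:R *: d)); exact: ler_normB.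
move: Bk; rewrite normrZ ger0_norm// /B ltr_pdivrMr// => H1.
move=> /(lt_le_trans H1); rewrite ltrD2r => /lt_trans/(_ (ltr_pwDl ltr01 (lexx _))).
by move=> /lt_le_trans/(_ H); rewrite ltxx.
Qed.

Lemma heisenberg_usub w w' (f : cfun R n) x : schwartz f -> normc (f x) != 0 ->
  heis w f = heis w' f -> usubmx w = usubmx w'.
Proof.
move=> sf fx0 E; apply/eqP; rewrite -subr_eq0; apply/eqP.
apply: (schwartz_periodic (x := x) sf) => // y.
have := congr1 (fun g => normc (g (y + usubmx w))) E.
by rewrite /heisenberg !Normc.normcM !normc_cis !mul1r addrK addrA => <-.
Qed.

Lemma heisenberg_inj w w' (f : cfun R n) : schwartz f -> f <> (fun=> 0) ->
  heis w f = heis w' f -> w = w'.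
Proof.
move=> sf f0 E.
have nz (g : cfun R n) : g <> (fun=> 0) -> exists x, normc (g x) != 0.
  move=> g0; apply: contrapT => H; apply: g0; apply/funext => x.
  apply: Normc.eq0_normc; apply/eqP; apply: contraT => gx.
  by exfalso; apply: H; exists x.
have uJ := schwartz_unitary_J hbar_gt0 n.
have sJf := su_schwartz uJ sf.
have [x fx] := nz _ f0.
have [p Jfp] : exists p, normc (Jhat hbar f p) != 0.
  apply: nz => Jf0; apply: f0; apply: (su_inj uJ) => //; first exact: schwartz0.
  rewrite Jf0; apply/funext => p; rewrite /Jhat /fourier.
  rewrite (_ : (fun x => _) = (fun _ : V => 0)) ?cintegral0 ?mulr0//.
  by apply/funext => y; rewrite mulr0.
rewrite -(vsubmxK w) -(vsubmxK w'); congr col_mx.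
  exact: heisenberg_usub fx E.
have cJ w0 : Jhat hbar (heis w0 f) = heis (Jmx R n *m w0) (Jhat hbar f).
  exact: covariant_J.
have := heisenberg_usub sJf Jfp
  (etrans (esym (cJ w)) (etrans (congr1 (Jhat hbar (n := n)) E) (cJ w'))).
by rewrite !usub_J.
Qed.

Lemma dot_vsubmx (z w : 'cV[R]_(n + n)) :
  dot z w = dot (usubmx z) (usubmx w) + dot (dsubmx z) (dsubmx w).
Proof.
by rewrite [LHS]big_split_ord; congr (_ + _); apply: eq_bigr => i _; rewrite !mxE.
Qed.

Lemma symp_formE (z z' : 'cV[R]_(n + n)) : symp_form z z' = - dot z (Jmx R n *m z').
Proof.
rewrite dot_vsubmx usub_J dsub_J dotNr /symp_form opprD opprK addrC.
by rewrite (dotC (usubmx z)).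
Qed.

Lemma symp_form_invariant s z z' : s^T *m Jmx R n *m s = Jmx R n ->
  symp_form (s *m z) (s *m z') = symp_form z z'.
Proof. by move=> h; rewrite !symp_formE dot_mulmx !mulmxA h. Qed.

Lemma symplectic_det s : s^T *m Jmx R n *m s = Jmx R n -> `|\det s| = 1.
Proof.
move=> h; have Ju : Jmx R n \in unitmx.
  apply: symplectic_unit; have := Mp_proj_symplectic (Mp_proj_J hbar n).
  by [].
have := congr1 determinant h; rewrite !det_mulmx det_tr mulrAC => /eqP.
rewrite -{2}(mul1r (\det (Jmx R n))) (inj_eq (mulIf _)) -?unitfE -?unitmxE//.
by rewrite -expr2 sqr_norm_eq1 => /eqP.
Qed.

Lemma symp_fourier_symplectic s (f : cfun R (n + n)) z :
  s^T *m Jmx R n *m s = Jmx R n ->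
  symp_fourier hbar (fun z => f (s *m z)) z = symp_fourier hbar f (s *m z).
Proof.
move=> h; have su := symplectic_unit h.
have := cintegral_mulmx
  (fun z' => cis (- (symp_form (s *m z) z' / hbar)) * f z') su.
rewrite (symplectic_det h) invr1 mul1r /symp_fourier => <-.
by congr (_ * cintegral _); apply/funext => z'; rewrite symp_form_invariant.
Qed.

End covariance.

Theorem proposition7 (R : realType) (hbar : R) (hbar_gt0 : 0 < hbar) (n : nat)
    (a : functional R (n + n)) (a_tempered : tempered a)
    (S : operator R n) (S_JM : JM_group hbar S)
    (s : 'M[R]_(n + n)) (S_s : Mp_proj hbar S s) :
  forall psi : cfun R n, schwartz psi ->
    dist_eq (op_ext S (OpBJ hbar a (op_inv S psi)))
        (OpBJ hbar (dist_comp a (invmx s)) psi).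
Proof.
move=> psi spsi phi sphi.
have uS := Mp_proj_unitary hbar_gt0 S_s.
have cS := Mp_proj_covariant hbar_gt0 S_s.
have sympl := Mp_proj_symplectic S_s.
have [schi Schi] := op_invP uS spsi.
have [sphi' Sphi'] := op_invP uS (schwartzJ sphi).
pose W z := cintegral (fun x => heisenberg hbar z psi x * phi x).
pose H z := (Theta hbar z)%:C * W z.
(* Isometry applies [S] to both factors: covariance moves [z] to s z in the first, and the
   conjugations built into [op_ext] cancel in the second. *)
have WE z : cintegral (fun x => heisenberg hbar z (op_inv S psi) x *
    conjc (op_inv S (fun y => conjc (phi y)) x)) = W (s *m z).
  rewrite -(su_isometry uS)//; last exact: schwartz_heisenberg.
  rewrite cS// Schi Sphi'; congr cintegral; apply/funext => x.
  by rewrite conjc_conjc.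
have HE z : (Theta hbar z)%:C * W (s *m z) = H (s *m z).
  (* For psi = 0 the vector T(w) psi does not determine [w], but then every matrix coefficient [W w]
     is 0. *)
  have [psi0|psi0] := pselect (psi = fun=> 0).
    have W0 w : W w = 0.
      rewrite -(cintegral0 R n); congr cintegral; apply/funext => x.
      by rewrite psi0 /heisenberg mulr0 mul0r.
    by rewrite /H !W0 !mulr0.
  (* Both [s] and [s0] satisfy covariance for the same [S], which forces s0 z = s z and makes the
     invariance of [Theta] under [s0] available for [s]. *)
  have [s0 S_s0 e] := JM_group_Theta S_JM.
  rewrite /H -{1}e; congr ((Theta _ _)%:C * _).
  apply: (heisenberg_inj hbar_gt0 spsi psi0).
  by rewrite -{1}Schi -(Mp_proj_covariant hbar_gt0 S_s0)// cS// Schi.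
have detV : (`|\det (invmx s)|^-1)%:C = 1 :> R[i].
  by rewrite det_inv normfV invrK (symplectic_det hbar sympl).
pose G z := (Theta hbar z)%:C * cintegral (fun x =>
  heisenberg hbar z (op_inv S psi) x * conjc (op_inv S (fun y => conjc (phi y)) x)).
have GH : G = (fun z => H (s *m z)) by apply/funext => z; rewrite /G WE HE.
(* These are the two functions at which [a] is evaluated; composing the distribution with s^-1 means
   composing its test function with [s], with determinant factor 1. *)
have FGH : (fun z => symp_fourier hbar G (- z)) =
    (fun z => symp_fourier hbar H (- (s *m z))).
  by apply/funext => z; rewrite -mulmxN GH (symp_fourier_symplectic hbar H (- z) sympl).
rewrite /op_ext /OpBJ /dsymp_fourier /dist_comp detV invmxK mul1r.
exact: (congr1 (fun F => ((2 * pi * hbar) ^- n)%:C * a F) FGH).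
Qed.
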